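(* Let $\kappa\in(0,1)$, $\mu\in\mathbb{R}$, $\delta>0$, $\gamma>0$, $\beta>0$, $\lambda>0$, with $\beta<(\gamma^{1/\kappa}-1)/2$, and let $q^*\ge2$ be a fixed integer with $q^*\le\sqrt{\beta^2+\gamma^{1/\kappa}}-\beta$. Let $X(t)$ be a stationary $NTS(\kappa,\gamma,\beta,\mu,\delta)$ Ornstein-Uhlenbeck (OU) type process with parameter $\lambda$ (see context), let $$\Lambda(t)=\exp\{X(t)-c_X\},\qquad c_X=\mu+\delta\gamma-\delta\bigl(\beta^2+\gamma^{1/\kappa}-(\beta+1)^2\bigr)^\kappa,$$ and let $\Lambda^{(j)}$, $j=0,1,2,\dots$, be independent copies of $\Lambda$. Put $Q=\{q:0<q<q^*\}$. Then, for any $$b>\exp\left\{-\delta\gamma+\frac{\delta\bigl(\beta^2+\gamma^{1/\kappa}-(\beta+q^* )^2\bigr)^\kappa-q^*\delta\bigl(\beta^2+\gamma^{1/\kappa}-(\beta+1)^2\bigr)^\kappa}{1-q^*}\right\},$$ the sequence of stochastic processes $$A_n(t)=\int_0^t\prod_{j=0}^n\Lambda^{(j)}(sb^j)\,ds,\qquad t\in[0,1],$$ converges in $\mathcal{L}_q$ to a stochastic process $A(t)$ for each fixed $t\in[0,1]$ as $n\to\infty$, such that $A(1)\in\mathcal{L}_q$ for $q\in Q$, and $$\mathrm{E}A^q(t)\sim t^{\varsigma(q)},\qquad q\in Q,$$ where the scaling function $\varsigma(q)$ is given by $$\varsigma(q)=\left(1-\frac{\delta\left[\bigl(\beta^2+\gamma^{1/\kappa}-(\beta+1)^2\bigr)^\kappa-\gamma\right]}{\log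 b}\right)q+\frac{\delta}{\log b}\bigl(\beta^2+\gamma^{1/\kappa}-(\beta+q)^2\bigr)^\kappa-\frac{\delta\gamma}{\log b},\qquad q\in Q.$$ Moreover, $$\mathrm{Var}\,A(t)\ge\int_0^t\!\!\int_0^t\bigl[M(1,1;u-w)-1\bigr]\,du\,dw,$$ where $M(\zeta_1,\zeta_2;t_1-t_2)=e^{-c_X(\zeta_1+\zeta_2)}\,\mathrm{E}\exp\{\zeta_1X(t_1)+\zeta_2X(t_2)\}$.
   Context: Tempered stable law $TS(\kappa,\delta,\gamma)$, $\kappa\in(0,1)$, $\delta,\gamma>0$: the distribution on $(0,\infty)$ with $\log\mathrm{E}e^{\zeta Y}=\delta\gamma-\delta(\gamma^{1/\kappa}-2\zeta)^\kappa$ for $\zeta<\gamma^{1/\kappa}/2$. Normal tempered stable law $NTS(\kappa,\gamma,\beta,\mu,\delta)$: the law of $\mu+\beta Y+\sqrt{Y}\,\epsilon$, where $Y\sim TS(\kappa,\delta,\gamma)$ and $\epsilon$ is standard normal, independent of $Y$. Its cumulant transform is $\log\mathrm{E}e^{\zeta X}=\mu\zeta+\delta\gamma-\delta(\alpha^2-(\beta+\zeta)^2)^\kappa$ for $|\beta+\zeta|<\alpha=\sqrt{\beta^2+\gamma^{1/\kappa}}$. It is self-decomposable. Stationary OU type process with a given self-decomposable marginal law $D$ and parameter $\lambda>0$: a strictly stationary process with $X(0)\sim D$ and $X(t)=e^{-\lambda t}X(0)+\int_{(0,t]}e^{-\lambda(t-s)}\,dZ(\lambda s)$, $t\ge0$,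 where $Z$ is a L\'evy process independent of $X(0)$ (the background driving L\'evy process, determined by $D$). The mother process $\Lambda$ is measurable and separable. Convergence in $\mathcal{L}_q$ (for $q\in Q$) means $\mathrm{E}|A_n(t)-A(t)|^q\to0$. Notation: $\mathrm{E}A^q(t)\sim t^{p}$ means that there are constants $0<\underline{C}\le\overline{C}<\infty$ (possibly depending on $q$ but not on $t$) with $\underline{C}\,t^{p}\le\mathrm{E}A^q(t)\le\overline{C}\,t^{p}$ for all $t\in[0,1]$. *)

(* Defs.v *)
(* A stochastic process indexed by [0, +oo[ is a function
   X : R -> T -> R; its values at negative times are irrelevant. *)
From HB Require Import structures.
From mathcomp Require Import all_boot all_order all_algebra.
From mathcomp Require Import finmap.
From mathcomp Require Import all_classical all_reals all_analysis.
Import numFieldNormedType.Exports.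
Import Order.TTheory GRing.Theory Num.Theory.

Set Implicit Arguments.
Unset Strict Implicit.
Unset Printing Implicit Defensive.

Local Open Scope classical_set_scope.
Local Open Scope ring_scope.

Section independence.
Context (d : measure_display) (T : measurableType d) (R : realType)
  (P : probability T R).

Definition mutually_independent (I : choiceType) (F : I -> set (set T)) :=
  forall (J : {fset I}) (A : I -> set T),
    (forall i, i \in J -> F i (A i)) ->
    P (\bigcap_(i in [set` J]) A i) = (\prod_(i <- J) P (A i))%E.

Definition independent2 (F G : set (set T)) :=
  forall A B, F A -> G B -> P (A `&` B) = (P A * P B)%E.

Definition sigma_rv (f : T -> R) : set (set T) :=
  preimage_set_system [set: T] f measurable.

Definition sigma_process (X : R -> T -> R) : set (set T) :=
  <<s \bigcup_(t in `[0, +oo[) sigma_rv (X t) >>.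

End independence.

Section processes.
Context (R : realType).

Definition is_process d (T : measurableType d) (X : R -> T -> R) :=
  forall t : R, 0 <= t -> measurable_fun [set: T] (X t).

Definition sample d (T : measurableType d) (X : R -> T -> R) n
    (t : n.-tuple R) (w : T) : n.-tuple R :=
  [tuple of [seq X s w | s <- t]].

Definition same_fdd d (T : measurableType d) (P : probability T R)
    (X : R -> T -> R) d' (T' : measurableType d') (P' : probability T' R)
    (X' : R -> T' -> R) :=
  forall n (t : n.-tuple R) (B : set (n.-tuple R)),
    (forall i, 0 <= tnth t i) -> measurable B ->
    P (sample X t @^-1` B) = P' (sample X' t @^-1` B).

Definition strictly_stationary d (T : measurableType d) (P : probability T R)
    (X : R -> T -> R) :=
  forall h : R, 0 <= h -> same_fdd P (fun t => X (t + h)) P X.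

Definition jointly_measurable d (T : measurableType d) (X : R -> T -> R) :=
  measurable_fun [set p : measurableTypeR R * T | 0 <= p.1]
    (fun p => X p.1 p.2).

(* Separability in the sense of Doob. *)
Definition separable_process d (T : measurableType d) (P : probability T R)
    (X : R -> T -> R) :=
  exists S : set R, [/\ countable S, S `<=` `[0, +oo[ &
    {ae P, forall w, forall (a b : R) (F : set R), closed F ->
      (forall s, (S `&` `]a, b[) s -> F (X s w)) ->
      forall t : R, (`[0, +oo[ `&` `]a, b[) t -> F (X t w)}].

Definition independent_copies d (T : measurableType d) (P : probability T R)
    (X : R -> T -> R) d' (T' : measurableType d') (P' : probability T' R)
    (Xs : nat -> R -> T' -> R) :=
  [/\ forall j, is_process (Xs j),
      forall j, same_fdd P' (Xs j) P X &
      mutually_independent P' (fun j => sigma_process (Xs j))].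

End processes.

Section levy_OU.
Context (R : realType) (d : measure_display) (T : measurableType d)
  (P : probability T R).

Definition cadlag_path (f : R -> R) :=
  (forall t : R, 0 <= t -> f s @[s --> t^'+] --> f t) /\
  (forall t : R, 0 < t -> cvg (f s @[s --> t^'-])).

Definition levy_process (Z : R -> T -> R) :=
  [/\ is_process Z,
      {ae P, forall w, Z 0 w = 0},
      forall n (t : nat -> R), 0 <= t 0%N -> (forall i, t i <= t i.+1) ->
        mutually_independent P
          (fun i : 'I_n => sigma_rv (fun w => Z (t i.+1) w - Z (t i) w)) &
   [/\ forall (s h : R) (B : set R), 0 <= s -> 0 <= h -> measurable B ->
        P [set w | B (Z (s + h) w - Z s w)] = P [set w | B (Z h w - Z 0 w)],
      forall (s e : R), 0 <= s -> 0 < e ->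
        P [set w | e < `|Z u w - Z s w|]
          @[u --> within `[0, +oo[ (nbhs s)] --> 0%E &
      {ae P, forall w, cadlag_path (fun t => Z t w)}]].

(* I is the integral over ]0, t] of the deterministic integrand f against the
   process W: the limit in probability of the tagged Riemann-Stieltjes sums as
   the mesh of the partition tends to 0. *)
Definition is_stochastic_integral (f : R -> R) (W : R -> T -> R) (t : R)
    (I : T -> R) :=
  measurable_fun [set: T] I /\
  forall e : R, 0 < e -> exists2 h : R, 0 < h &
    forall n (s c : nat -> R), s 0%N = 0 -> s n = t ->
      (forall i, (i < n)%N -> s i <= c i <= s i.+1 /\ s i.+1 - s i < h) ->
      (P [set w | e <
         `|\sum_(i < n) f (c i) * (W (s i.+1) w - W (s i) w) - I w|]%R
       <= e%:E)%E.

Definition stationary_OU_process (D : probability (measurableTypeR R) R)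
    (lambda : R) (X : R -> T -> R) :=
  [/\ is_process X,
      strictly_stationary P X,
      forall B : set R, measurable B -> P (X 0 @^-1` B) = D B &
      exists Z : R -> T -> R,
        [/\ levy_process Z,
            independent2 P (sigma_rv (X 0)) (sigma_process Z) &
            forall t : R, 0 <= t -> exists2 I : T -> R,
              is_stochastic_integral (fun s => expR (- lambda * (t - s)))
                (fun s => Z (lambda * s)) t I &
              {ae P, forall w, X t w = expR (- lambda * t) * X 0 w + I w}]].

End levy_OU.

Section tempered_stable.
Context (R : realType).

Definition is_TS (kappa delta gamma : R)
    (nu : probability (measurableTypeR R) R) :=
  nu `]0, +oo[%classic = 1%E /\
  forall z : R, z < gamma `^ kappa^-1 / 2 ->
    lne (\int[nu]_y (expR (z * y))%:E) =
    (delta * gamma - delta * (gamma `^ kappa^-1 - 2 * z) `^ kappa)%:E.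

(* The pair (Y, epsilon) of independent variables is realized by the two
   coordinates of the product space. *)
Definition is_NTS (kappa gamma beta mu delta : R)
    (D : probability (measurableTypeR R) R) :=
  exists2 nu : probability (measurableTypeR R) R, is_TS kappa delta gamma nu &
    forall B : set R, measurable B ->
      D B = (nu \x normal_prob 0 1)%E
        [set p : measurableTypeR R * measurableTypeR R |
          B (mu + beta * p.1 + Num.sqrt p.1 * p.2)].

Definition nts_power (kappa gamma beta z : R) : R :=
  (beta ^+ 2 + gamma `^ kappa^-1 - (beta + z) ^+ 2) `^ kappa.

Definition nts_center (kappa gamma beta mu delta : R) : R :=
  mu + delta * gamma - delta * nts_power kappa gamma beta 1.

Definition scaling_function (kappa gamma beta delta b q : R) : R :=
  (1 - delta * (nts_power kappa gamma beta 1 - gamma) / ln b) * q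
  + delta / ln b * nts_power kappa gamma beta q - delta * gamma / ln b.

End tempered_stable.

Section geometric_OU.
Context (R : realType) (d : measure_display) (T : measurableType d).

Definition mother (X : R -> T -> R) (c : R) : R -> T -> R :=
  fun t w => expR (X t w - c).

(* For a stationary X this depends on t1 - t2 only. *)
Definition joint_mgf (P : probability T R) (X : R -> T -> R)
    (c z1 z2 t1 t2 : R) : \bar R :=
  ((expR (- c * (z1 + z2)))%:E
     * 'E_P[fun w => expR (z1 * X t1 w + z2 * X t2 w)%R])%E.

Definition cascade (Lam : nat -> R -> T -> R) (b : R) (n : nat) (t : R) (w : T)
    : R :=
  \int[lebesgue_measure]_(s in `[0, t]) \prod_(j < n.+1) Lam j (s * b ^+ j) w.

End geometric_OU.

(* Main.v *)
Require Import Defs.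
From HB Require Import structures.
From mathcomp Require Import all_boot all_order all_algebra.
From mathcomp Require Import finmap.
From mathcomp Require Import all_classical all_reals all_analysis.
From mathcomp Require Import measurable_realfun.
From mathcomp Require Import ring lra.
Import numFieldNormedType.Exports.
Import Order.TTheory GRing.Theory Num.Theory.

Set Implicit Arguments.
Unset Strict Implicit.
Unset Printing Implicit Defensive.

Local Open Scope classical_set_scope.
Local Open Scope ring_scope.

(* Write [L_j] for the [j]-th copy of the mother process and [lm q] for its log-moment,
   [E L_j(t)^q = exp (lm q)], so that [lm 1 = 0] and [lm] is convex.  Since [X t] is
   [exp (- lambda t) X_0] plus a variable which, jointly over the times, is independent of
   [X_0], and [X] is stationary, conditioning on the earliest time shows that the
   dependence between [L_j(s)] and [L_j(s + e)] decays like [exp (- lambda e)]; the condition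
   on [b] says [exp (lm q) < b ^ (q - 1)] for [q = q*], hence for [1 < q <= q*].

   Moments of [A_n(1)] are bounded by induction on the integer order [r <= q*]: cut [[0, 1]]
   into blocks of length [b ^ (- i)] with [i] large; products of distant blocks are bounded
   by moments of lower order, and each order-[r] moment of a single block carries the small
   factor [(exp (lm r) / b ^ (r - 1)) ^ i], which absorbs the constants.  The
   increments of [A_n] are orthogonal, which gives the limit in [L_2] and, by
   interpolation with the moment bounds, in [L_q] for [q < q*].  For the scaling, at
   [t = b ^ (- p)] the first [p] factors are stripped one at a time.  On Riemann sums,
   tangent-line inequalities for [x ^ q] reduce one such step to estimating
   [E L_j(s) ^ (q - 1) L_j(s')], which is [exp (lm q)] up to a factor [exp (O(|s' - s|))], and
   these errors are summable; what remains is [b ^ (- p)] times a copy of [A(1)].  The variance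
   bound is the monotonicity of [E A_n(t)^2], starting from [n = 0]. *)

(** * Moments, independence and integrals of random paths *)

(** The layers are dependent in time, so blocks of [[0, 1]] never separate exactly; independence is
    used only across levels, and dependence within a level enters as an error factor. Two opposite
    regimes make these errors summable: for a gap [e] the error at level [j] decays like
    [exp (- lambda e b ^ j)] and sums upwards, while on [[0, t]] level [l] acts on moments like a
    constant up to a factor [1 + O(t b ^ l)], which sums downwards from [t = b ^ (- p)]. The cascade
    is therefore studied for abstract layers with these two properties, and the process enters only
    through the convexity of [lm]. Slopes of [lm] are bounded by chords reaching as far as [-1] and
    [k = q*]; the latter may be the very end of the domain of the cumulant transform, so the moment
    there is obtained as a limit. Only integer moments of order at most [k] are bounded directly;
    other exponents are reached by pointwise inequalities, at the cost of constants that the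
    relation [~] ignores. Finally, the copies share only finite-dimensional laws with the positive
    mother process, and are replaced by everywhere positive, jointly measurable versions with almost
    surely the same cascade. *)

Section real_inequalities.
Context {R : realType}.
Implicit Types (q x y e : R).

(** After division by [y ^ q] this is Bernoulli's inequality for [expR u], with [u = ln x - ln y].
    The point of tangency stays free because it will be random. *)
Lemma powR_tangent_ge q x y : 1 <= q -> 0 <= x -> 0 < y ->
  y `^ q + q * y `^ (q - 1) * (x - y) <= x `^ q.
Proof.
move=> q1 x0 y0.
have yq : y `^ q = y * y `^ (q - 1).
  by rewrite -{2}(powRr1 (ltW y0)) -powRD ?(gt_eqF y0) ?implybT// addrC subrK.
move: x0; rewrite le_eqVlt => /predU1P[<-|x0].
  rewrite powR0 ?gt_eqF ?(lt_le_trans ltr01)//.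
  rewrite yq; have : 0 <= (q - 1) * (y * y `^ (q - 1)); last lra.
  by rewrite mulr_ge0 ?subr_ge0// mulr_ge0 ?powR_ge0// ltW.
have powRE z r : 0 < z -> z `^ r = expR (r * ln z).
  by move=> z0; rewrite /powR gt_eqF.
have h1 : expR (q * (ln x - ln y)) >= 1 + q * (expR (ln x - ln y) - 1).
  set u := ln x - ln y.
  have e1 := expR_ge1Dx ((q - 1) * u); have e2 := expR_ge1Dx (- u).
  have q0 : 0 < q by apply: lt_le_trans q1.
  (* The bound [1 + v <= expR v] at [(q - 1) * u] and at [- u], with weights [q^-1] and [1 - q^-1]:
     the linear terms cancel. *)
  have : expR u * (q^-1 * expR ((q - 1) * u) + (1 - q^-1) * expR (- u)) >= expR u.
    rewrite ler_peMr ?expR_ge0//.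
    have qV : 0 <= 1 - q^-1 by rewrite subr_ge0 invf_le1.
    apply: le_trans (lerD (ler_wpM2l _ e1) (ler_wpM2l qV e2)); last by rewrite invr_ge0 ltW.
    by rewrite le_eqVlt; apply/orP; left; apply/eqP; field; rewrite gt_eqF.
  rewrite mulrDr !(mulrCA (expR u)) -!expRD subrr expR0.
  rewrite (_ : u + (q - 1) * u = q * u); last by ring.
  move=> h; have {h} := ler_wpM2l (ltW q0) h.
  rewrite (_ : q * (_ + _) = expR (q * u) + (q - 1)); first lra.
  by field; rewrite gt_eqF.
have := ler_wpM2l (powR_ge0 y q) h1.
rewrite expRB !lnK//.
rewrite powRE// [X in _ -> _ <= X]powRE// -expRD (_ : q * ln y + _ = q * ln x); last by ring.
rewrite -powRE// => /(le_trans _); apply.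
rewrite yq le_eqVlt; apply/orP; left; apply/eqP; field.
by rewrite gt_eqF.
Qed.

(** The convex case with exponent [q^-1], applied to [x ^ q] and [y ^ q] and solved for [x ^ q]. *)
Lemma powR_tangent_le q x y : 0 < q <= 1 -> 0 <= x -> 0 < y ->
  x `^ q <= y `^ q + q * y `^ (q - 1) * (x - y).
Proof.
move=> /andP[q0 q1] x0 y0.
have yq : y `^ q = y * y `^ (q - 1).
  by rewrite -{2}(powRr1 (ltW y0)) -powRD ?(gt_eqF y0) ?implybT// addrC subrK.
have xqV : (x `^ q) `^ q^-1 = x by rewrite -powRrM divff ?gt_eqF// powRr1.
have := @powR_tangent_ge q^-1 (x `^ q) (y `^ q) _ (powR_ge0 _ _) (powR_gt0 _ y0).
rewrite invf_ge1// xqV -!powRrM divff ?gt_eqF// (powRr1 (ltW y0)).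
rewrite (_ : q * (q^-1 - 1) = 1 - q); last by field; rewrite gt_eqF.
rewrite -(opprB q 1) powRN => /(_ q1) h.
have yq1 := powR_gt0 (q - 1) y0.
have := ler_wpM2l (ltW (mulr_gt0 q0 yq1)) h.
rewrite mulrDr (_ : _ * (_ * (x `^ q - _)) = x `^ q - y `^ q); last first.
  by field; rewrite (gt_eqF q0) (gt_eqF yq1).
lra.
Qed.

Lemma powRD_le q x y : 0 < q -> 0 <= x -> 0 <= y ->
  (x + y) `^ q <= 2 `^ q * (x `^ q + y `^ q).
Proof.
move=> q0; wlog xy : x y / x <= y => [h x0 y0|x0 y0].
  by case: (leP x y) => [/h|/ltW /h]; [exact|rewrite addrC [X in _ * X]addrC; exact].
apply: (@le_trans _ _ ((2 * y) `^ q)).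
  by rewrite ge0_ler_powR ?nnegrE ?addr_ge0 ?mulr_ge0 ?(ltW q0)//; lra.
by rewrite powRM// ler_wpM2l ?powR_ge0// lerDr powR_ge0.
Qed.

(** The constant dominates below [d], the power [k] above [H], and the linear term in between. It
    turns convergence in [L_1] with bounded [k]-th moments into convergence in [L_q]. *)
Lemma powR_le_interpolate q (k : nat) e : 0 < q < k%:R -> (2 <= k)%N -> 0 < e ->
  exists2 C : R, 0 <= C & forall x, 0 <= x -> x `^ q <= e + C * x + e * x ^+ k.
Proof.
move=> /andP[q0 qk] k2 e0.
have kq0 : 0 < k%:R - q by rewrite subr_gt0.
pose d := Num.min 1 (e `^ q^-1).
have d0 : 0 < d by rewrite lt_min ltr01 powR_gt0.
pose H := Num.max 1 (e `^ (- (k%:R - q)^-1)).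
have H1 : 1 <= H by rewrite le_max lexx.
have H0 : 0 < H := lt_le_trans ltr01 H1.
exists (H `^ q / d); first by rewrite divr_ge0 ?powR_ge0// ltW.
move=> x x0; have Cx : 0 <= H `^ q / d * x by rewrite !mulr_ge0 ?powR_ge0// invr_ge0 ltW.
have ex : 0 <= e * x ^+ k by rewrite mulr_ge0 ?exprn_ge0// ltW.
have [xd|dx] := leP x d.
  suff : x `^ q <= e by lra.
  rewrite -[leRHS](powRr1 (ltW e0)) -(mulVf (lt0r_neq0 q0)) powRrM.
  by rewrite ge0_ler_powR ?nnegrE ?powR_ge0 ?(ltW q0)// (le_trans xd)// ge_min lexx orbT.
have [xH|Hx] := leP x H.
  suff : x `^ q <= H `^ q / d * x by lra.
  apply: (@le_trans _ _ (H `^ q)); first by rewrite ge0_ler_powR ?nnegrE ?(ltW q0) ?(ltW H0).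
  by rewrite -mulrA ler_peMr ?powR_ge0// ler_pdivlMl// mulr1 ltW.
suff : x `^ q <= e * x ^+ k by lra.
have x1 : 0 < x by apply: lt_trans Hx.
have -> : x ^+ k = x `^ (k%:R - q) * x `^ q.
  by rewrite -powR_mulrn// -powRD ?(gt_eqF x1) ?implybT// subrK.
rewrite mulrA ler_peMl ?powR_ge0// -ler_pdivrMl// mulr1.
rewrite -[leLHS](powRr1 (_ : 0 <= e^-1)) ?invr_ge0 ?(ltW e0)//.
rewrite -[X in _ `^ X <= _](mulVf (lt0r_neq0 kq0)) powRrM.
rewrite ge0_ler_powR ?nnegrE ?powR_ge0 ?(ltW kq0) ?(ltW x1)//.
apply: ltW; apply: le_lt_trans Hx; rewrite /H le_max.
by rewrite -(powR_inv1 (ltW e0)) -powRrM mulN1r lexx orbT.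
Qed.

(* Take for [c] an index splitting the sum into two halves: either the three
   terms around [c] carry half of it, or one of the two far sides carries a
   quarter of it. *)
Lemma sum_exprn_le_far_near k N (y : nat -> R) : (0 < k)%N -> (forall i, 0 <= y i) ->
  (\sum_(0 <= i < N) y i) ^+ k <= 6 ^+ k * \sum_(i < N) y i ^+ k +
    4 ^+ k * \sum_(c < N) (\sum_(0 <= i < c) y i) *
                          (\sum_(c.+1 <= i < N) y i) ^+ k.-1.
Proof.
move=> k0 y0; pose F n := \sum_(0 <= i < n) y i; pose S := F N; rewrite -/(F N) -/S.
have F0 n : 0 <= F n by apply: sumr_ge0.
have FS n : F n.+1 = F n + y n by rewrite /F big_nat_recr.
have Rt0 c : 0 <= \sum_(c.+1 <= i < N) y i by apply: sumr_ge0.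
have RtE c : (c < N)%N -> \sum_(c.+1 <= i < N) y i = S - F c.+1.
  by move=> cN; rewrite /S /F (big_cat_nat _ (m:=0) (n:=c.+1) (p:=N))//= [X in _ = X - _]addrC addrK.
have near0 : 0 <= 6 ^+ k * \sum_(i < N) y i ^+ k.
  by rewrite mulr_ge0 ?exprn_ge0// sumr_ge0// => i _; rewrite exprn_ge0.
have far0 : 0 <= 4 ^+ k * \sum_(c < N) F c * (\sum_(c.+1 <= i < N) y i) ^+ k.-1.
  by rewrite mulr_ge0 ?exprn_ge0// sumr_ge0// => i _; rewrite mulr_ge0 ?exprn_ge0.
have := F0 N; rewrite -/S le_eqVlt => /predU1P[<-|S0].
  by rewrite expr0n gtn_eqF// addr_ge0.
have far c : (c < N)%N -> S / 4 <= F c -> S / 4 <= S - F c.+1 ->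
    S ^+ k <= 6 ^+ k * \sum_(i < N) y i ^+ k +
      4 ^+ k * \sum_(c < N) F c * (\sum_(c.+1 <= i < N) y i) ^+ k.-1.
  move=> cN h1 h2; apply: ler_wpDl => //.
  rewrite (bigD1 (Ordinal cN))//= mulrDr; apply: ler_wpDr.
    rewrite mulr_ge0 ?exprn_ge0// sumr_ge0// => i _.
    by rewrite mulr_ge0 ?exprn_ge0.
  rewrite RtE// -ler_pdivrMl ?exprn_gt0// mulrC -expr_div_n.
  rewrite -{1}(prednK k0) exprS ler_pM ?exprn_ge0 ?divr_ge0 ?(ltW S0)//.
  by rewrite lerXn2r ?nnegrE ?divr_ge0 ?(ltW S0)// (le_trans _ h2)// divr_ge0 ?(ltW S0).
have near j : (j < N)%N -> S / 6 <= y j ->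
    S ^+ k <= 6 ^+ k * \sum_(i < N) y i ^+ k +
      4 ^+ k * \sum_(c < N) F c * (\sum_(c.+1 <= i < N) y i) ^+ k.-1.
  move=> jN h1; apply: ler_wpDr => //.
  rewrite (bigD1 (Ordinal jN))//= mulrDr; apply: ler_wpDr.
    by rewrite mulr_ge0 ?exprn_ge0// sumr_ge0// => i _; rewrite exprn_ge0.
  rewrite -ler_pdivrMl ?exprn_gt0// mulrC -expr_div_n.
  by rewrite lerXn2r ?nnegrE ?divr_ge0 ?(ltW S0).
(* The least such [c] is where the partial sums cross half of [S], so that [F c] and [S - F c.+1]
   are both at most [S / 2]. *)
have exc : exists c, S / 2 <= F c.+1.
  exists N.-1; case: (posnP N) S0 => [N0|N0] S0; last by rewrite prednK// -/S; lra.
  by move: S0; rewrite /S /F N0 big_nil ltxx.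
case: (ex_minnP exc) => c hc cmin.
have Fc : F c <= S / 2.
  case: c hc cmin => [|c] hc cmin; first by rewrite /F big_nil divr_ge0 ?(ltW S0).
  by rewrite leNgt; apply/negP => /ltW /cmin; rewrite ltnn.
have Fmono m n : (m <= n)%N -> F m <= F n.
  by move=> mn; rewrite /F (big_cat_nat _ (n:=m) (p:=n))//= lerDl sumr_ge0.
have cN : (c < N)%N.
  by rewrite ltnNge; apply/negP => /Fmono; rewrite -/S; lra.
have [/(near _ cN)//|yc] := leP (S / 6) (y c).
(* If neither side yields a far pair or a large neighbour, both outer sums are below [5 / 12] of [S]
   while [y c < S / 6]; since [5/12 + 1/6 + 5/12 = 1], this is absurd. *)
have lft : (0 < c)%N /\ S / 4 <= F c.-1 \/ (0 < c)%N /\ S / 6 <= y c.-1 \/ F c < S * (5 / 12).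
  case: (posnP c) => [->|c0]; first by right; right; rewrite /F big_nil mulr_gt0//; lra.
  case: (leP (S / 4) (F c.-1)) => h; first by left.
  case: (leP (S / 6) (y c.-1)) => h'; first by right; left.
  by right; right; rewrite -(prednK c0) FS; lra.
have rgt : (c.+1 < N)%N /\ S / 4 <= S - F c.+2 \/
    (c.+1 < N)%N /\ S / 6 <= y c.+1 \/ S - F c.+1 < S * (5 / 12).
  case: (ltnP c.+1 N) => c1; last first.
    right; right; have -> : c.+1 = N by apply/eqP; rewrite eqn_leq cN.
    by rewrite subrr mulr_gt0//; lra.
  case: (leP (S / 4) (S - F c.+2)) => h; first by left.
  case: (leP (S / 6) (y c.+1)) => h'; first by right; left.
  by right; right; have := FS c.+1; lra.
case: lft => [[c0 h]|[[c0 h]|lft]].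
- by apply: (far c.-1) => //; rewrite prednK//; [exact: ltnW|lra].
- by apply: (near c.-1) => //; rewrite prednK// ltnW.
case: rgt => [[c0 h]|[[c0 h]|rgt]].
- by apply: (far c.+1) => //; lra.
- exact: (near c.+1).
- by have := FS c; lra.
Qed.

(** AM-GM: [m] is the average of the [u i], so the deviations [u i - m] sum to zero and
    [1 + v <= expR v] can be averaged. *)
Lemma prodr_le_avg_exprn k (y : 'I_k -> R) : (0 < k)%N -> (forall i, 0 < y i) ->
  \prod_i y i <= (k%:R)^-1 * \sum_i y i ^+ k.
Proof.
move=> k0 y0; pose u i := k%:R * ln (y i); pose m := \sum_i ln (y i).
have kR : 0 < k%:R :> R by rewrite ltr0n.
have -> : \prod_i y i = expR m.
  by rewrite /m expR_sum; apply: eq_bigr => i _; rewrite lnK// posrE.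
rewrite ler_pdivlMl//; apply: (@le_trans _ _ (\sum_(i < k) (expR m * (1 + (u i - m))))).
  rewrite -mulr_sumr mulrC ler_pM2l ?expR_gt0// big_split/= sumrB !sumr_const card_ord.
  by rewrite /u -mulr_sumr -/m -[m *+ k]mulr_natl subrr addr0.
apply: ler_sum => i _; have -> : y i ^+ k = expR m * expR (u i - m).
  by rewrite -expRD addrC subrK /u expRM_natl lnK// posrE.
by rewrite ler_pM2l ?expR_gt0// expR_ge1Dx.
Qed.

End real_inequalities.

(** * Expectations as extended reals *)

Section mean.
Context {d : measure_display} {T : measurableType d} {R : realType}
  (P : probability T R).
Local Open Scope ereal_scope.
Implicit Types (f g : T -> R).

Definition mean f : \bar R := \int[P]_w (f w)%:E.

Lemma expectationE f : 'E_P[f] = mean f.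
Proof. by rewrite unlock. Qed.

Lemma mean_ge0 f : (forall w, 0 <= f w)%R -> 0 <= mean f.
Proof. by move=> f0; apply: integral_ge0 => w _; rewrite lee_fin. Qed.

Lemma mean_cst (c : R) : mean (fun=> c) = c%:E.
Proof. by transitivity (c%:E * P setT); [exact: integral_cst|rewrite probability_setT mule1]. Qed.

Lemma le_mean_ae f g : measurable_fun setT f -> measurable_fun setT g ->
  (forall w, 0 <= f w)%R -> (forall w, 0 <= g w)%R ->
  {ae P, forall w, (f w <= g w)%R} -> mean f <= mean g.
Proof.
move=> mf mg f0 g0 fg; apply: ae_ge0_le_integral => //.
- by move=> w _; rewrite lee_fin.
- exact/measurable_EFinP.
- by move=> w _; rewrite lee_fin.
- exact/measurable_EFinP.
- by apply: filterS fg => w h _; rewrite lee_fin.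
Qed.

Lemma le_mean f g : measurable_fun setT f -> measurable_fun setT g ->
  (forall w, 0 <= f w)%R -> (forall w, f w <= g w)%R -> mean f <= mean g.
Proof.
move=> mf mg f0 fg; apply: le_mean_ae => //; last exact: aeW.
by move=> w; exact: le_trans (fg w).
Qed.

Lemma eq_mean_ae f g : measurable_fun setT f -> measurable_fun setT g ->
  (forall w, 0 <= f w)%R -> (forall w, 0 <= g w)%R ->
  {ae P, forall w, f w = g w} -> mean f = mean g.
Proof.
by move=> mf mg f0 g0 fg; apply/eqP; rewrite eq_le !le_mean_ae//;
  apply: filterS fg => w ->.
Qed.

Lemma eq_mean f g : f =1 g -> mean f = mean g.
Proof. by move=> /funext ->. Qed.

Lemma meanZ (c : R) f : (0 <= c)%R -> measurable_fun setT f ->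
  (forall w, 0 <= f w)%R -> mean (fun w => c * f w)%R = c%:E * mean f.
Proof.
move=> c0 mf f0; rewrite /mean -ge0_integralZl_EFin//.
- by move=> w _; rewrite lee_fin.
- exact/measurable_EFinP.
Qed.

Lemma meanD f g : measurable_fun setT f -> measurable_fun setT g ->
  (forall w, 0 <= f w)%R -> (forall w, 0 <= g w)%R ->
  mean (fun w => f w + g w)%R = mean f + mean g.
Proof.
move=> mf mg f0 g0; rewrite /mean -ge0_integralD//; try exact/measurable_EFinP.
- by move=> w _; rewrite lee_fin.
- by move=> w _; rewrite lee_fin.
Qed.

Lemma mean_sum (I : Type) (s : seq I) (F : I -> T -> R) :
  (forall i, measurable_fun setT (F i)) -> (forall i w, 0 <= F i w)%R ->
  mean (fun w => \sum_(i <- s) F i w)%R = \sum_(i <- s) mean (F i).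
Proof.
move=> mF F0; elim: s => [|i s ih].
  by rewrite big_nil -[RHS](mean_cst 0); apply: eq_mean => w; rewrite big_nil.
rewrite big_cons -ih -meanD//.
- by apply: eq_mean => w; rewrite big_cons.
- exact: measurable_sum.
- by move=> w; exact: sumr_ge0.
Qed.

(** The joint law agrees with the product of the marginal laws on rectangles, hence everywhere, and
    Tonelli's theorem splits the integral. *)
Lemma mean_indep f g : measurable_fun setT f -> measurable_fun setT g ->
  (forall w, 0 <= f w)%R -> (forall w, 0 <= g w)%R ->
  independent2 P (sigma_rv f) (sigma_rv g) ->
  mean (fun w => f w * g w)%R = mean f * mean g.
Proof.
move=> mf mg f0 g0 fg.
pose f' : {mfun T >-> R} := HB.pack f (isMeasurableFun.Build _ _ _ _ _ mf).
pose g' : {mfun T >-> R} := HB.pack g (isMeasurableFun.Build _ _ _ _ _ mg).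
have mh : measurable_fun setT (fun w => (f w, g w)).
  exact: measurable_fun_pair.
pose h' : {mfun T >-> (R * R)%type} :=
  HB.pack (fun w => (f w, g w)) (isMeasurableFun.Build _ _ _ _ _ mh).
have e := @product_measure_unique _ _ _ _ _ (distribution P f') (distribution P g')
  (distribution P h').
have {}e X : measurable X -> ((distribution P f') \x (distribution P g')) X = distribution P h' X.
  apply: e => A B mA mB; rewrite /distribution/= /pushforward/=.
  rewrite -[RHS]fg//.
    by exists A => //; rewrite setTI.
  by exists B => //; rewrite setTI.
(* Tonelli's theorem needs an integrand that is nonnegative on the whole plane; the absolute values
   change nothing on the range of [(f, g)]. *)
have m12 : measurable_fun setT (fun p : R * R => (`|p.1| * `|p.2|)%:E).
  apply/measurable_EFinP; apply: measurable_funM; apply: measurableT_comp => //.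
have -> : mean (fun w => f w * g w)%R = \int[distribution P h']_p (`|p.1| * `|p.2|)%:E.
  rewrite ge0_integral_pushforward//= ?preimage_setT.
    by apply: eq_integral => w _ /=; rewrite !ger0_norm.
rewrite (eq_measure_integral ((distribution P f') \x (distribution P g'))); last first.
  by move=> A mA _; exact/esym/e.
rewrite fubini_tonelli1//.
rewrite /fubini_F/=.
have mE (k : {mfun T >-> R}) : (forall w, 0 <= k w)%R ->
    \int[distribution P k]_x (`|x|)%:E = mean k.
  move=> k0; rewrite ge0_integral_pushforward//= ?preimage_setT.
  - by apply: eq_integral => w _ /=; rewrite ger0_norm.
  - exact/measurable_EFinP.
under eq_integral.
  move=> x _; under eq_integral do rewrite EFinM.
  rewrite ge0_integralZl_EFin//; last exact/measurable_EFinP.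
  rewrite (mE g')//; over.
rewrite /= ge0_integralZr//; last 2 first.
- exact/measurable_EFinP.
- exact: mean_ge0.
by rewrite (mE f').
Qed.

End mean.

Lemma measurable_prod_seq d (T : measurableType d) (R : realType) (I : eqType)
    (s : seq I) (h : I -> T -> R) :
  (forall x, x \in s -> measurable_fun setT (h x)) ->
  measurable_fun setT (fun w => \prod_(x <- s) h x w).
Proof.
elim: s => [|x s ih] hs; first by under eq_fun do rewrite big_nil; exact: measurable_cst.
under eq_fun do rewrite big_cons; apply: measurable_funM.
  by apply: hs; rewrite mem_head.
by apply: ih => y ys; apply: hs; rewrite inE ys orbT.
Qed.

(** * Independence of one process from all the others *)

Section independence.
Context {d : measure_display} {T : measurableType d} {R : realType}
  (P : probability T R) (Xs : nat -> R -> T -> R).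
Hypothesis Xs_process : forall j, is_process (Xs j).
Hypothesis Xs_indep : mutually_independent P (fun j => sigma_process (Xs j)).

Definition gen_from (J : set nat) : set (set T) :=
  \bigcup_(j in J) \bigcup_(t in `[0, +oo[) sigma_rv (Xs j t).

Lemma sigma_process_measurable j : sigma_process (Xs j) `<=` measurable.
Proof.
apply: smallest_sub; first exact: sigma_algebra_measurable.
move=> _ [t /= t0 [B mB <-]]; apply: Xs_process => //.
by move: t0; rewrite in_itv/= andbT.
Qed.

(** Mutual independence speaks of finitely many indices at a time. Finite intersections of events of
    the other processes form a pi-system [Pi], and Dynkin's theorem extends the product rule from
    [Pi] to the generated sigma-algebra. *)
Lemma independent_split j0 :
  independent2 P (sigma_process (Xs j0)) <<s gen_from [set j | j != j0] >>.
Proof.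
pose Pi : set (set T) := [set B | exists (J : {fset nat}) (F : nat -> set T),
  [/\ j0 \notin J, forall j, sigma_process (Xs j) (F j) &
      B = \bigcap_(j in [set` J]) F j]].
have spT j : sigma_process (Xs j) setT.
  by have [h0 hC _] := smallest_sigma_algebra setT (\bigcup_(t in `[0, +oo[) sigma_rv (Xs j t));
    rewrite -(setD0 setT); exact: hC.
have spI j : setI_closed (sigma_process (Xs j)).
  move=> A B hA hB.
  exact: (@measurableI _ (g_sigma_algebraType (\bigcup_(t in `[0, +oo[) sigma_rv (Xs j t)))).
have PiI : setI_closed Pi.
  move=> _ _ [J [F [j0J FJ ->]]] [J' [F' [j0J' FJ' ->]]].
  exists (J `|` J')%fset, (fun j => (if j \in J then F j else setT) `&`
                                   (if j \in J' then F' j else setT)); split.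
  - by rewrite inE negb_or j0J j0J'.
  - by move=> j; apply: spI; case: ifP.
  - apply/seteqP; split => [w [h h'] j /= jJ|w h].
      by split; case: ifPn => // jJ'; [exact: h|exact: h'].
    split => j /= jJ.
      by have /= := h j; rewrite inE jJ => -[].
    by have /= := h j; rewrite inE jJ orbT => -[].
have PiM : Pi `<=` measurable.
  move=> _ [J [F [j0J FJ ->]]]; apply: fin_bigcap_measurable => // j _.
  exact: (@sigma_process_measurable j).
have PiP A : sigma_process (Xs j0) A -> forall B, Pi B -> P (A `&` B) = (P A * P B)%E.
  move=> hA _ [J [F [j0J FJ ->]]].
  rewrite [in RHS]Xs_indep; last by move=> j _; exact: FJ.
  pose G j := if j == j0 then A else F j.
  have -> : A `&` \bigcap_(j in [set` J]) F j = \bigcap_(j in [set` (j0 |` J)%fset]) G j.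
    apply/seteqP; split => [w [Aw Fw] j /=|w h].
      rewrite inE in_fset1 /G => /orP[->//|jJ]; case: ifPn => // _; exact: Fw.
    split; first by have := h j0; rewrite /= inE in_fset1 /G eqxx; exact.
    move=> j /= jJ; have := h j; rewrite /= inE jJ orbT /G.
    by rewrite (_ : (j == j0) = false); [exact|apply: contraNF j0J => /eqP <-].
  rewrite Xs_indep; last by move=> j _; rewrite /G; case: eqP => // ->.
  rewrite big_fsetU1//= /G eqxx; congr (_ * _)%E.
  apply: eq_big_seq => j jJ.
  by rewrite (_ : (j == j0) = false)//; apply: contraNF j0J => /eqP <-.
move=> A B hA hB.
have mA := sigma_process_measurable hA.
have {hB} : <<s Pi >> B.
  move: B hB; apply: smallest_sub; first exact: smallest_sigma_algebra.
  move=> B [j /= jj0 [t t0 hB]]; apply: sub_sigma_algebra.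
  exists [fset j]%fset, (fun i => if i == j then B else setT); split.
  - by rewrite in_fset1 eq_sym.
  - move=> i; case: eqP => [->|//]; apply: sub_sigma_algebra; by exists t.
  - by rewrite set_fset1 bigcap_set1 eqxx.
have sPiM : <<s Pi >> `<=` measurable.
  by apply: smallest_sub => //; exact: sigma_algebra_measurable.
apply: (@dynkin_induction _ (g_sigma_algebraType Pi) Pi
  (fun B => P (A `&` B) = (P A * P B)%E)) => //.
- by rewrite setIT probability_setT mule1.
- exact: PiP.
- move=> S /sPiM mS hS; rewrite -setDE measureD//; last first.
    by rewrite -ge0_fin_numE ?measure_ge0//; exact: fin_num_measure.
  transitivity (P A - P A * P S)%E; first by congr (_ - _)%E; exact: hS.
  rewrite probability_setC//.
  by rewrite muleBr ?mule1 ?fin_num_measure.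
- move=> F mF tF hF; rewrite setI_bigcupr !measure_bigcup//=; last 3 first.
  + by move=> i _; apply: sPiM; exact: mF.
  + by move=> i _; apply: measurableI => //; apply: sPiM; exact: mF.
  + by apply: trivIset_setIl.
  have PAE : P A = (fine (P A))%:E by rewrite fineK ?fin_num_measure.
  by rewrite PAE -nneseriesZl//; apply: eq_eseriesr => i _; rewrite -PAE; exact: hF.
Qed.

Let S j := g_sigma_algebraType (\bigcup_(t in `[0, +oo[) sigma_rv (Xs j t)).
Let O j0 := g_sigma_algebraType (gen_from [set j | j != j0]).

Lemma measurable_gen_sub (G G' : set (set T)) (f : T -> R) : <<s G >> `<=` <<s G' >> ->
  measurable_fun (setT : set (g_sigma_algebraType G)) f ->
  measurable_fun (setT : set (g_sigma_algebraType G')) f.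
Proof.
by move=> GG' mf _ B mB; rewrite setTI; apply: GG'; rewrite -[X in <<s _ >> X]setTI; exact: mf.
Qed.

Lemma measurable_gen_meas (G : set (set T)) (f : T -> R) : <<s G >> `<=` measurable ->
  measurable_fun (setT : set (g_sigma_algebraType G)) f ->
  measurable_fun (setT : set T) f.
Proof.
by move=> GG' mf _ B mB; rewrite setTI; apply: GG'; rewrite -[X in <<s _ >> X]setTI; exact: mf.
Qed.

Lemma gen_from_measurable J : <<s gen_from J >> `<=` measurable.
Proof.
apply: smallest_sub; first exact: sigma_algebra_measurable.
move=> _ [j _ [t /= t0 [B mB <-]]]; apply: Xs_process => //.
by move: t0; rewrite in_itv/= andbT.
Qed.

Lemma sub_gen_from (J : set nat) j : J j -> sigma_process (Xs j) `<=` <<s gen_from J >>.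
Proof.
move=> Jj; apply: smallest_sub; first exact: smallest_sigma_algebra.
by move=> B hB; apply: sub_sigma_algebra; exists j.
Qed.

Lemma measurable_coord j t : 0 <= t -> measurable_fun (setT : set (S j)) (Xs j t).
Proof.
move=> t0 _ B mB; apply: sub_sigma_algebra; exists t => /=.
  by rewrite in_itv/= andbT.
by exists B.
Qed.

Lemma measurable_other j j0 t : j != j0 -> 0 <= t ->
  measurable_fun (setT : set (O j0)) (Xs j t).
Proof.
move=> jj0 t0; apply: (@measurable_gen_sub (\bigcup_(t in `[0, +oo[) sigma_rv (Xs j t))).
  exact: sub_gen_from.
exact: measurable_coord.
Qed.

Lemma mean_split j0 (U V : T -> R) :
  measurable_fun (setT : set (S j0)) U -> measurable_fun (setT : set (O j0)) V ->
  (forall w, 0 <= U w) -> (forall w, 0 <= V w) ->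
  mean P (fun w => U w * V w) = (mean P U * mean P V)%E.
Proof.
move=> mU mV U0 V0; apply: mean_indep => //.
- by apply: measurable_gen_meas mU; exact: sigma_process_measurable.
- by apply: measurable_gen_meas mV; exact: gen_from_measurable.
- move=> _ _ [A mA <-] [B mB <-]; apply: (independent_split (j0 := j0)).
    exact: mU.
  exact: mV.
Qed.

Lemma mean_prod_nat p n (U : nat -> T -> R) :
  (forall j, measurable_fun (setT : set (S j)) (U j)) -> (forall j w, 0 <= U j w) ->
  mean P (fun w => \prod_(p <= j < n) U j w) = (\prod_(p <= j < n) mean P (U j))%E.
Proof.
move=> mU U0; elim: n => [|n ih].
  by rewrite big_geq// -(mean_cst P 1); apply: eq_mean => w; rewrite big_geq.
have [pn|np] := leqP p n; last first.
  by rewrite big_geq// -(mean_cst P 1); apply: eq_mean => w; rewrite big_geq.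
rewrite big_nat_recr//= -ih muleC -(mean_split (j0 := n))//.
- by apply: eq_mean => w; rewrite big_nat_recr//= mulrC.
- apply: measurable_prod_seq => j; rewrite mem_index_iota => /andP[_ jn].
  apply: measurable_gen_sub (mU j); apply: sub_gen_from => /=.
  by rewrite neq_ltn jn.
- by move=> w; exact: prodr_ge0.
Qed.

Lemma le_mean_prod_nat p n (U V : nat -> T -> R) (c : nat -> R) :
  (forall j, measurable_fun (setT : set (S j)) (U j)) -> (forall j w, 0 <= U j w) ->
  (forall j, measurable_fun (setT : set (S j)) (V j)) -> (forall j w, 0 <= V j w) ->
  (forall j, 0 <= c j) ->
  (forall j, (p <= j < n)%N -> (mean P (U j) <= (c j)%:E * mean P (V j))%E) ->
  (mean P (fun w => \prod_(p <= j < n) U j w)%R <=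
   (\prod_(p <= j < n) c j)%:E * mean P (fun w => \prod_(p <= j < n) V j w)%R)%E.
Proof.
move=> mU U0 mV V0 c0; rewrite !mean_prod_nat//.
elim: n => [|n ih] UV; first by rewrite !big_geq// mule1.
have [pn|np] := leqP p n; last by rewrite !big_geq// mule1.
rewrite !big_nat_recr//= EFinM muleACA; apply: lee_pmul => //.
- by apply: prode_ge0 => j _; exact: mean_ge0.
- exact: mean_ge0.
- by apply: ih => j /andP[pj jn]; apply: UV; rewrite pj ltnS ltnW.
- by apply: UV; rewrite pn ltnSn.
Qed.

End independence.

(** * Integrals of random paths over time *)

Section time_integral.
Context {d : measure_display} {T : measurableType d} {R : realType}
  (P : probability T R).
Implicit Types (a : R -> T -> R) (D : set R) (U : T -> R).

Definition jmeas a :=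
  measurable_fun setT (fun p : measurableTypeR R * T => a p.1 p.2).

(** A real-valued integral, hence [0] where the extended integral of a nonnegative path is infinite;
    [tint_fin] confines this to a null set. *)
Definition tint a D (w : T) : R := \int[lebesgue_measure]_(s in D) a s w.

Lemma jmeas_section a s : jmeas a -> measurable_fun setT (a s).
Proof. by move=> ma; exact: (measurableT_comp ma (measurable_pair1 s)). Qed.

Lemma jmeas_path a w : jmeas a -> measurable_fun setT (a ^~ w : measurableTypeR R -> R).
Proof. by move=> ma; exact: (measurableT_comp ma (measurable_pair2 w)). Qed.

Lemma jmeas_mul a U : jmeas a -> measurable_fun setT U -> jmeas (fun s w => U w * a s w).
Proof.
move=> ma mU; apply: measurable_funM => //.
exact: (measurableT_comp mU measurable_snd).
Qed.

Lemma measurable_mean a : jmeas a -> (forall s w, 0 <= a s w) ->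
  measurable_fun setT (fun s : measurableTypeR R => mean P (a s)).
Proof.
move=> ma a0.
apply: (@measurable_fun_fubini_tonelli_F _ _ _ _ _ P (fun p : measurableTypeR R * T => (a p.1 p.2)%:E)) => //.
- exact/measurable_EFinP.
- by move=> p; rewrite lee_fin.
Qed.

Let patch_tint a D w : measurable D ->
  (\int[lebesgue_measure]_(s in D) (a s w)%:E =
   \int[lebesgue_measure]_(s in setT) (a s w * \1_D s)%:E)%E.
Proof.
move=> mD; rewrite [LHS]integral_mkcond; apply: eq_integral => s _.
by rewrite /patch indicE; case: ifP => _; rewrite ?mulr1 ?mulr0.
Qed.

Let jmeas_patch a D : measurable D -> jmeas a -> jmeas (fun s w => a s w * \1_D s).
Proof.
move=> mD ma; apply: measurable_funM => //.
by apply: (measurableT_comp (measurable_indic mD) measurable_fst).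
Qed.

Lemma measurable_etint a D : measurable D -> jmeas a -> (forall s w, 0 <= a s w) ->
  measurable_fun setT (fun w => \int[lebesgue_measure]_(s in D) (a s w)%:E)%E.
Proof.
move=> mD ma a0; under eq_fun do rewrite patch_tint//.
apply: (@measurable_fun_fubini_tonelli_G _ _ (measurableTypeR R) T R lebesgue_measure
   (fun p => (a p.1 p.2 * \1_D p.1)%:E)).
- by apply/measurable_EFinP; exact: jmeas_patch.
- by move=> p; rewrite lee_fin mulr_ge0.
Qed.

Lemma mean_etint a D : measurable D -> jmeas a -> (forall s w, 0 <= a s w) ->
  (\int[P]_w \int[lebesgue_measure]_(s in D) (a s w)%:E =
   \int[lebesgue_measure]_(s in D) mean P (a s))%E.
Proof.
move=> mD ma a0; under eq_integral do rewrite patch_tint//.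
rewrite -(@fubini_tonelli _ _ (measurableTypeR R) T R lebesgue_measure P
   (fun p => (a p.1 p.2 * \1_D p.1)%:E)).
- rewrite [RHS]integral_mkcond; apply: eq_integral => s _ /=.
  rewrite /patch indicE; case: ifP => _ /=; first by under eq_integral do rewrite mulr1.
  by under eq_integral do rewrite mulr0; rewrite integral0.
- by apply/measurable_EFinP; exact: jmeas_patch.
- by move=> p; rewrite lee_fin mulr_ge0.
Qed.

Lemma tint_ge0 a D w : (forall s w, 0 <= a s w) -> 0 <= tint a D w.
Proof. by move=> a0; apply: Rintegral_ge0. Qed.

Lemma measurable_tint a D : measurable D -> jmeas a -> (forall s w, 0 <= a s w) ->
  measurable_fun setT (tint a D).
Proof.
by move=> mD ma a0; apply: measurableT_comp => //; exact: measurable_etint.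
Qed.

(** The copies of the mother process are only almost surely positive, so their cascade needs
    measurability without a sign condition. The values [1] and [-1] of [s] give the positive and
    negative parts. *)
Lemma measurable_tint_signed a D : measurable D -> jmeas a -> measurable_fun setT (tint a D).
Proof.
move=> mD ma.
have mp (s : R) : jmeas (fun t w => Num.max (s * a t w) 0).
  by apply: measurable_maxr; [exact: measurable_funM|exact: measurable_cst].
have m0 (s : R) t w : 0 <= Num.max (s * a t w) 0 by rewrite le_max lexx orbT.
have E w : tint a D w = fine (\int[lebesgue_measure]_(s in D) (Num.max (1 * a s w) 0)%:E -
    \int[lebesgue_measure]_(s in D) (Num.max (-1 * a s w) 0)%:E)%E.
  rewrite /tint /Rintegral integralE; congr (fine (_ - _)); apply: eq_integral => s _.
    by rewrite unlock mul1r EFin_max.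
  by rewrite unlock mulN1r EFin_max EFinN.
rewrite (funext E); apply: measurableT_comp => //.
by apply: emeasurable_funB; apply: measurable_etint.
Qed.

Lemma tint_fin a D : measurable D -> jmeas a -> (forall s w, 0 <= a s w) ->
  (\int[lebesgue_measure]_(s in D) mean P (a s) < +oo)%E ->
  {ae P, forall w, (tint a D w)%:E = \int[lebesgue_measure]_(s in D) (a s w)%:E}%E.
Proof.
move=> mD ma a0; rewrite -mean_etint// => ioo.
have : P.-integrable setT (fun w => \int[lebesgue_measure]_(s in D) (a s w)%:E)%E.
  apply/integrableP; split; first exact: measurable_etint.
  apply: le_lt_trans ioo; rewrite le_eqVlt; apply/orP; left; apply/eqP.
  apply: eq_integral => w _; rewrite gee0_abs//.
  by apply: integral_ge0 => s _; rewrite lee_fin.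
move=> /integrable_ae -/(_ measurableT); apply: filterS => w /(_ Logic.I) h.
by rewrite /tint /Rintegral fineK.
Qed.

(** Tonelli's theorem for the extended integral; the finite mean makes the real integral almost
    surely equal to it. *)
Lemma mean_tintM a D U : measurable D -> jmeas a -> (forall s w, 0 <= a s w) ->
  (\int[lebesgue_measure]_(s in D) mean P (a s) < +oo)%E ->
  measurable_fun setT U -> (forall w, 0 <= U w) ->
  (mean P (fun w => U w * tint a D w)%R =
   \int[lebesgue_measure]_(s in D) mean P (fun w => U w * a s w)%R)%E.
Proof.
move=> mD ma a0 ioo mU U0; rewrite -mean_etint//; [|exact: jmeas_mul|by move=> *; exact: mulr_ge0].
apply: ge0_ae_eq_integral => //.
- apply/measurable_EFinP; apply: measurable_funM => //; exact: measurable_tint.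
- by apply: measurable_etint => //; [exact: jmeas_mul|move=> *; exact: mulr_ge0].
- by move=> w _; rewrite lee_fin mulr_ge0// tint_ge0.
- by move=> w _; apply: integral_ge0 => s _; rewrite lee_fin mulr_ge0.
- have := tint_fin mD ma a0 ioo; apply: filterS => w h _.
  rewrite EFinM h -ge0_integralZl_EFin//.
  + by move=> s _; rewrite lee_fin.
  + by apply/measurable_EFinP; apply: measurable_funTS; exact: jmeas_path.
Qed.

End time_integral.

(** A comparison at every [k]-tuple of times is integrated one time at a time, instead of over a
    [k]-fold product. The weights [U] and [U'] absorb the times already fixed, which is why they are
    arbitrary. *)
Lemma mean_tint_exprn_le {R : realType} d (T : measurableType d) (P : probability T R)
    d' (T' : measurableType d') (P' : probability T' R) (a : R -> T -> R) (a' : R -> T' -> R)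
    (D : set R) (C : R) k (U : T -> R) (U' : T' -> R) :
  measurable D -> 0 <= C -> jmeas a -> jmeas a' ->
  (forall s w, 0 <= a s w) -> (forall s w, 0 <= a' s w) ->
  (\int[lebesgue_measure]_(s in D) mean P (a s) < +oo)%E ->
  (\int[lebesgue_measure]_(s in D) mean P' (a' s) < +oo)%E ->
  measurable_fun setT U -> measurable_fun setT U' ->
  (forall w, 0 <= U w) -> (forall w, 0 <= U' w) ->
  (forall s : seq R, size s = k -> (forall x, x \in s -> D x) ->
    (mean P (fun w => U w * \prod_(x <- s) a x w)%R <=
     C%:E * mean P' (fun w => U' w * \prod_(x <- s) a' x w)%R)%E) ->
  (mean P (fun w => U w * tint a D w ^+ k)%R <=
   C%:E * mean P' (fun w => U' w * tint a' D w ^+ k)%R)%E.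
Proof.
move=> mD C0 ma ma' a0 a'0 ioo ioo'.
elim: k U U' => [|k ih] U U' mU mU' U0 U'0 h.
  have /= := h [::] erefl; rewrite (eq_mean P (g := fun w => U w * tint a D w ^+ 0)).
    rewrite (eq_mean P' (g := fun w => U' w * tint a' D w ^+ 0)); first exact.
    by move=> w; rewrite big_nil.
  by move=> w; rewrite big_nil.
have mA : measurable_fun setT (tint a D) := measurable_tint mD ma a0.
have mA' : measurable_fun setT (tint a' D) := measurable_tint mD ma' a'0.
have A0 w : 0 <= tint a D w by exact: tint_ge0.
have A'0 w : 0 <= tint a' D w by exact: tint_ge0.
have mUA n : measurable_fun setT (fun w => U w * tint a D w ^+ n).
  by apply: measurable_funM => //; exact: measurable_funX.
have mUA' n : measurable_fun setT (fun w => U' w * tint a' D w ^+ n).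
  by apply: measurable_funM => //; exact: measurable_funX.
have UA0 n w : 0 <= U w * tint a D w ^+ n by rewrite mulr_ge0 ?exprn_ge0.
have UA'0 n w : 0 <= U' w * tint a' D w ^+ n by rewrite mulr_ge0 ?exprn_ge0.
rewrite (eq_mean P (g := fun w => U w * tint a D w ^+ k * tint a D w)); last first.
  by move=> w; rewrite exprSr mulrA.
rewrite (eq_mean P' (g := fun w => U' w * tint a' D w ^+ k * tint a' D w)); last first.
  by move=> w; rewrite exprSr mulrA.
rewrite !mean_tintM// -ge0_integralZl_EFin//; last 2 first.
- by move=> s _; apply: mean_ge0 => w; rewrite mulr_ge0.
- apply: measurable_funTS; apply: measurable_mean; first exact: jmeas_mul.
  by move=> s w; rewrite mulr_ge0.
apply: ge0_le_integral => //.
- by move=> s _; apply: mean_ge0 => w; rewrite mulr_ge0.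
- apply: measurable_funTS; apply: measurable_mean; first exact: jmeas_mul.
  by move=> s w; rewrite mulr_ge0.
- apply: emeasurable_funM => //; apply: measurable_funTS; apply: measurable_mean.
    exact: jmeas_mul.
  by move=> s w; rewrite mulr_ge0.
move=> s Ds.
rewrite (eq_mean P (g := fun w => (U w * a s w) * tint a D w ^+ k)); last first.
  by move=> w; rewrite mulrAC.
rewrite (eq_mean P' (g := fun w => (U' w * a' s w) * tint a' D w ^+ k)); last first.
  by move=> w; rewrite mulrAC.
apply: ih.
- by apply: measurable_funM => //; exact: jmeas_section.
- by apply: measurable_funM => //; exact: jmeas_section.
- by move=> w; rewrite mulr_ge0.
- by move=> w; rewrite mulr_ge0.
move=> l lk lD; have := h (s :: l); rewrite /= lk => /(_ erefl).
rewrite (eq_mean P (g := fun w => U w * a s w * \prod_(x <- l) a x w)); last first.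
  by move=> w; rewrite big_cons mulrA.
rewrite (eq_mean P' (g := fun w => U' w * a' s w * \prod_(x <- l) a' x w)); last first.
  by move=> w; rewrite big_cons mulrA.
by apply=> x; rewrite inE => /predU1P[->//|/lD].
Qed.

(** * Convergence of means and limits in L_2 *)

Section convergence.
Context {d : measure_display} {T : measurableType d} {R : realType}
  (P : probability T R).
Implicit Types (x y : nat -> T -> R).

Definition mean_small x := forall e, 0 < e ->
  exists N, forall n, (N <= n)%N -> (mean P (x n) <= e%:E)%E.

(** The means sum to at most [2], so the sum of the series has finite mean and is almost surely
    finite. *)
Lemma ae_summable y : (forall i, measurable_fun setT (y i)) -> (forall i w, 0 <= y i w) ->
  (forall i, (mean P (y i) <= (2^-1 ^+ i)%:E)%E) ->
  {ae P, forall w, cvgn (series (y ^~ w))}.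
Proof.
move=> my y0 hy.
have myE i : measurable_fun setT (fun w => (y i w)%:E) by exact/measurable_EFinP.
have S2 : (\int[P]_w (\sum_(0 <= i <oo) (y i w)%:E) <= 2%:E)%E.
  rewrite integral_nneseries//; last by move=> i w _; rewrite lee_fin.
  apply: lime_le; first by apply: is_cvg_nneseries => i _ _; exact: mean_ge0.
  apply: nearW => n; apply: (@le_trans _ _ (\sum_(0 <= i < n) (2^-1 ^+ i)%:E)%E).
    by apply: lee_sum => i _; exact: hy.
  rewrite sumEFin lee_fin.
  have := @geometric_le_lim R n 1 2^-1 ler01.
  rewrite invr_gt0 ger0_norm ?invr_ge0// => /(_ (ltr0n _ 2)).
  rewrite (_ : 1 / (1 - 2^-1) = 2 :> R); last by field.
  rewrite /series/= => h; apply: le_trans (h _); last by rewrite invf_lt1// ltr1n.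
  by rewrite le_eqVlt; apply/orP; left; apply/eqP; apply: eq_bigr => i _; rewrite mul1r.
have : P.-integrable setT (fun w => \sum_(0 <= i <oo) (y i w)%:E)%E.
  apply/integrableP; split.
    by apply: ge0_emeasurable_sum => // i w _ _; rewrite lee_fin.
  apply: (@le_lt_trans _ _ 2%:E); last exact: ltry.
  apply: le_trans S2; rewrite le_eqVlt; apply/orP; left; apply/eqP.
  apply: eq_integral => w _; rewrite gee0_abs//.
  by apply: nneseries_ge0 => i _ _; rewrite lee_fin.
move=> /integrable_ae -/(_ measurableT); apply: filterS => w /(_ Logic.I) fS.
apply: nondecreasing_is_cvgn.
  by apply/nondecreasing_seqP => n; rewrite /series/= big_nat_recr//= lerDl.
exists (fine (\sum_(0 <= i <oo) (y i w)%:E)%E) => _ [n _ <-].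
rewrite -lee_fin fineK// /series/= -sumEFin.
by apply: nneseries_lim_ge => i _ _; rewrite lee_fin.
Qed.

Lemma ae_cvg0 y : (forall i, measurable_fun setT (y i)) -> (forall i w, 0 <= y i w) ->
  (forall i, (mean P (y i) <= (2^-1 ^+ i)%:E)%E) ->
  {ae P, forall w, y i w @[i --> \oo] --> 0}.
Proof.
move=> my y0 hy; have := ae_summable my y0 hy.
by apply: filterS => w; exact: cvg_series_cvg_0.
Qed.

Lemma fatou_mean y (h : T -> R) B : (forall i, measurable_fun setT (y i)) ->
  (forall i w, 0 <= y i w) -> measurable_fun setT h -> (forall w, 0 <= h w) ->
  {ae P, forall w, y i w @[i --> \oo] --> h w} ->
  (exists N, forall i, (N <= i)%N -> (mean P (y i) <= B)%E) -> (mean P h <= B)%E.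
Proof.
move=> my y0 mh h0 yh [N hN].
have myE i : measurable_fun setT (fun w => (y i w)%:E) by exact/measurable_EFinP.
apply: (@le_trans _ _ (\int[P]_w limn_einf (fun i => (y i w)%:E))%E).
  apply: ae_ge0_le_integral => //.
  - by move=> w _; rewrite lee_fin.
  - exact/measurable_EFinP.
  - move=> w _; rewrite limn_einf_lim; apply: lime_ge; first exact: is_cvg_einfs.
    apply: nearW => n; apply: le_ereal_inf_tmp => _ [i /= ni <-].
    by rewrite lee_fin.
  - apply: (emeasurable_fun_cvg (fun n w => einfs (fun i => (y i w)%:E) n)).
      exact: (measurable_fun_einfs myE).
    by move=> w _; rewrite limn_einf_lim; exact: is_cvg_einfs.
  apply: filterS yh => w hw _.
  have /cvg_limn_einf_sup[-> _]// : (y i w)%:E @[i --> \oo] --> (h w)%:E.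
  by apply: cvg_EFin => //; exact: nearW.
apply: le_trans (fatou P measurableT myE _) _.
  by move=> i w _; rewrite lee_fin.
rewrite limn_einf_lim; apply: lime_le; first exact: is_cvg_einfs.
apply: nearW => n; apply: (@le_trans _ _ (mean P (y (maxn n N)))); last by apply: hN; rewrite leq_maxr.
by apply: ereal_inf_lbound; exists (maxn n N) => //=; rewrite leq_maxl.
Qed.

(** Completing a square gives [|x| <= e / 2 + (e / 2)^-1 * x ^ 2], and eventually both terms have
    mean at most [e / 2]. *)
Lemma mean_small_sqr x : (forall i, measurable_fun setT (x i)) ->
  mean_small (fun i w => x i w ^+ 2) -> mean_small (fun i w => `|x i w|).
Proof.
move=> mx hx e e0; have e2 : 0 < e / 2 by rewrite divr_gt0.
have [|N hN] := hx (e / 2 * (e / 2)); first exact: mulr_gt0.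
exists N => n Nn.
apply: (@le_trans _ _ (mean P (fun w => e / 2 + (e / 2)^-1 * x n w ^+ 2))).
  apply: le_mean => //.
  - by apply: measurableT_comp.
  - by apply: measurable_funD => //; apply: measurable_funM => //; exact: measurable_funX.
  move=> w; rewrite -real_normK ?num_real//; set z := `|x n w|.
  have z0 : 0 <= z by exact: normr_ge0.
  have -> : e / 2 + (e / 2)^-1 * z ^+ 2 = z + (e / 2)^-1 * ((z - e / 4) ^+ 2 + 3 * (e / 4) ^+ 2).
    by field; rewrite gt_eqF.
  by rewrite lerDl mulr_ge0 ?invr_ge0 ?(ltW e2)// addr_ge0 ?sqr_ge0// mulr_ge0 ?sqr_ge0.
have eV : 0 <= (e / 2)^-1 by rewrite invr_ge0 ltW.
have mX : measurable_fun setT (fun w => x n w ^+ 2) by exact: measurable_funX.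
have mX' : measurable_fun setT (fun w => (e / 2)^-1 * x n w ^+ 2) by exact: measurable_funM.
have X0 w : 0 <= x n w ^+ 2 by exact: sqr_ge0.
rewrite (meanD P (measurable_cst _) mX' (fun _ => ltW e2) (fun w => mulr_ge0 eV (X0 w))).
rewrite mean_cst (meanZ P eV mX X0).
apply: (@le_trans _ _ ((e / 2)%:E + ((e / 2)^-1)%:E * (e / 2 * (e / 2))%:E)%E).
  by apply: leeD => //; apply: lee_wpmul2l; [rewrite lee_fin invr_ge0 ltW|exact: hN].
by rewrite -EFinM -EFinD lee_fin mulKf ?gt_eqF//; lra.
Qed.

Lemma mean_small_powR x q (k : nat) K : (forall i, measurable_fun setT (x i)) ->
  (forall i w, 0 <= x i w) -> (2 <= k)%N -> 0 < q < k%:R -> 0 <= K ->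
  mean_small x -> (forall i, (mean P (fun w => x i w ^+ k)%R <= K%:E)%E) ->
  mean_small (fun i w => x i w `^ q).
Proof.
move=> mx x0 k2 qk K0 hx hK e e0.
have d0 : 0 < e / (2 * (1 + K)) by rewrite divr_gt0// mulr_gt0// ltr_pwDl.
have [C C0 hC] := powR_le_interpolate qk k2 d0.
have [|N hN] := hx (e / (2 * (1 + C))); first by rewrite divr_gt0// mulr_gt0// ltr_pwDl.
exists N => n Nn; set d' := e / (2 * (1 + K)) in d0 hC *.
apply: (@le_trans _ _ (mean P (fun w => d' + C * x n w + d' * x n w ^+ k))).
  apply: le_mean => //.
  - exact: (measurableT_comp (measurable_powR q)).
  - apply: measurable_funD; last by apply: measurable_funM => //; exact: measurable_funX.
    by apply: measurable_funD => //; exact: measurable_funM.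
  - by move=> w; exact: powR_ge0.
  - by move=> w; exact: hC.
have C' w : 0 <= C * x n w by rewrite mulr_ge0.
have X' w : 0 <= x n w ^+ k by rewrite exprn_ge0.
have mX : measurable_fun setT (fun w => x n w ^+ k) by exact: measurable_funX.
have mC : measurable_fun setT (fun w => C * x n w) by exact: measurable_funM.
have mdX : measurable_fun setT (fun w => d' * x n w ^+ k) by exact: measurable_funM.
have md : measurable_fun setT (fun w => d' + C * x n w) by exact: measurable_funD.
rewrite (meanD P md mdX (fun w => addr_ge0 (ltW d0) (C' w)) (fun w => mulr_ge0 (ltW d0) (X' w))).
rewrite (meanD P (measurable_cst _) mC (fun=> ltW d0) C').
rewrite mean_cst (meanZ P C0 (mx n) (x0 n)) (meanZ P (ltW d0) mX X').
apply: (@le_trans _ _ (d'%:E + C%:E * (e / (2 * (1 + C)))%:E + d'%:E * K%:E)%E).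
  apply: leeD; last by apply: lee_wpmul2l => //; rewrite lee_fin ltW.
  by apply: leeD => //; apply: lee_wpmul2l; [rewrite lee_fin|exact: hN].
rewrite -!EFinM -!EFinD lee_fin.
have -> : d' + C * (e / (2 * (1 + C))) + d' * K = e / 2 + C / (1 + C) * (e / 2).
  by rewrite /d'; field; rewrite !gt_eqF// ltr_pwDl.
suff : C / (1 + C) * (e / 2) <= e / 2 by lra.
rewrite ler_piMl ?divr_ge0 ?(ltW e0)// ler_pdivrMr ?ltr_pwDl// mul1r; lra.
Qed.

Lemma mean_small_cvg x : (forall i w, 0 <= x i w) -> mean_small x ->
  mean P (x i) @[i --> \oo] --> 0%E.
Proof.
move=> x0 hx; have m0 i := mean_ge0 P (x0 i).
apply/fine_cvgP; split.
  have [N hN] := hx 1 ltr01; exists N => // n /= Nn.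
  by rewrite ge0_fin_numE// (le_lt_trans (hN n Nn))// ltry.
apply/cvgrPdist_le => e e0; have [N hN] := hx e e0.
exists N => // n /= Nn; rewrite sub0r normrN ger0_norm ?fine_ge0//.
rewrite -lee_fin fineK ?hN// ge0_fin_numE//.
by rewrite (le_lt_trans (hN n Nn))// ltry.
Qed.

(** A quasi-triangle inequality; the factor [2 ^ q] buys validity for every [q > 0], on both sides
    of [1]. *)
Lemma mean_leD2 (x y : T -> R) q : 0 < q -> measurable_fun setT x -> measurable_fun setT y ->
  (forall w, 0 <= x w) ->
  (mean P (fun w => x w `^ q)%R <=
   (2 `^ q)%:E * (mean P (fun w => `|y w| `^ q)%R + mean P (fun w => `|x w - y w| `^ q)%R))%E.
Proof.
move=> q0 mx my x0.
have mq (f : T -> R) : measurable_fun setT f -> measurable_fun setT (fun w => `|f w| `^ q).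
  by move=> mf; apply: (measurableT_comp (measurable_powR q)); exact: measurableT_comp.
have mxy : measurable_fun setT (fun w => x w - y w) by exact: measurable_funB.
rewrite -(meanD P (mq _ my) (mq _ mxy) (fun=> powR_ge0 _ _) (fun=> powR_ge0 _ _)).
rewrite -(meanZ P (powR_ge0 _ _) (measurable_funD (mq _ my) (mq _ mxy))
  (fun=> addr_ge0 (powR_ge0 _ _) (powR_ge0 _ _))).
apply: le_mean.
- exact: (measurableT_comp (measurable_powR q)).
- by apply: measurable_funM => //; apply: measurable_funD; exact: mq.
- by move=> w; exact: powR_ge0.
- move=> w; apply: le_trans (powRD_le q0 (normr_ge0 _) (normr_ge0 _)).
  rewrite ge0_ler_powR ?nnegrE ?addr_ge0 ?(ltW q0)//.
  have := ler_normD (y w) (x w - y w); rewrite [X in `|X| <= _]addrC subrK.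
  by apply: le_trans; exact: ler_norm.
Qed.

(* The increments of a bounded orthogonal-increment sequence are dominated by
   those of the sequence of its second moments. *)
Lemma L2_limit (f : nat -> T -> R) (e : nat -> R) (B : R) :
  (forall n, measurable_fun setT (f n)) -> (forall n w, 0 <= f n w) ->
  (forall n, e n <= B) ->
  (forall n m, (n <= m)%N -> (mean P (fun w => (f m w - f n w) ^+ 2)%R = (e m - e n)%:E)%E) ->
  exists g : T -> R, exists phi : nat -> nat, [/\ measurable_fun setT g,
    (forall w, 0 <= g w), (forall i, (i <= phi i)%N),
    {ae P, forall w, f (phi i) w @[i --> \oo] --> g w} &
    mean_small (fun n w => (f n w - g w) ^+ 2)].
Proof.
move=> mf f0 eB he.
have mfB m n : measurable_fun setT (fun w => f m w - f n w) by exact: measurable_funB.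
have e_nd n m : (n <= m)%N -> e n <= e m.
  move=> nm; rewrite -subr_ge0 -lee_fin -he//.
  by apply: mean_ge0 => w; exact: sqr_ge0.
have e_cvg : cvgn e.
  apply: nondecreasing_is_cvgn; first exact: e_nd.
  by exists B => _ [n _ <-].
have e_le n : e n <= limn e by apply: nondecreasing_cvgn_le.
(* With [c = 2^-1 ^+ i] the tolerance is [c ^ 3]: since [|z| <= c / 2 + z ^ 2 / (2 * c)], an
   increment has first moment at most [c / 2 + c ^ 2 / 2 <= c], which is summable. *)
have ex i : exists N, (i <= N)%N /\ limn e - e N <= 8^-1 ^+ i.
  have /cvgrPdist_le/(_ (8^-1 ^+ i))[|N _ hN] := e_cvg; first by rewrite exprn_gt0.
  exists (maxn i N); split; first exact: leq_maxl.
  have := hN _ (leq_maxr i N); rewrite /= ger0_norm// subr_ge0; exact: e_le.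
have [phi0 hphi] := choice ex.
(* The running maximum makes the chosen indices nondecreasing, so that the formula for increments
   applies to consecutive ones. *)
pose phi := fix phi i := if i is j.+1 then maxn (phi j) (phi0 j.+1) else phi0 0%N.
have phi_nd i : (phi i <= phi i.+1)%N by rewrite /= leq_maxl.
have phi0_le i : (phi0 i <= phi i)%N by case: i => //= i; rewrite leq_maxr.
have phi_ge i : (i <= phi i)%N by apply: leq_trans (phi0_le i); exact: (hphi i).1.
have phi_e i : limn e - e (phi i) <= 8^-1 ^+ i.
  by apply: le_trans (hphi i).2; rewrite lerD2l lerN2 e_nd.
pose y i w := `|f (phi i.+1) w - f (phi i) w|.
have my i : measurable_fun setT (y i) by exact: measurableT_comp.
have hy i : (mean P (y i) <= (2^-1 ^+ i)%:E)%E.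
  have c0 : 0 < 2^-1 ^+ i :> R by rewrite exprn_gt0.
  have h0 : 0 <= 2^-1 * (2^-1 ^+ i)^-1 :> R by rewrite mulr_ge0// invr_ge0 ltW.
  have mX : measurable_fun setT (fun w => (f (phi i.+1) w - f (phi i) w) ^+ 2).
    exact: measurable_funX.
  have mX' : measurable_fun setT (fun w =>
      2^-1 * (2^-1 ^+ i)^-1 * (f (phi i.+1) w - f (phi i) w) ^+ 2) by exact: measurable_funM.
  apply: (@le_trans _ _ (mean P (fun w => 2^-1 * 2^-1 ^+ i +
     2^-1 * (2^-1 ^+ i)^-1 * (f (phi i.+1) w - f (phi i) w) ^+ 2))).
    apply: le_mean => //.
    - exact: measurable_funD.
    - by move=> w; exact: normr_ge0.
    move=> w; rewrite -[X in _ <= X](_ : y i w + 2^-1 * (2^-1 ^+ i)^-1 * (y i w - 2^-1 ^+ i) ^+ 2 = _).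
      by rewrite lerDl mulr_ge0 ?sqr_ge0// mulr_ge0// invr_ge0 ltW.
    by rewrite -[in RHS]real_normK ?num_real// -/(y i w); field; rewrite gt_eqF.
  rewrite (meanD P (measurable_cst _) mX' (fun=> mulr_ge0 (ltW _) (ltW c0))
    (fun w => mulr_ge0 h0 (sqr_ge0 _)))//.
  rewrite mean_cst (meanZ P h0 mX (fun=> sqr_ge0 _)) he//.
  rewrite -EFinM -EFinD lee_fin.
  apply: (@le_trans _ _ (2^-1 * 2^-1 ^+ i + 2^-1 * (2^-1 ^+ i)^-1 * 8^-1 ^+ i)).
    rewrite lerD2l ler_wpM2l ?mulr_ge0 ?invr_ge0 ?(ltW c0)//.
    by apply: le_trans (phi_e i); rewrite lerD2r; exact: e_le.
  have -> : 8^-1 ^+ i = (2^-1 ^+ i) ^+ 2 * 2^-1 ^+ i :> R.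
    by rewrite -exprM mulnC exprM -exprMn; congr (_ ^+ _); field.
  have c1 : 2^-1 ^+ i <= 1 :> R by rewrite exprn_ile1// invf_le1// ler1n.
  rewrite (_ : 2^-1 * (2^-1 ^+ i)^-1 * _ = 2^-1 * (2^-1 ^+ i * 2^-1 ^+ i)).
    have : 2^-1 ^+ i * 2^-1 ^+ i <= 2^-1 ^+ i :> R by rewrite ler_piMl// ltW.
    lra.
  by field; rewrite gt_eqF.
have ycvg := ae_summable my (fun i w => normr_ge0 _) hy.
(* The upper limit is measurable and defined everywhere, and the absolute value makes [g]
   nonnegative even off the set of convergence. *)
pose g w := `|fine (limn_esup (fun i => (f (phi i) w)%:E))|.
have fg : {ae P, forall w, f (phi i) w @[i --> \oo] --> g w}.
  apply: filterS ycvg => w hw.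
  have /normed_cvg : cvgn [normed series (fun i => f (phi i.+1) w - f (phi i) w)].
    by [].
  move=> hc.
  have fc : cvgn (fun i => f (phi i) w).
    have -> : (fun i => f (phi i) w) = (fun i => f (phi 0%N) w +
        series (fun i => f (phi i.+1) w - f (phi i) w) i).
      by apply/funext => i; rewrite /series/= telescope_sumr// addrC subrK.
    by apply: is_cvgD => //; exact: is_cvg_cst.
  have fE : (f (phi i) w)%:E @[i --> \oo] --> (limn (fun i => f (phi i) w))%:E.
    by apply: cvg_EFin => //; exact: nearW.
  have /cvg_limn_einf_sup[_ gE] := fE.
  rewrite /g gE/= ger0_norm//.
  by apply: limr_ge => //; exact: nearW.
have mg : measurable_fun setT g.
  apply: measurableT_comp => //; apply: measurableT_comp => //.
  by apply: measurable_fun_limn_esup => i; apply/measurable_EFinP.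
exists g, phi; split => //; first by move=> w; exact: normr_ge0.
move=> r r0.
have /cvgrPdist_le/(_ r r0)[N _ hN] := e_cvg.
exists N => n Nn; apply: (@fatou_mean (fun i w => (f n w - f (phi i) w) ^+ 2)).
- by move=> i; apply: measurable_funX.
- by move=> i w; exact: sqr_ge0.
- by apply: measurable_funX; exact: measurable_funB.
- by move=> w; exact: sqr_ge0.
- apply: filterS fg => w hw; apply: (@cvg_comp _ _ _ _ (fun z : R => z ^+ 2) _ (nbhs (f n w - g w))).
    by apply: cvgB => //; exact: cvg_cst.
  exact: exprn_continuous.
exists n => i ni.
rewrite (eq_mean P (g := fun w => (f (phi i) w - f n w) ^+ 2)); last first.
  by move=> w; rewrite -opprB sqrrN.
rewrite he ?(leq_trans ni)// lee_fin.
have := hN n Nn; rewrite /= ger0_norm ?subr_ge0//.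
by apply: le_trans; rewrite lerD2r; exact: e_le.
Qed.

End convergence.

(** * Removing one independent layer from a weighted sum *)

Section one_step.
Context {d : measure_display} {T : measurableType d} {R : realType}
  (P : probability T R) (G G' : set (set T)).
Hypothesis sG : <<s G >> `<=` measurable.
Hypothesis sG' : <<s G' >> `<=` measurable.
Hypothesis split : forall U V : T -> R,
  measurable_fun (setT : set (g_sigma_algebraType G)) U ->
  measurable_fun (setT : set (g_sigma_algebraType G')) V ->
  (forall w, 0 <= U w) -> (forall w, 0 <= V w) ->
  mean P (fun w => U w * V w) = (mean P U * mean P V)%E.
Variables (N : nat) (f A : 'I_N.+1 -> T -> R) (q mq : R).
Hypothesis mf : forall i, measurable_fun (setT : set (g_sigma_algebraType G)) (f i).
Hypothesis mA : forall i, measurable_fun (setT : set (g_sigma_algebraType G')) (A i).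
Hypothesis f0 : forall i w, 0 < f i w.
Hypothesis A0 : forall i w, 0 < A i w.
Hypothesis fq : forall i, mean P (fun w => f i w `^ q) = mq%:E.
Hypothesis mq0 : 0 < mq.

Let B w := \sum_i A i w.
Let W w := \sum_i f i w * A i w.

Let B0 w : 0 < B w.
Proof. by rewrite /B big_ord_recl ltr_pwDl// sumr_ge0// => i _; exact: ltW. Qed.

Let W0 w : 0 < W w.
Proof.
rewrite /W big_ord_recl ltr_pwDl ?mulr_gt0// sumr_ge0// => i _.
by rewrite mulr_ge0// ltW.
Qed.

Let mT (g : T -> R) : measurable_fun (setT : set (g_sigma_algebraType G)) g ->
  measurable_fun setT g := measurable_gen_meas sG.
Let mT' (g : T -> R) : measurable_fun (setT : set (g_sigma_algebraType G')) g ->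
  measurable_fun setT g := measurable_gen_meas sG'.

Let mB : measurable_fun (setT : set (g_sigma_algebraType G')) B.
Proof. exact: measurable_sum. Qed.

Let mW : measurable_fun setT W.
Proof.
by apply: measurable_sum => i; apply: measurable_funM; [exact: mT|exact: mT'].
Qed.

Let mpow d' (T' : measurableType d') (g : T' -> R) r : measurable_fun setT g ->
  measurable_fun setT (fun w => g w `^ r).
Proof. by move=> mg; exact: (measurableT_comp (measurable_powR r)). Qed.

(** Divided by their sum [B ^ q], these are the weights [A i / B] of Jensen's inequality for
    [W / B]; they are independent of the [f i]. *)
Let V i w := B w `^ (q - 1) * A i w.

Let mV i : measurable_fun (setT : set (g_sigma_algebraType G')) (V i).
Proof. by apply: measurable_funM => //; exact: mpow. Qed.

Let V0 i w : 0 <= V i w.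
Proof. by rewrite mulr_ge0 ?powR_ge0// ltW. Qed.

Let VB w : \sum_i V i w = B w `^ q.
Proof.
rewrite -mulr_sumr -/(B w) -{2}(powRr1 (ltW (B0 w))) -powRD ?subrK//.
by rewrite (gt_eqF (B0 w)) implybT.
Qed.

Let sum_split (U : 'I_N.+1 -> T -> R) :
  (forall i, measurable_fun (setT : set (g_sigma_algebraType G)) (U i)) ->
  (forall i w, 0 <= U i w) ->
  mean P (fun w => \sum_i U i w * V i w) = (\sum_i mean P (U i) * mean P (V i))%E.
Proof.
move=> mU U0; rewrite mean_sum; first by apply: eq_bigr => i _; rewrite split.
  by move=> i; apply: measurable_funM; [exact: mT|exact: mT'].
by move=> i w; rewrite mulr_ge0.
Qed.

Let mean_B : mean P (fun w => B w `^ q)%R = (\sum_i mean P (V i))%E.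
Proof.
rewrite -mean_sum//; first by apply: eq_mean => w; rewrite VB.
by move=> i; exact: mT'.
Qed.

Let sum_cst (c : R) : (\sum_i c%:E * mean P (V i))%E = (c%:E * mean P (fun w => B w `^ q)%R)%E.
Proof. by rewrite mean_B ge0_sume_distrr// => i _; exact: mean_ge0. Qed.

Let jensen_bound : mean P (fun w => \sum_i f i w `^ q * V i w) =
  (mq%:E * mean P (fun w => B w `^ q)%R)%E.
Proof.
rewrite (sum_split (U := fun i w => f i w `^ q)).
- by rewrite -sum_cst; apply: eq_bigr => i _; rewrite fq.
- by move=> i; exact: mpow.
- by move=> i w; exact: powR_ge0.
Qed.

(** At the weighted average [y = W / B] the linear terms of the tangent cancel. Jensen's inequality
    thus becomes a termwise bound, whose other side [\sum_i f i ^ q * V i] has an expectation that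
    factorizes. *)
Let jensenE w : let y := W w / B w in
  \sum_i (y `^ q + q * y `^ (q - 1) * (f i w - y)) * V i w = W w `^ q.
Proof.
move=> y; have y0 : 0 < y by rewrite divr_gt0.
have Wy : W w = y * B w by rewrite /y divfK// gt_eqF.
have WV : \sum_i f i w * V i w = B w `^ (q - 1) * W w.
  by rewrite /W mulr_sumr; apply: eq_bigr => i _; rewrite /V mulrCA.
transitivity (y `^ q * B w `^ q); last by rewrite Wy powRM// ltW.
rewrite (eq_bigr (fun i => (y `^ q - q * y `^ (q - 1) * y) * V i w +
   q * y `^ (q - 1) * (f i w * V i w))); last by move=> i _; ring.
have E1 c : \sum_i c * V i w = c * B w `^ q by rewrite -VB mulr_sumr.
have E2 c : \sum_i c * (f i w * V i w) = c * (B w `^ (q - 1) * W w) by rewrite -WV mulr_sumr.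
rewrite big_split/= E1 E2 Wy.
have -> : B w `^ (q - 1) * (y * B w) = y * B w `^ q.
  have Bq : B w `^ q = B w * B w `^ (q - 1).
    rewrite -{2}(powRr1 (ltW (B0 w))) -powRD ?(gt_eqF (B0 w)) ?implybT//.
    by rewrite addrC subrK.
  by rewrite Bq; ring.
by ring.
Qed.

Let measurable_W_powR : measurable_fun setT (fun w => W w `^ q). Proof. exact: mpow. Qed.

Let measurable_sum_fV : measurable_fun setT (fun w => \sum_i f i w `^ q * V i w).
Proof.
by apply: measurable_sum => i; apply: measurable_funM; [apply: mT; exact: mpow|exact: mT'].
Qed.

Lemma step_le_ge1 : 1 <= q ->
  (mean P (fun w => W w `^ q)%R <= mq%:E * mean P (fun w => B w `^ q)%R)%E.
Proof.
move=> q1; rewrite -jensen_bound; apply: le_mean => //.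
  by move=> w; exact: powR_ge0.
move=> w; rewrite -jensenE; apply: ler_sum => i _; rewrite ler_wpM2r//.
by apply: powR_tangent_ge; rewrite ?divr_gt0// ltW.
Qed.

Lemma step_ge_le1 : 0 < q <= 1 ->
  (mq%:E * mean P (fun w => B w `^ q)%R <= mean P (fun w => W w `^ q)%R)%E.
Proof.
move=> q1; rewrite -jensen_bound; apply: le_mean => //.
  by move=> w; apply: sumr_ge0 => i _; rewrite mulr_ge0 ?powR_ge0.
move=> w; rewrite -jensenE; apply: ler_sum => i _; rewrite ler_wpM2r//.
by apply: powR_tangent_le; rewrite ?divr_gt0// ltW.
Qed.

(** Jensen's inequality works in one direction only. For the opposite one the tangent is taken at
    [f ord0 * B], as if the layer were constant in time; the error then involves only the
    correlations of [f ord0 ^ (q - 1)] with [f i]. *)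
Let U i w := f ord0 w `^ (q - 1) * f i w.

Let mU i : measurable_fun (setT : set (g_sigma_algebraType G)) (U i).
Proof. by apply: measurable_funM => //; exact: mpow. Qed.

Let U0 i w : 0 <= U i w.
Proof. by rewrite mulr_ge0 ?powR_ge0// ltW. Qed.

Let fB w := f ord0 w `^ q * B w `^ q.

Let mfB : measurable_fun setT fB.
Proof. by apply: measurable_funM; [apply: mT|apply: mT']; exact: mpow. Qed.

Let mean_fB : mean P fB = (mq%:E * mean P (fun w => B w `^ q)%R)%E.
Proof.
rewrite /fB split ?fq//; first exact: mpow.
- exact: mpow.
- by move=> w; exact: powR_ge0.
- by move=> w; exact: powR_ge0.
Qed.

Let mUV : measurable_fun setT (fun w => \sum_i U i w * V i w).
Proof. by apply: measurable_sum => i; apply: measurable_funM; [exact: mT|exact: mT']. Qed.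

Let tangentE w : let y := f ord0 w * B w in
  y `^ q + q * y `^ (q - 1) * (W w - y) = (1 - q) * fB w + q * \sum_i U i w * V i w.
Proof.
move=> y; have f1 := ltW (f0 ord0 w); have B1 := ltW (B0 w).
have -> : \sum_i U i w * V i w = y `^ (q - 1) * W w.
  rewrite /y powRM// /W mulr_sumr; apply: eq_bigr => i _; rewrite /U /V; ring.
have y0 : 0 < y by rewrite mulr_gt0.
have yq : y `^ q = y * y `^ (q - 1).
  by rewrite -{2}(powRr1 (ltW y0)) -powRD ?(gt_eqF y0) ?implybT// addrC subrK.
rewrite /fB -powRM// -/y [in RHS]yq {1}yq; ring.
Qed.

(** The number [c] measures how nearly constant the layer is: [c = 1] would match the upper bound of
    [step_le_ge1]. *)
Lemma step_ge_ge1 c : 1 <= q -> 0 <= c ->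
  (forall i, ((c * mq)%:E <= mean P (U i))%E) ->
  (mean P (fun w => B w `^ q)%R < +oo)%E ->
  (((1 - q * (1 - c)) * mq)%:E * mean P (fun w => B w `^ q)%R <= mean P (fun w => W w `^ q)%R)%E.
Proof.
move=> q1 c0 hU Bfin.
have q10 : 0 <= q - 1 by rewrite subr_ge0.
have q0 : 0 <= q by apply: le_trans q1.
have mqU : measurable_fun setT (fun w => q * \sum_i U i w * V i w) by exact: measurable_funM.
have mqf : measurable_fun setT (fun w => (q - 1) * fB w) by exact: measurable_funM.
have fB0 w : 0 <= fB w by rewrite mulr_ge0 ?powR_ge0.
have UV0 w : 0 <= \sum_i U i w * V i w by apply: sumr_ge0 => i _; rewrite mulr_ge0.
have : (mean P (fun w => q * \sum_i U i w * V i w)%R <=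
        mean P (fun w => W w `^ q + (q - 1) * fB w)%R)%E.
  apply: le_mean => //.
  - exact: measurable_funD.
  - by move=> w; rewrite mulr_ge0.
  move=> w; have := @powR_tangent_ge _ q _ _ q1 (ltW (W0 w)) (mulr_gt0 (f0 ord0 w) (B0 w)).
  by rewrite tangentE; lra.
rewrite (meanD P measurable_W_powR mqf (fun=> powR_ge0 _ _) (fun w => mulr_ge0 q10 (fB0 w))).
rewrite (meanZ P q0 mUV UV0) (meanZ P q10 mfB fB0) mean_fB (sum_split mU U0).
have hS : (q%:E * ((c * mq)%:E * mean P (fun w => B w `^ q)%R) <=
    q%:E * \sum_i mean P (U i) * mean P (V i))%E.
  rewrite -sum_cst; apply: lee_wpmul2l; first by rewrite lee_fin.
  by apply: lee_sum => i _; apply: lee_wpmul2r => //; exact: mean_ge0.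
move=> /(le_trans hS).
have : mean P (fun w => B w `^ q)%R \is a fin_num.
  by rewrite ge0_fin_numE//; apply: mean_ge0 => w; exact: powR_ge0.
move=> /fineK <-; set bt := fine _; rewrite -!EFinM.
case: (mean P (fun w => W w `^ q)%R) => [r| |]; last by [].
  by rewrite -EFinD !lee_fin; lra.
by move=> _; rewrite leey.
Qed.

Lemma step_le_le1 c : 0 < q <= 1 -> 1 <= c ->
  (forall i, (mean P (U i) <= (c * mq)%:E)%E) ->
  (mean P (fun w => W w `^ q)%R <= (c * mq)%:E * mean P (fun w => B w `^ q)%R)%E.
Proof.
move=> /andP[q0 q1] c1 hU.
have q10 : 0 <= 1 - q by rewrite subr_ge0.
have mqU : measurable_fun setT (fun w => q * \sum_i U i w * V i w) by exact: measurable_funM.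
have mqf : measurable_fun setT (fun w => (1 - q) * fB w) by exact: measurable_funM.
have fB0 w : 0 <= fB w by rewrite mulr_ge0 ?powR_ge0.
have UV0 w : 0 <= \sum_i U i w * V i w by apply: sumr_ge0 => i _; rewrite mulr_ge0.
have : (mean P (fun w => W w `^ q)%R <=
        mean P (fun w => (1 - q) * fB w + q * \sum_i U i w * V i w)%R)%E.
  apply: le_mean => //.
  - exact: measurable_funD.
  - by move=> w; exact: powR_ge0.
  move=> w; have := @powR_tangent_le _ q _ _ _ (ltW (W0 w)) (mulr_gt0 (f0 ord0 w) (B0 w)).
  by rewrite q0 q1 tangentE; exact.
move=> /le_trans; apply.
rewrite (meanD P mqf mqU (fun w => mulr_ge0 q10 (fB0 w)) (fun w => mulr_ge0 (ltW q0) (UV0 w))).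
rewrite (meanZ P (ltW q0) mUV UV0) (meanZ P q10 mfB fB0) mean_fB (sum_split mU U0).
have a0 : (0 <= mean P (fun w => B w `^ q)%R)%E by apply: mean_ge0 => w; exact: powR_ge0.
apply: (@le_trans _ _ (((1 - q) * mq)%:E * mean P (fun w => B w `^ q)%R +
    (q * (c * mq))%:E * mean P (fun w => B w `^ q)%R)%E).
  apply: leeD; first by rewrite EFinM muleA.
  rewrite EFinM -muleA; apply: lee_wpmul2l; first by rewrite lee_fin ltW.
  by rewrite -sum_cst; apply: lee_sum => i _; apply: lee_wpmul2r => //; exact: mean_ge0.
rewrite -ge0_muleDl ?lee_fin ?mulr_ge0 ?(ltW q0) ?(ltW mq0)//; last exact: le_trans c1.
apply: lee_wpmul2r => //; rewrite -EFinD lee_fin mulrA -mulrDl ler_pM2r//.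
have : 0 <= (1 - q) * (c - 1) by rewrite mulr_ge0 ?subr_ge0.
lra.
Qed.

End one_step.

(** * Additivity and monotonicity of the integral of one path *)

Section path_integrals.
Context {R : realType} (f : R -> R) (X : R).
Notation mu := (@lebesgue_measure R).
Hypothesis f0 : forall s, 0 <= f s.
Hypothesis fX : mu.-integrable `[0, X] (EFin \o f).

Let sub u v : 0 <= u -> v <= X -> mu.-integrable `[u, v] (EFin \o f).
Proof.
move=> u0 vX; apply: integrableS fX => //.
by apply: subset_itv; rewrite bnd_simp.
Qed.

Lemma Rintegral_adjacent u v x : 0 <= u -> u <= v -> v <= x -> x <= X ->
  \int[mu]_(s in `[u, v]) f s + \int[mu]_(s in `[v, x]) f s =
  \int[mu]_(s in `[u, x]) f s.
Proof.
move=> u0 uv vx xX.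
have := @Rintegral_itvB _ f (BLeft u) (BRight x) v (sub u0 xX).
rewrite !bnd_simp => /(_ uv vx) h; rewrite -(@Rintegral_itv_obnd_cbnd _ v).
  by rewrite -h addrC subrK.
apply: integrableS (sub u0 xX) => //.
by apply: subset_itv; rewrite bnd_simp.
Qed.

Lemma Rintegral_blocks u e m n : 0 <= u -> 0 <= e -> (m <= n)%N -> u + n%:R * e <= X ->
  \sum_(m <= i < n) \int[mu]_(s in `[(u + i%:R * e), (u + i.+1%:R * e)]) f s =
  \int[mu]_(s in `[(u + m%:R * e), (u + n%:R * e)]) f s.
Proof.
move=> u0 e0; elim: n => [|n ih]; first by rewrite leqn0 => /eqP->; rewrite big_geq// set_itv1 Rintegral_set1.
rewrite leq_eqVlt => /predU1P[->|]; first by rewrite big_geq// set_itv1 Rintegral_set1.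
rewrite ltnS => mn nX; rewrite big_nat_recr//= ih//.
  rewrite Rintegral_adjacent//.
  - by rewrite addr_ge0// mulr_ge0.
  - by rewrite lerD2l ler_wpM2r// ler_nat.
  - by rewrite lerD2l ler_wpM2r// ler_nat.
by rewrite (le_trans _ nX)// lerD2l ler_wpM2r// ler_nat.
Qed.

Lemma Rintegral_subitv u v u' v' : 0 <= u' -> u' <= u -> v <= v' -> v' <= X ->
  \int[mu]_(s in `[u, v]) f s <= \int[mu]_(s in `[u', v']) f s.
Proof.
move=> u'0 u'u vv' v'X; rewrite fine_le//.
- by apply: integrable_fin_num => //; apply: sub; lra.
- by apply: integrable_fin_num => //; apply: sub; lra.
- apply: ge0_subset_integral => //.
  + by apply: (measurable_int mu); apply: sub.
  + by move=> s _; rewrite lee_fin.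
  + by apply: subset_itv; rewrite bnd_simp.
Qed.

End path_integrals.

Lemma lebesgue_itv_lty {R : realType} (u v : R) : (@lebesgue_measure R `[u, v] < +oo)%E.
Proof. by rewrite lebesgue_measure_itv/= lte_fin; case: ifP; rewrite ?ltry// -EFinB ltry. Qed.

Lemma integral_cst_itv {R : realType} (c u v : R) : u <= v ->
  (\int[lebesgue_measure]_(s in `[u, v]) c%:E = (c * (v - u))%:E)%E.
Proof.
move=> uv; transitivity (c%:E * @lebesgue_measure R `[u, v])%E; first exact: integral_cst.
rewrite lebesgue_measure_itv/= lte_fin; case: ltP => [_|vu]; first by rewrite -EFinB -EFinM.
by rewrite (_ : v - u = 0) ?mulr0 ?mule0//; apply/eqP; rewrite subr_eq0 eq_le uv vu.
Qed.

Lemma Rintegral_cst_itv {R : realType} (c u v : R) : u <= v ->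
  \int[lebesgue_measure]_(s in `[u, v]) c = c * (v - u).
Proof. by move=> uv; rewrite /Rintegral integral_cst_itv. Qed.

(** Carries moment bounds from Riemann sums to integrals. The factor [4 ^ q] is the quasi-triangle
    inequality used once for [X] and once for [Y]. *)
Lemma mean_powR_transfer {d : measure_display} {T : measurableType d} {R : realType}
    (P : probability T R) (x y : nat -> T -> R) (X Y : T -> R) (q c : R) :
  0 < q -> 0 <= c ->
  (forall i, measurable_fun setT (x i)) -> (forall i, measurable_fun setT (y i)) ->
  measurable_fun setT X -> measurable_fun setT Y ->
  (forall i w, 0 <= x i w) -> (forall i w, 0 <= y i w) ->
  (forall w, 0 <= X w) -> (forall w, 0 <= Y w) ->
  mean_small P (fun i w => `|X w - x i w| `^ q) ->
  mean_small P (fun i w => `|Y w - y i w| `^ q) ->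
  (forall i, (mean P (fun w => x i w `^ q)%R <= c%:E * mean P (fun w => y i w `^ q)%R)%E) ->
  (mean P (fun w => X w `^ q)%R <= (4 `^ q * c)%:E * mean P (fun w => Y w `^ q)%R)%E.
Proof.
move=> q0 c0 mx my mX mY x0 y0 X0 Y0 hX hY hxy.
apply/lee_addgt0Pr => e e0.
have p2 : 0 < 2 `^ q :> R by rewrite powR_gt0.
have e4 : 0 < e / (2 * 2 `^ q) by rewrite divr_gt0// mulr_gt0.
have e4' : 0 < e / (2 * (4 `^ q * (c + 1))) by rewrite divr_gt0// !mulr_gt0 ?powR_gt0// ltr_wpDl.
have [N1 h1] := hX _ e4; have [N2 h2] := hY _ e4'.
pose N := maxn N1 N2.
have {}h1 := h1 N (leq_maxl _ _); have {}h2 := h2 N (leq_maxr _ _).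
have nE (f : T -> R) : (forall w, 0 <= f w) ->
    mean P (fun w => `|f w| `^ q) = mean P (fun w => f w `^ q).
  by move=> f0; apply: eq_mean => w; rewrite ger0_norm.
have m0 (f : T -> R) : (0 <= mean P (fun w => f w `^ q)%R)%E.
  by apply: mean_ge0 => w; exact: powR_ge0.
have hY' := mean_leD2 P q0 (my N) mY (y0 N); rewrite (nE _ Y0) in hY'.
have hX' := mean_leD2 P q0 mX (mx N) X0; rewrite (nE _ (x0 N)) in hX'.
have h44 : 2 `^ q * 2 `^ q = 4 `^ q :> R by rewrite -powRM//; congr (_ `^ _); lra.
apply: (le_trans hX'); rewrite -h44.
apply: (@le_trans _ _ ((2 `^ q)%:E * (c%:E * ((2 `^ q)%:E * (mean P (fun w => (Y w `^ q)%R) +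
    (e / (2 * (4 `^ q * (c + 1))))%:E)) + (e / (2 * 2 `^ q))%:E))%E).
  apply: lee_wpmul2l; first by rewrite lee_fin ltW.
  apply: leeD; last exact: h1.
  apply: (le_trans (hxy N)); apply: lee_wpmul2l; first by rewrite lee_fin.
  apply: (le_trans hY'); apply: lee_wpmul2l; first by rewrite lee_fin ltW.
  apply: leeD; first exact: lexx.
  apply: le_trans h2.
  by rewrite le_eqVlt; apply/orP; left; apply/eqP; apply: eq_mean => w; rewrite distrC.
have {m0} := m0 Y; case: (mean P _) => [r| |] //=.
  rewrite lee_fin => r0; rewrite -EFinD -EFinM -?EFinM -?EFinD lee_fin -h44.
  rewrite (_ : 2 `^ q * (c * _ + _) = 2 `^ q * 2 `^ q * c * r + (c / (c + 1)) * (e / 2) + e / 2); last first.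
    by field; rewrite !gt_eqF// ltr_wpDl.
  suff : c / (c + 1) * (e / 2) <= e / 2 by lra.
  by rewrite ler_piMl ?divr_ge0 ?(ltW e0)// ler_pdivrMr ?ltr_wpDl// mul1r; lra.
(* Here the moment of [Y] is infinite. For [c = 0] the right-hand side is still [0], by the
   convention [0 * +oo = 0], so this value of [c] is treated separately. *)
move=> _; move: c0; rewrite le_eqVlt => /predU1P[<-|c0].
  rewrite mulr0 !mul0e !add0e -EFinM lee_fin.
  by rewrite (_ : 2 `^ q * _ = e / 2); [lra|field; rewrite !gt_eqF].
by rewrite [X in (_ <= X + _)%E]gt0_muley ?lte_fin ?mulr_gt0// leey.
Qed.

Lemma sumr_cst_div {R : realType} (t : R) N : \sum_(i < N.+1) t / N.+1%:R = t.
Proof. by rewrite sumr_const card_ord -[LHS]mulr_natl mulrCA divff ?mulr1// pnatr_eq0. Qed.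

(** * Multiplicative cascades of processes with decaying dependence *)

Section cascade.
Context {d : measure_display} {T : measurableType d} {R : realType}
  (P : probability T R) (L : nat -> R -> T -> R) (b : R).
Hypothesis b1 : 1 < b.
Hypothesis L_jmeas : forall j, jmeas (L j).
Hypothesis L_gt0 : forall j s w, 0 < L j s w.
Hypothesis L_indep : mutually_independent P (fun j => sigma_process (L j)).
Variables (k : nat) (m : R -> R) (C lam : R).
Hypothesis k2 : (2 <= k)%N.
Hypothesis C0 : 0 <= C.
Hypothesis lam0 : 0 < lam.
Hypothesis m_gt0 : forall q, 0 < m q.
Hypothesis m1 : m 1 = 1.
Hypothesis m_le1 : forall q, 0 < q <= 1 -> m q <= 1.
Hypothesis m_ge1 : forall q, 1 <= q <= k%:R -> 1 <= m q.
Hypothesis m_lt : forall q, 1 < q <= k%:R -> m q < b `^ (q - 1).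
Hypothesis L_pow : forall q j s, 0 <= q <= k%:R -> 0 <= s ->
  mean P (fun w => L j s w `^ q) = (m q)%:E.
(** Decoupling of one time from at most [k - 1] times that come at least [e] later; the total order
    of the product never exceeds [k]. *)
Hypothesis L_far : forall j s t e, (size t < k)%N -> 0 <= s -> 0 <= e ->
  (forall x, x \in t -> s + e <= x) ->
  (mean P (fun w => L j s w * \prod_(x <- t) L j x w)%R <=
   (expR (C * expR (- (lam * e))))%:E * mean P (fun w => \prod_(x <- t) L j x w)%R)%E.
Hypothesis L_cont : forall e, 0 < e -> exists2 h, 0 < h & forall j s s',
  0 <= s -> s <= s' <= s + h -> (mean P (fun w => `|L j s' w - L j s w|)%R <= e%:E)%E.
Hypothesis L_low : forall q, 1 <= q < k%:R -> exists2 c, 0 <= c & forall j s s', 0 <= s <= s' ->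
  ((expR (- (c * (s' - s))) * m q)%:E <= mean P (fun w => L j s w `^ (q - 1) * L j s' w)%R)%E.
Hypothesis L_up : forall q, 0 < q <= 1 -> exists2 c, 0 <= c & forall j s s', 0 <= s <= s' ->
  (mean P (fun w => L j s w `^ (q - 1) * L j s' w)%R <= (expR (c * (s' - s)) * m q)%:E)%E.
Hypothesis L_corr : forall j u v, 0 <= u -> 0 <= v ->
  (1 <= mean P (fun w => L j u w * L j v w)%R)%E.

Let b0 : 0 < b. Proof. exact: lt_trans b1. Qed.
Let bX0 n : 0 < b ^+ n. Proof. by rewrite exprn_gt0. Qed.
Let bV0 n : 0 < b ^- n. Proof. by rewrite invr_gt0. Qed.
Let k0 : 0 < k%:R :> R. Proof. by rewrite ltr0n (ltn_trans _ k2). Qed.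
Let k1 : 1 < k%:R :> R. Proof. by rewrite ltr1n. Qed.

Let L_mean1 j s : 0 <= s -> mean P (L j s) = 1%E.
Proof.
move=> s0; rewrite -m1 -(L_pow j (q := 1) _ s0) ?ler01 ?(ltW k1)//.
by apply: eq_mean => w; rewrite powRr1// ltW.
Qed.

(** The value [1] beyond order [k] is a default, chosen so that [1 <= M r] for every [r]. *)
Let M (r : nat) : R := if (r <= k)%N then m r%:R else 1.

Let M_ge1 r : 1 <= M r.
Proof.
rewrite /M; case: ifP => // rk; case: r rk => [_|r rk]; last first.
  by apply: m_ge1; rewrite ler1n ler_nat.
rewrite -lee_fin -(L_pow 0%N (q := 0%:R) _ (lexx 0)) ?lexx ?(ltW k0)//.
by under eq_mean do rewrite powRr0; rewrite mean_cst.
Qed.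

Let M_lt r : (2 <= r <= k)%N -> M r < b ^+ r.-1.
Proof.
case: r => // r /andP[r2 rk]; rewrite /M rk; apply: lt_le_trans (m_lt _) _.
  by rewrite ltr1n ler_nat r2.
by rewrite -natr1 addrK powR_mulrn// ltW.
Qed.

Let L_mom r j s : (r <= k)%N -> 0 <= s -> mean P (fun w => L j s w ^+ r) = (M r)%:E.
Proof.
move=> rk s0; rewrite /M rk -(L_pow j (q := r%:R) _ s0) ?ler_nat ?rk ?andbT//.
by apply: eq_mean => w; rewrite powR_mulrn// ltW.
Qed.

(** * Densities of the cascade between two levels *)

Section wprod.

(** Starting at level [p] permits a recursion over scales: in the time unit [b ^- p] the factors
    again run at speeds [1], [b], [b ^ 2], and so on. *)
Definition wprod (p n : nat) (s : R) (w : T) : R := \prod_(p <= j < n) L j (s * b ^+ j) w.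

Lemma wprod_gt0 p n s w : 0 < wprod p n s w.
Proof. exact: prodr_gt0. Qed.

Lemma wprod_ge0 p n s w : 0 <= wprod p n s w.
Proof. exact/ltW/wprod_gt0. Qed.

Lemma jmeas_wprod p n : jmeas (wprod p n).
Proof.
apply: (@measurable_prod_seq _ (measurableTypeR R * T)%type R nat (index_iota p n)
  (fun j p => L j (p.1 * b ^+ j) p.2)) => j _.
have mf : measurable_fun setT
    (fun q : measurableTypeR R * T => ((q.1 : R) * b ^+ j, q.2) : measurableTypeR R * T).
  by apply: measurable_fun_pair => //; exact: measurable_funM.
exact: (measurableT_comp (L_jmeas j) mf).
Qed.

Lemma L_process j : is_process (L j).
Proof. by move=> t _; exact: jmeas_section. Qed.

Let S j := g_sigma_algebraType (\bigcup_(t in `[0, +oo[) sigma_rv (L j t)).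

Lemma measurable_prod_coord j (s : seq R) : (forall x, x \in s -> 0 <= x) ->
  measurable_fun (setT : set (S j)) (fun w => \prod_(x <- s) L j (x * b ^+ j) w).
Proof.
move=> s0; apply: measurable_prod_seq => x xs; apply: measurable_coord.
by apply: mulr_ge0; [exact: s0|exact/exprn_ge0/ltW].
Qed.

Lemma prod_wprod p n (s : seq R) w :
  \prod_(x <- s) wprod p n x w = \prod_(p <= j < n) \prod_(x <- s) L j (x * b ^+ j) w.
Proof. by rewrite exchange_big. Qed.

Lemma mean_wprod p n s : 0 <= s -> mean P (wprod p n s) = 1%E.
Proof.
move=> s0.
have sb j : 0 <= s * b ^+ j by rewrite mulr_ge0// exprn_ge0// ltW.
rewrite /wprod.
transitivity (mean P (fun w => \prod_(p <= j < n) L j (s * b ^+ j) w)); first exact: eq_mean.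
rewrite (@mean_prod_nat _ _ _ P L L_process L_indep p n (fun j => L j (s * b ^+ j))).
- by rewrite big1// => j _; rewrite L_mean1.
- by move=> j; exact: measurable_coord.
- by move=> j w; exact: ltW.
Qed.

Let itv_fin p n u v : 0 <= u ->
  (\int[lebesgue_measure]_(s in `[u, v]) mean P (wprod p n s) = lebesgue_measure `[u, v])%E.
Proof.
move=> u0; rewrite -[RHS]mul1e -integral_cst//; apply: eq_integral => s.
by rewrite inE/= in_itv/= => /andP[us _]; rewrite mean_wprod// (le_trans u0).
Qed.

Lemma wprod_fin p n u v : 0 <= u ->
  (\int[lebesgue_measure]_(s in `[u, v]) mean P (wprod p n s) < +oo)%E.
Proof.
by move=> u0; rewrite itv_fin// lebesgue_measure_itv/= lte_fin; case: ifP; rewrite ?ltry.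
Qed.

Lemma mean_tint_wprod p n u v : 0 <= u <= v ->
  mean P (tint (wprod p n) `[u, v]) = (v - u)%:E.
Proof.
move=> /andP[u0 uv].
rewrite (eq_mean P (g := fun w => 1 * tint (wprod p n) `[u, v] w)); last by move=> w; rewrite mul1r.
rewrite (mean_tintM _ (jmeas_wprod p n))//; [|exact: wprod_ge0|exact: wprod_fin].
under eq_integral do under eq_mean do rewrite mul1r.
rewrite itv_fin// lebesgue_measure_itv/= lte_fin; case: ltP => // vu.
by rewrite (_ : v = u) ?subrr//; apply/eqP; rewrite eq_le vu.
Qed.

Lemma ae_integrable_wprod p n (X : R) : {ae P, forall w,
  lebesgue_measure.-integrable `[0, X] (EFin \o wprod p n ^~ w)}.
Proof.
have := tint_fin (a := wprod p n) (D := `[0, X]) (P := P) _ (jmeas_wprod p n) (wprod_ge0 p n).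
move=> /(_ (measurable_itv _) (wprod_fin _ _ _ (lexx 0))); apply: filterS => w h.
apply/integrableP; split.
  by apply/measurable_EFinP; apply: measurable_funTS; exact: jmeas_path (jmeas_wprod p n).
apply: (@le_lt_trans _ _ (\int[lebesgue_measure]_(s in `[0%R, X]) (wprod p n s w)%:E)%E).
  rewrite le_eqVlt; apply/orP; left; apply/eqP; apply: eq_integral => s _ /=.
  by rewrite ger0_norm// wprod_ge0.
by rewrite -h ltry.
Qed.

End wprod.
Local Notation a := wprod.

(** * Moments of integer order, uniformly in the number of levels *)

Section moments.
Let m0 r : 0 <= M r. Proof. exact: le_trans (M_ge1 r). Qed.
Let mS j s := measurable_coord (Xs := L) (j := j) (t := s).

Let mT p n u v : measurable_fun setT (tint (a p n) `[u, v]).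
Proof. by apply: measurable_tint => //; [exact: jmeas_wprod|exact: wprod_ge0]. Qed.
Let T0 p n D w : 0 <= tint (a p n) D w.
Proof. by apply: tint_ge0; exact: wprod_ge0. Qed.

(** AM-GM plays the role of Hölder's inequality, since all factors have the same moment of order
    [size s]. *)
Lemma mean_prod_le_moment j (s : seq R) : (size s <= k)%N -> (forall x, x \in s -> 0 <= x) ->
  (mean P (fun w => \prod_(x <- s) L j x w)%R <= (M (size s))%:E)%E.
Proof.
move=> sk s0; have [s_0|s_gt0] := posnP (size s).
  have -> : s = [::] by case: (s) s_0.
  by under eq_mean do rewrite big_nil; rewrite mean_cst lee_fin.
pose r := size s.
have nth0 i : (i < r)%N -> 0 <= nth 0 s i by move=> ir; apply: s0; exact: mem_nth.
apply: (@le_trans _ _ (mean P (fun w => r%:R^-1 * \sum_(i < r) L j (nth 0 s i) w ^+ r))).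
  apply: le_mean.
  - by apply: measurable_prod_seq => x _; exact: jmeas_section.
  - apply: measurable_funM => //; apply: measurable_sum => i.
    by apply: measurable_funX; exact: jmeas_section.
  - by move=> w; apply: prodr_ge0 => x _; exact: ltW.
  - move=> w; rewrite (big_nth 0) big_mkord.
    exact: (@prodr_le_avg_exprn _ _ (fun i : 'I_r => L j (nth 0 s i) w)).
rewrite meanZ ?invr_ge0//; last 2 first.
- by apply: measurable_sum => i; apply: measurable_funX; exact: jmeas_section.
- by move=> w; apply: sumr_ge0 => i _; rewrite exprn_ge0// ltW.
rewrite mean_sum//; last 2 first.
- by move=> i; apply: measurable_funX; exact: jmeas_section.
- by move=> i w; rewrite exprn_ge0// ltW.
rewrite (eq_bigr (fun=> (M r)%:E)); last by move=> i _; rewrite L_mom// nth0.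
rewrite sumEFin -EFinM lee_fin sumr_const card_ord -[M r *+ r]mulr_natl mulrA mulVf ?mul1r//.
by rewrite pnatr_eq0 -lt0n.
Qed.

Let mprod j (s : seq R) : (forall x, x \in s -> 0 <= x) ->
  measurable_fun (setT : set (g_sigma_algebraType (\bigcup_(t in `[0, +oo[) sigma_rv (L j t))))
    (fun w => \prod_(x <- s) L j (x * b ^+ j) w).
Proof. exact: measurable_prod_coord. Qed.

Let mapb (s : seq R) j w : \prod_(x <- s) L j (x * b ^+ j) w =
  \prod_(x <- [seq x * b ^+ j | x <- s]) L j x w.
Proof. by rewrite big_map. Qed.

Let mapb0 (s : seq R) j : (forall x, x \in s -> 0 <= x) ->
  forall x, x \in [seq x * b ^+ j | x <- s] -> 0 <= x.
Proof. by move=> s0 _ /mapP[x xs ->]; apply: mulr_ge0; [exact: s0|exact: ltW]. Qed.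

Let mul1f (g : T -> R) : (fun w => 1 * g w) = g.
Proof. by apply/funext => w; rewrite mul1r. Qed.

(** Each level below [q] is paid for by its full moment of order [r]. This is meant for intervals of
    length [b ^- q], on which those levels hardly vary. *)
Lemma mean_tint_near p q n u v r : (p <= q)%N -> (q <= n)%N -> (r <= k)%N -> 0 <= u ->
  (mean P (fun w => tint (a p n) `[u, v] w ^+ r)%R <=
   (M r ^+ (q - p))%:E * mean P (fun w => tint (a q n) `[u, v] w ^+ r)%R)%E.
Proof.
move=> pq qn rk u0.
have := @mean_tint_exprn_le _ _ _ P _ _ P (a p n) (a q n) `[u, v]
  (M r ^+ (q - p)) r (fun=> 1) (fun=> 1).
rewrite !mul1f; apply => //; try exact: jmeas_wprod; try exact: wprod_ge0; try exact: wprod_fin.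
- by rewrite exprn_ge0.
move=> s sr su.
have s0 x : x \in s -> 0 <= x.
  by move=> /su/=; rewrite in_itv/= => /andP[+ _]; exact: le_trans.
rewrite !mul1f; under eq_mean do rewrite prod_wprod.
under [in X in (_ <= X)%E]eq_mean do rewrite prod_wprod.
have := @le_mean_prod_nat _ _ _ P L L_process L_indep p n
  (fun j w => \prod_(x <- s) L j (x * b ^+ j) w)
  (fun j w => if (j < q)%N then 1 else \prod_(x <- s) L j (x * b ^+ j) w)
  (fun j => if (j < q)%N then M r else 1).
rewrite (@big_cat_nat _ _ _ q p n)//=.
rewrite (eq_big_nat _ _ (F2 := fun=> M r)); last by move=> i /andP[_ ->].
rewrite prodr_const_nat big_nat_cond big1 ?mulr1; last first.
  by move=> i; rewrite andbT => /andP[qi _]; rewrite ltnNge qi.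
rewrite (eq_mean P (g := fun w => \prod_(q <= j < n) \prod_(x <- s) L j (x * b ^+ j) w)
  (f := fun w => \prod_(p <= j < n)
     (if (j < q)%N then 1 else \prod_(x <- s) L j (x * b ^+ j) w))).
  apply => //.
  - by move=> j; exact: mprod.
  - by move=> j w; apply: prodr_ge0 => x _; exact: ltW.
  - by move=> j; case: (j < q)%N; [exact: measurable_cst|exact: mprod].
  - by move=> j w; case: (j < q)%N => //; apply: prodr_ge0 => x _; exact: ltW.
  - by move=> j; case: (j < q)%N.
  move=> j _; case: (j < q)%N; last by rewrite mul1e.
  rewrite mean_cst mule1; under eq_mean do rewrite mapb.
  have := @mean_prod_le_moment j [seq x * b ^+ j | x <- s].
  by rewrite size_map sr; apply => //; exact: mapb0.
move=> w; rewrite (@big_cat_nat _ _ _ q p n)//= big_nat_cond big1 ?mul1r; last first.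
  by move=> i; rewrite andbT => /andP[_ ->].
by apply: eq_big_nat => i /andP[qi _]; rewrite ltnNge qi.
Qed.

Lemma sum_geometric p n : (p <= n)%N ->
  \sum_(p <= j < n) b ^- j = (b ^- p - b ^- n) * (b / (b - 1)).
Proof.
have bb : b - 1 != 0 by rewrite subr_eq0 gt_eqF.
elim: n => [|n ih]; first by rewrite leqn0 => /eqP->; rewrite big_geq// subrr mul0r.
rewrite leq_eqVlt => /predU1P[->|]; first by rewrite big_geq// subrr mul0r.
rewrite ltnS => pn; rewrite big_nat_recr//= ih// exprS.
by field; rewrite bb !gt_eqF.
Qed.

(** Bounds the product over the levels [j >= p] of the decoupling errors at gap [b ^- q]: by
    [expR (- y) <= y^-1] the exponents are dominated by a geometric series, whose sum depends only
    on [i = q - p]. *)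
Definition far_const (i : nat) : R := expR (C * (b ^+ i / lam * (b / (b - 1)))).

Let F0 i : 0 <= far_const i. Proof. exact: expR_ge0. Qed.

Lemma mean_far p q n s v x r : (p <= q)%N -> (r < k)%N -> 0 <= s ->
  s + b ^- q <= v ->
  (mean P (fun w => tint (a p n) `[v, x] w ^+ r * a p n s w)%R <=
   (far_const (q - p))%:E * mean P (fun w => tint (a p n) `[v, x] w ^+ r)%R)%E.
Proof.
move=> pq rk s0 sv.
have v0 : 0 <= v by apply: le_trans sv; rewrite addr_ge0// ltW.
have := @mean_tint_exprn_le _ _ _ P _ _ P (a p n) (a p n) `[v, x]
  (far_const (q - p)) r (a p n s) (fun=> 1).
under eq_mean do rewrite mulrC.
rewrite !mul1f; apply => //; try exact: jmeas_wprod; try exact: wprod_ge0; try exact: wprod_fin.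
- by apply: jmeas_section; exact: jmeas_wprod.
move=> t tr tu.
have t0 y : y \in t -> v <= y.
  by move=> /tu/=; rewrite in_itv/= => /andP[+ _].
rewrite mul1f; under [in X in (_ <= X)%E]eq_mean do rewrite prod_wprod.
under eq_mean do rewrite prod_wprod /wprod -big_split/=.
have := @le_mean_prod_nat _ _ _ P L L_process L_indep p n
  (fun j w => L j (s * b ^+ j) w * \prod_(x <- t) L j (x * b ^+ j) w)
  (fun j w => \prod_(x <- t) L j (x * b ^+ j) w)
  (fun j => expR (C * expR (- (lam * (b ^- q * b ^+ j))))).
move=> h; apply: (le_trans (h _ _ _ _ _ _)) => {h}.
- move=> j; apply: measurable_funM; last first.
    by apply: mprod => y /t0; exact: le_trans.
  by apply: mS; rewrite mulr_ge0// ltW.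
- by move=> j w; rewrite mulr_ge0 ?(ltW (L_gt0 _ _ _))//; apply: prodr_ge0 => y _; exact: ltW.
- by move=> j; apply: mprod => y /t0; exact: le_trans.
- by move=> j w; apply: prodr_ge0 => y _; exact: ltW.
- by move=> j; exact: expR_ge0.
- move=> j _; under eq_mean do rewrite mapb.
  under [in X in (_ <= X)%E]eq_mean do rewrite mapb.
  apply: L_far; rewrite ?size_map ?tr//.
  + by rewrite mulr_ge0// ltW.
  + by rewrite mulr_ge0// ltW.
  + move=> _ /mapP[y /t0 vy ->]; rewrite -mulrDl ler_pM2r//.
    exact: le_trans vy.
apply: lee_wpmul2r; first by apply: mean_ge0 => w; apply: prodr_ge0 => j _; apply: prodr_ge0 => y _; exact: ltW.
rewrite lee_fin -expR_sum ler_expR -mulr_sumr ler_wpM2l//.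
have [np|pn] := leqP n p.
  by rewrite big_geq// !mulr_ge0 ?invr_ge0 ?subr_ge0 ?(ltW b0) ?(ltW b1) ?(ltW lam0) ?(ltW (bX0 _)).
apply: (@le_trans _ _ (\sum_(p <= j < n) (b ^+ q / lam * b ^- j))).
  apply: ler_sum => j _.
  have y0 : 0 < lam * (b ^- q * b ^+ j) by rewrite !mulr_gt0.
  rewrite expRN; apply: (@le_trans _ _ (lam * (b ^- q * b ^+ j))^-1).
    by rewrite lef_pV2 ?posrE ?expR_gt0//; apply: le_trans (expR_ge1Dx _); rewrite lerDr.
  by rewrite !invfM invrK le_eqVlt; apply/orP; left; apply/eqP; ring.
rewrite -mulr_sumr sum_geometric ?(ltnW pn)//.
have bb : 0 < b / (b - 1) by rewrite divr_gt0// subr_gt0.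
apply: (@le_trans _ _ (b ^+ q / lam * (b ^- p * (b / (b - 1))))).
  by rewrite ler_wpM2l ?divr_ge0 ?(ltW lam0) ?(ltW (bX0 _))// ler_pM2r// gerBl ltW.
rewrite -[in X in X <= _](subnK pq) exprD le_eqVlt; apply/orP; left; apply/eqP.
by field; rewrite !gt_eqF// subr_gt0.
Qed.

Lemma mean_far_tint p q n u v v' x r : (p <= q)%N -> (r < k)%N -> 0 <= u <= v ->
  v + b ^- q <= v' ->
  (mean P (fun w => tint (a p n) `[u, v] w * tint (a p n) `[v', x] w ^+ r)%R <=
   (far_const (q - p) * (v - u))%:E * mean P (fun w => tint (a p n) `[v', x] w ^+ r)%R)%E.
Proof.
move=> pq rk /andP[u0 uv] vv'.
under eq_mean do rewrite mulrC.
rewrite (mean_tintM _ (jmeas_wprod p n))//; last 4 first.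
- exact: wprod_ge0.
- exact: wprod_fin.
- exact: measurable_funX.
- by move=> w; exact: exprn_ge0.
apply: (@le_trans _ _ (\int[lebesgue_measure]_(s in `[u, v])
   ((far_const (q - p))%:E * mean P (fun w => tint (a p n) `[v', x] w ^+ r)%R)%E)%E).
  apply: ge0_le_integral => //.
  - by move=> s _; apply: mean_ge0 => w; rewrite mulr_ge0 ?exprn_ge0// wprod_ge0.
  - apply: measurable_funTS; apply: measurable_mean.
      by apply: jmeas_mul; [exact: jmeas_wprod|exact: measurable_funX].
    by move=> s w; rewrite mulr_ge0 ?exprn_ge0// wprod_ge0.
  - move=> s /=; rewrite in_itv/= => /andP[us sv]; apply: mean_far => //.
      exact: le_trans us.
    by apply: le_trans vv'; rewrite lerD2r.
rewrite [X in (X <= _)%E](_ : _ = ((far_const (q - p))%:E *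
  mean P (fun w => tint (a p n) `[v', x] w ^+ r)%R * lebesgue_measure `[u, v])%E);
  last exact: integral_cst.
rewrite lebesgue_measure_itv/= lte_fin muleAC EFinM.
case: ltP => [_|vu]; first by rewrite EFinB.
by rewrite mule0 (_ : v - u = 0) ?mule0 ?mul0e//; apply/eqP; rewrite subr_eq0 eq_le uv vu.
Qed.

Lemma tint_wprodnn n u v w : u <= v -> tint (a n n) `[u, v] w = v - u.
Proof.
move=> uv; rewrite /tint /wprod; under eq_Rintegral do rewrite big_geq//.
rewrite Rintegral_cst//= lebesgue_measure_itv/= lte_fin mul1r.
by case: ltP => // vu; apply/eqP; rewrite eq_sym subr_eq0 eq_le uv vu.
Qed.

Lemma exprDn_le (x y : R) r : 0 <= x -> 0 <= y -> (x + y) ^+ r <= 2 ^+ r * (x ^+ r + y ^+ r).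
Proof.
wlog xy : x y / x <= y => [h x0 y0|x0 y0].
  by case: (leP x y) => [/h|/ltW /h]; [exact|rewrite addrC [X in _ * X]addrC; exact].
apply: (@le_trans _ _ ((2 * y) ^+ r)).
  by rewrite lerXn2r ?nnegrE ?addr_ge0 ?mulr_ge0//; lra.
by rewrite exprMn ler_pM2l ?exprn_gt0// lerDr exprn_ge0.
Qed.

Let small_exp (x e : R) : 0 <= x < 1 -> 0 < e -> exists2 i, (0 < i)%N & x ^+ i <= e.
Proof.
move=> /andP[x0 x1] e0.
have /cvgrPdist_le/(_ e e0)[N _ hN] : x ^+ i @[i --> \oo] --> 0.
  by apply: cvg_expr; rewrite ger0_norm.
exists N.+1 => //; have /= := hN N.+1 (leqnSn _).
by rewrite sub0r normrN ger0_norm// exprn_ge0.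
Qed.

Let sum_cst (N : nat) (x : R) : (\sum_(j < N) x%:E)%E = (N%:R * x)%:E.
Proof. by rewrite sumEFin sumr_const card_ord mulr_natl. Qed.

(** An induction on the order [r] and, inside it, on the number [n - p] of levels. The inner
    induction must return the same constant [K], which is what makes the bound uniform in [n]. *)
Lemma moment_bound r : (0 < r <= k)%N -> exists2 K, 0 <= K & forall p n u, (p <= n)%N -> 0 <= u ->
  (mean P (fun w => tint (a p n) `[u, u + b ^- p] w ^+ r)%R <= (K * (b ^- p) ^+ r)%:E)%E.
Proof.
elim: r => // -[_ _|r ih rk].
  exists 1 => // p n u pn u0; under eq_mean do rewrite expr1.
  have -> : mean P (tint (a p n) `[u, u + b ^- p]) = (u + b ^- p - u)%:E.
    by apply: (mean_tint_wprod); rewrite u0 lerDl ltW.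
  by rewrite (_ : u + b ^- p - u = b ^- p) ?mul1r ?expr1//; rewrite addrC addKr.
have [K1 K10 hK1] := ih (ltnW rk); have r1k : (r.+1 < k)%N by case/andP: rk.
move: (ltn0Sn r) r1k hK1; move: r.+1 => r1 r1_gt0 r1k hK1 {r ih rk}.
have mb : 0 <= M r1.+1 / b ^+ r1 < 1.
  by rewrite divr_ge0// ?ltW//= ltr_pdivrMr// mul1r (M_lt (r := r1.+1))// r1k andbT ltnS.
have s64 : 0 < (6 ^+ r1.+1 * 4)^-1 :> R by rewrite invr_gt0 mulr_gt0// exprn_gt0.
(* Fixed before [p], [n] and [u]. The [N <= 2 * b ^+ i] single blocks then contribute at most [6 ^
   r1.+1 * 2 * (M r1.+1 / b ^ r1) ^ i <= 1 / 2] times [K]. *)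
have [i i_gt0 hi] := small_exp mb s64.
pose N := (Num.truncn (b ^+ i)).+1.
have Nb : b ^+ i <= N%:R by apply/ltW/truncnS_gt.
have N2b : N%:R <= 2 * b ^+ i.
  have := truncn_le (b ^+ i); rewrite (ltW (bX0 i)) => h.
  by rewrite /N -natr1; have : 1 <= b ^+ i by [apply/exprn_ege1/ltW]; lra.
(* The far terms: [N] of them, a left part of length at most [2 * b ^- p], and a right part covered
   by two intervals on which the bound [K1] of lower order holds. *)
pose C2 := 4 ^+ r1.+1 * (N%:R * (far_const i * 2 * (2 ^+ r1 * (K1 + K1)))).
have C20 : 0 <= C2.
  apply: mulr_ge0; first exact: exprn_ge0.
  apply: mulr_ge0 => //; apply: mulr_ge0; first exact: mulr_ge0.
  by apply: mulr_ge0; [exact: exprn_ge0|exact: addr_ge0].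
(* The first summand settles at most [i] levels; the second ensures [K / 2 + C2 <= K], which closes
   the recursion. *)
pose K := M r1.+1 ^+ i + 2 * C2.
have K0 : 0 <= K by rewrite addr_ge0 ?exprn_ge0// mulr_ge0.
exists K => // p n u; have := leqnn (n - p); move: {2}(n - p)%N => l.
elim: l p u => [|l ihl] p u nl pn u0.
  have {}pn : p = n by apply/eqP; rewrite eqn_leq pn -subn_eq0 -leqn0.
  rewrite pn; under eq_mean do rewrite tint_wprodnn ?lerDl ?(ltW (bV0 _))// addrC addKr.
  rewrite mean_cst lee_fin ler_peMl ?exprn_ge0 ?(ltW (bV0 _))//.
  by apply: ler_wpDr; [exact: mulr_ge0|exact: exprn_ege1].
(* With at most [i] levels left, all of them are removed and the integral becomes the length of the
   interval. *)
have [ni|ni] := leqP (n - p) i.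
  have := @mean_tint_near p n n u (u + b ^- p) r1.+1 pn (leqnn n) r1k u0.
  move=> /le_trans; apply.
  under eq_mean do rewrite tint_wprodnn ?lerDl ?(ltW (bV0 _))// addrC addKr.
  rewrite mean_cst -EFinM lee_fin ler_wpM2r ?exprn_ge0 ?(ltW (bV0 _))//.
  by apply: ler_wpDr; [exact: mulr_ge0|exact: ler_weXn2l].
pose q := (p + i)%N.
have pq : (p <= q)%N by rewrite leq_addr.
have qn : (q <= n)%N by rewrite /q -leq_subRL// ltnW.
pose e := b ^- q.
have e0 : 0 < e by exact: bV0.
have eE : e = b ^- p * b ^- i by rewrite /e /q exprD invfM.
have Ne1 : b ^- p <= N%:R * e.
  by rewrite eE mulrCA ler_peMr ?(ltW (bV0 _))// ler_pdivlMr// mul1r.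
have Ne2 : N%:R * e <= 2 * b ^- p.
  by rewrite eE mulrCA [leRHS]mulrC ler_pM2l// ler_pdivrMr.
pose y j w := tint (a p n) `[u + j%:R * e, u + j.+1%:R * e] w.
pose Lt c w := tint (a p n) `[u, u + c%:R * e] w.
pose Rt c w := tint (a p n) `[u + c.+1%:R * e, u + N%:R * e] w.
have my j : measurable_fun setT (y j) by exact: mT.
have mLt j : measurable_fun setT (Lt j) by exact: mT.
have mRt j : measurable_fun setT (Rt j) by exact: mT.
have y0 j w : 0 <= y j w by exact: T0.
have Lt0 j w : 0 <= Lt j w by exact: T0.
have Rt0 j w : 0 <= Rt j w by exact: T0.
have mLR c : measurable_fun setT (fun w => Lt c w * Rt c w ^+ r1).
  by apply: measurable_funM => //; exact: measurable_funX.
have LR0 c w : 0 <= Lt c w * Rt c w ^+ r1 by rewrite mulr_ge0 ?exprn_ge0.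
have my1 : measurable_fun setT (fun w => 6 ^+ r1.+1 * \sum_(j < N) y j w ^+ r1.+1).
  by apply: measurable_funM => //; apply: measurable_sum => j; exact: measurable_funX.
have mLR1 : measurable_fun setT (fun w => 4 ^+ r1.+1 * \sum_(c < N) Lt c w * Rt c w ^+ r1).
  by apply: measurable_funM => //; exact: measurable_sum.
have y10 w : 0 <= 6 ^+ r1.+1 * \sum_(j < N) y j w ^+ r1.+1.
  by rewrite mulr_ge0 ?exprn_ge0// sumr_ge0// => j _; exact: exprn_ge0.
have LR10 w : 0 <= 4 ^+ r1.+1 * \sum_(c < N) Lt c w * Rt c w ^+ r1.
  by rewrite mulr_ge0 ?exprn_ge0// sumr_ge0.
(* The last of the [N] blocks may overrun [u + b ^- p], but never [u + 2 * b ^- p]. *)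
have X0 : 0 <= u + 2 * b ^- p by rewrite addr_ge0// mulr_ge0// ltW.
have aeI := ae_integrable_wprod p n (u + 2 * b ^- p).
have step : (mean P (fun w => tint (a p n) `[u, u + b ^- p] w ^+ r1.+1)%R <=
    mean P (fun w => 6 ^+ r1.+1 * \sum_(j < N) y j w ^+ r1.+1 +
      4 ^+ r1.+1 * \sum_(c < N) Lt c w * Rt c w ^+ r1)%R)%E.
  apply: le_mean_ae.
  - by apply: measurable_funX; exact: mT.
  - exact: measurable_funD.
  - by move=> w; exact: exprn_ge0.
  - by move=> w; rewrite addr_ge0.
  apply: filterS aeI => w Iw.
  have blk := Rintegral_blocks Iw u0 (ltW e0).
  have f0 s : 0 <= wprod p n s w by exact: wprod_ge0.
  have ye : \sum_(0 <= j < N) y j w = tint (a p n) `[u, u + N%:R * e] w.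
    by rewrite /y /tint blk ?mul0r ?addr0//; lra.
  apply: (@le_trans _ _ ((\sum_(0 <= j < N) y j w) ^+ r1.+1)).
    rewrite lerXn2r ?nnegrE ?sumr_ge0// ye.
    by apply: (@Rintegral_subitv _ _ _ f0 Iw) => //; lra.
  apply: (le_trans (@sum_exprn_le_far_near _ r1.+1 N (y ^~ w) _ _)) => //.
  rewrite lerD2l ler_pM2l ?exprn_gt0//; apply: ler_sum => c _.
  rewrite le_eqVlt; apply/orP; left; apply/eqP.
  have cN : (c.+1 <= N)%N by [].
  congr (_ * _ ^+ _).
    rewrite /y /Lt /tint blk ?mul0r ?addr0//.
    by apply: (@le_trans _ _ (u + N%:R * e)); [rewrite lerD2l ler_pM2r// ler_nat ltnW|lra].
  by rewrite /y /Rt /tint blk//; lra.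
apply: (le_trans step); rewrite meanD// !meanZ ?exprn_ge0//; last 4 first.
- exact: measurable_sum.
- by move=> w; exact: sumr_ge0.
- by apply: measurable_sum => j; exact: measurable_funX.
- by move=> w; apply: sumr_ge0 => j _; exact: exprn_ge0.
rewrite !mean_sum//; last 2 first.
- by move=> j; exact: measurable_funX.
- by move=> j w; exact: exprn_ge0.
have h1 (j : 'I_N) : (mean P (fun w => y j w ^+ r1.+1)%R <= (M r1.+1 ^+ i * (K * e ^+ r1.+1))%:E)%E.
  have uj : 0 <= u + j%:R * e by rewrite addr_ge0// mulr_ge0// ltW.
  apply: (le_trans (mean_tint_near _ pq qn r1k uj)).
  rewrite /q addKn EFinM; apply: lee_wpmul2l; first by rewrite lee_fin exprn_ge0.
  have := ihl q (u + j%:R * e) _ qn uj.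
  rewrite (_ : u + j.+1%:R * e = u + j%:R * e + b ^- q).
    by apply; rewrite /q subnDA -ltnS (leq_trans _ nl)// ltn_subrL i_gt0 (leq_trans _ ni).
  by rewrite -natr1 mulrDl mul1r addrA.
have h2 (c : 'I_N) : (mean P (fun w => Lt c w * Rt c w ^+ r1)%R <=
    (far_const i * 2 * (2 ^+ r1 * (K1 + K1)) * (b ^- p) ^+ r1.+1)%:E)%E.
  have ce : 0 <= c%:R * e by rewrite mulr_ge0// ltW.
  apply: (le_trans (mean_far_tint n (u := u) (v := u + c%:R * e) (q := q) _ pq _ _ _)).
  - exact: r1k.
  - by rewrite u0 lerDl.
  - by rewrite -natr1 mulrDl mul1r addrA.
  rewrite /q addKn (_ : u + c%:R * e - u = c%:R * e); last by rewrite addrC addKr.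
  have Rb : (mean P (fun w => Rt c w ^+ r1)%R <= (2 ^+ r1 * ((K1 + K1) * (b ^- p) ^+ r1))%:E)%E.
    pose I1 w := tint (a p n) `[u, u + b ^- p] w.
    pose I2 w := tint (a p n) `[u + b ^- p, u + b ^- p + b ^- p] w.
    apply: (@le_trans _ _ (mean P (fun w => 2 ^+ r1 * (I1 w ^+ r1 + I2 w ^+ r1))%R)).
      apply: le_mean_ae.
      - exact: measurable_funX.
      - by apply: measurable_funM => //; apply: measurable_funD; apply: measurable_funX; exact: mT.
      - by move=> w; exact: exprn_ge0.
      - by move=> w; rewrite mulr_ge0 ?exprn_ge0// addr_ge0// exprn_ge0// T0.
      apply: filterS aeI => w Iw.
      have f0 s : 0 <= wprod p n s w by exact: wprod_ge0.
      apply: le_trans (exprDn_le _ (T0 _ _ _ _) (T0 _ _ _ _)).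
      rewrite lerXn2r ?nnegrE ?addr_ge0 ?T0//.
      have bp := bV0 p.
      have -> : I1 w + I2 w = tint (a p n) `[u, u + b ^- p + b ^- p] w.
        by apply: (@Rintegral_adjacent _ _ _ Iw) => //; lra.
      apply: (@Rintegral_subitv _ _ _ f0 Iw) => //; last 2 first.
      - lra.
      - lra.
      by rewrite lerDl mulr_ge0// ltW.
    rewrite meanZ ?exprn_ge0//; last 2 first.
    - by apply: measurable_funD; apply: measurable_funX; exact: mT.
    - by move=> w; rewrite addr_ge0// exprn_ge0// T0.
    rewrite meanD//; try by [apply: measurable_funX; exact: mT|move=> w; rewrite exprn_ge0// T0].
    rewrite EFinM; apply: lee_wpmul2l; first by rewrite lee_fin exprn_ge0.
    rewrite mulrDl EFinD; apply: leeD; apply: hK1 => //.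
    by rewrite addr_ge0// ltW.
  apply: (le_trans (lee_wpmul2l _ Rb)).
    by rewrite lee_fin !mulr_ge0// ?F0// ltW.
  rewrite -EFinM lee_fin.
  have ce2 : c%:R * e <= 2 * b ^- p by apply: le_trans Ne2; rewrite ler_pM2r// ler_nat ltnW.
  rewrite exprSr; set B := (b ^- p) ^+ r1; set F := far_const i.
  rewrite (_ : F * 2 * _ * _ = F * (2 * b ^- p) * (2 ^+ r1 * ((K1 + K1) * B))); last by ring.
  rewrite ler_wpM2r ?ler_wpM2l ?F0//.
  by rewrite !mulr_ge0 ?exprn_ge0// ?addr_ge0// ltW.
apply: (@le_trans _ _ ((6 ^+ r1.+1)%:E * (\sum_(j < N) (M r1.+1 ^+ i * (K * e ^+ r1.+1))%:E) +
   (4 ^+ r1.+1)%:E * (\sum_(c < N) (far_const i * 2 * (2 ^+ r1 * (K1 + K1)) * (b ^- p) ^+ r1.+1)%:E))%E).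
  by apply: leeD; apply: lee_wpmul2l; rewrite ?lee_fin ?exprn_ge0//; apply: lee_sum.
rewrite !sum_cst -!EFinM -EFinD lee_fin.
set B := (b ^- p) ^+ r1.+1.
have B0 : 0 <= B by rewrite exprn_ge0// ltW.
have -> : 4 ^+ r1.+1 * (N%:R * (far_const i * 2 * (2 ^+ r1 * (K1 + K1)) * B)) = C2 * B.
  by rewrite /C2; ring.
have -> : e ^+ r1.+1 = B * (b ^- i) ^+ r1.+1 by rewrite eE exprMn.
have hN : N%:R * (M r1.+1 ^+ i * (b ^- i) ^+ r1.+1) <= 2 * (M r1.+1 / b ^+ r1) ^+ i.
  rewrite (_ : 2 * _ = 2 * b ^+ i * (M r1.+1 ^+ i * (b ^- i) ^+ r1.+1)).
    by rewrite ler_wpM2r// mulr_ge0 ?exprn_ge0// ltW.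
  rewrite expr_div_n -exprM exprSr -!mulrA; congr (_ * _).
  rewrite mulrCA; congr (_ * _); rewrite mulrCA mulfV ?gt_eqF// mulr1.
  by rewrite exprVn -exprM mulnC.
have hN' : 6 ^+ r1.+1 * (N%:R * (M r1.+1 ^+ i * (b ^- i) ^+ r1.+1)) <= 2^-1.
  have s6 : 0 < 6 ^+ r1.+1 :> R by rewrite exprn_gt0.
  apply: (@le_trans _ _ (6 ^+ r1.+1 * (2 * (6 ^+ r1.+1 * 4)^-1))).
    rewrite ler_pM2l//; apply: (le_trans hN); by rewrite ler_pM2l.
  by rewrite le_eqVlt; apply/orP; left; apply/eqP; field; rewrite gt_eqF.
rewrite (_ : 6 ^+ r1.+1 * _ = 6 ^+ r1.+1 * (N%:R * (M r1.+1 ^+ i * (b ^- i) ^+ r1.+1)) * K * B); last by ring.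
rewrite -mulrDl ler_wpM2r//.
apply: (@le_trans _ _ (2^-1 * K + C2)); first by rewrite lerD2r ler_wpM2r.
by rewrite /K; have := exprn_ge0 i (m0 r1.+1); lra.
Qed.

End moments.

(** * Riemann sums of the densities *)

Section riemann_sums.

Let ma p n s : measurable_fun setT (a p n s).
Proof. by apply: jmeas_section; exact: jmeas_wprod. Qed.

Let mL j s : measurable_fun setT (L j s).
Proof. exact: jmeas_section. Qed.

Lemma measurable_wprod_other p n l s : (l < p)%N || (n <= l)%N -> 0 <= s ->
  measurable_fun (setT : set (g_sigma_algebraType (gen_from L [set j | j != l]))) (a p n s).
Proof.
move=> lpn s0; apply: measurable_prod_seq => j; rewrite mem_index_iota => /andP[pj jn].
apply: measurable_other.
  case/orP: lpn => h; first by rewrite gtn_eqF// (leq_trans h).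
  by rewrite ltn_eqF// (leq_trans jn).
by rewrite mulr_ge0// ltW.
Qed.

Let splitL l := mean_split L_process L_indep (j0 := l).

(** By induction on the top level, through [L' a' - L a = L' (a' - a) + (L' - L) a]: in each product
    the factors are independent and the undifferenced one has mean [1]. *)
Lemma mean_wprod_diff p n e : 0 < e -> exists2 h, 0 < h & forall s s',
  0 <= s -> s <= s' <= s + h -> (mean P (fun w => `|a p n s' w - a p n s w|)%R <= e%:E)%E.
Proof.
elim: n e => [|n ih] e e0.
  exists 1 => // s s' s0 _; rewrite (eq_mean P (g := fun=> 0)) ?mean_cst ?lee_fin ?ltW//.
  by move=> w; rewrite /wprod !big_geq// subrr normr0.
have [np|pn] := ltnP n p.
  exists 1 => // s s' s0 _; rewrite (eq_mean P (g := fun=> 0)) ?mean_cst ?lee_fin ?ltW//.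
  by move=> w; rewrite /wprod !big_geq// subrr normr0.
have e2 : 0 < e / 2 by rewrite divr_gt0.
have [h1 h10 H1] := ih _ e2; have [h2 h20 H2] := L_cont e2.
exists (Num.min h1 (h2 / b ^+ n)); first by rewrite lt_min h10 divr_gt0.
move=> s s' s0 /andP[ss' s'h].
have s'0 : 0 <= s' by apply: le_trans ss'.
have sb t : 0 <= t -> 0 <= t * b ^+ n by move=> t0; rewrite mulr_ge0// ltW.
have aS t w : a p n.+1 t w = L n (t * b ^+ n) w * a p n t w.
  by rewrite /wprod big_nat_recr//= mulrC.
have mD : measurable_fun setT (fun w => `|a p n s' w - a p n s w|).
  by apply: measurableT_comp => //; exact: measurable_funB.
have mDL : measurable_fun setT (fun w => `|L n (s' * b ^+ n) w - L n (s * b ^+ n) w|).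
  by apply: measurableT_comp => //; exact: measurable_funB.
have mA1 : measurable_fun setT (fun w => L n (s' * b ^+ n) w * `|a p n s' w - a p n s w|).
  exact: measurable_funM.
have m2 : measurable_fun setT (fun w => `|L n (s' * b ^+ n) w - L n (s * b ^+ n) w| * a p n s w).
  exact: measurable_funM.
have p1 w : 0 <= L n (s' * b ^+ n) w * `|a p n s' w - a p n s w| by rewrite mulr_ge0// ltW.
have p2 w : 0 <= `|L n (s' * b ^+ n) w - L n (s * b ^+ n) w| * a p n s w.
  by rewrite mulr_ge0// wprod_ge0.
apply: (@le_trans _ _ (mean P (fun w => L n (s' * b ^+ n) w * `|a p n s' w - a p n s w| +
   `|L n (s' * b ^+ n) w - L n (s * b ^+ n) w| * a p n s w)%R)).
  apply: le_mean => //.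
  - by apply: measurableT_comp => //; exact: measurable_funB.
  - exact: measurable_funD.
  move=> w; rewrite !aS -[X in X * `|a p n s' w - _|]ger0_norm ?(ltW (L_gt0 _ _ _))//.
  rewrite -[X in _ + _ * X]ger0_norm ?wprod_ge0// -!normrM.
  apply: le_trans (ler_normD _ _); rewrite le_eqVlt; apply/orP; left; apply/eqP.
  by congr `|_|; ring.
rewrite (meanD P mA1 m2 p1 p2).
have oX s1 : 0 <= s1 ->
    measurable_fun (setT : set (g_sigma_algebraType (gen_from L [set j | j != n]))) (a p n s1).
  by move=> s10; apply: measurable_wprod_other => //; rewrite leqnn orbT.
have oD : measurable_fun (setT : set (g_sigma_algebraType (gen_from L [set j | j != n])))
    (fun w => `|a p n s' w - a p n s w|).
  by apply: measurableT_comp => //; apply: measurable_funB; exact: oX.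
have cL s1 : 0 <= s1 -> measurable_fun (setT : set (g_sigma_algebraType
    (\bigcup_(t in `[0, +oo[) sigma_rv (L n t)))) (L n (s1 * b ^+ n)).
  by move=> s10; apply: measurable_coord; exact: sb.
have cD : measurable_fun (setT : set (g_sigma_algebraType
    (\bigcup_(t in `[0, +oo[) sigma_rv (L n t))))
    (fun w => `|L n (s' * b ^+ n) w - L n (s * b ^+ n) w|).
  by apply: measurableT_comp => //; apply: measurable_funB; exact: cL.
rewrite (splitL (cL _ s'0) oD (fun w => ltW (L_gt0 _ _ _)) (fun w => normr_ge0 _)).
rewrite (splitL cD (oX _ s0) (fun w => normr_ge0 _) (fun w => wprod_ge0 _ _ _ _)).
rewrite L_mean1 ?sb// mul1e (mean_wprod)// mule1.
rewrite (_ : e = e / 2 + e / 2); last by field.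
rewrite EFinD; apply: leeD.
  by apply: H1 => //; rewrite ss'/= (le_trans s'h)// lerD2l ge_min lexx.
apply: H2; first exact: sb.
rewrite ler_pM2r// ss'/=; apply: (@le_trans _ _ ((s + h2 / b ^+ n) * b ^+ n)).
  by rewrite ler_pM2r// (le_trans s'h)// lerD2l ge_min lexx orbT.
by rewrite mulrDl divfK// gt_eqF.
Qed.

(** Left endpoints put time [0] first; it is the reference value [f ord0] when a layer is compared
    with a constant. *)
Definition rsum p n (t : R) N (w : T) : R :=
  \sum_(i < N.+1) t / N.+1%:R * a p n (i%:R * (t / N.+1%:R)) w.

Lemma measurable_rsum p n t N : measurable_fun setT (rsum p n t N).
Proof. by apply: measurable_sum => i; apply: measurable_funM. Qed.

Lemma rsum_ge0 p n t N w : 0 <= t -> 0 <= rsum p n t N w.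
Proof.
by move=> t0; apply: sumr_ge0 => i _; rewrite mulr_ge0 ?wprod_ge0// divr_ge0.
Qed.

Let mT p n u v : measurable_fun setT (tint (a p n) `[u, v]).
Proof. by apply: measurable_tint => //; [exact: jmeas_wprod|exact: wprod_ge0]. Qed.

Lemma rsum_small p n t : 0 <= t ->
  mean_small P (fun N w => `|tint (a p n) `[0, t] w - rsum p n t N w|).
Proof.
move=> t0 e e0; have et : 0 < e / (t + 1) by rewrite divr_gt0// ltr_wpDl.
have [h h0 hh] := mean_wprod_diff p n et.
have [N0 hN0] : exists N0 : nat, t / h <= N0%:R.
  by exists (Num.truncn (t / h)).+1; apply/ltW/truncnS_gt.
exists N0 => N N0N; set u := t / N.+1%:R.
have u0 : 0 <= u by rewrite divr_ge0.
have uh : u <= h.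
  rewrite /u ler_pdivrMr// mulrC -ler_pdivrMr//; apply: (le_trans hN0).
  by rewrite ler_nat (leq_trans N0N).
have ut : N.+1%:R * u = t by rewrite /u mulrCA divff ?mulr1// pnatr_eq0.
pose D i s w := `|a p n s w - a p n (i%:R * u) w|.
have jD i : jmeas (D i).
  apply: measurableT_comp => //; apply: measurable_funB; first exact: jmeas_wprod.
  exact: (measurableT_comp (ma _ _ _) measurable_snd).
have D0 i s w : 0 <= D i s w by exact: normr_ge0.
have iu i : 0 <= i%:R * u by rewrite mulr_ge0.
have mDi i : (\int[lebesgue_measure]_(s in `[(0 + i%:R * u)%R, (0 + i.+1%:R * u)%R]) mean P (D i s) <=
    (u * (e / (t + 1)))%:E)%E.
  rewrite !add0r; apply: (@le_trans _ _ (\int[lebesgue_measure]_(s in `[(i%:R * u)%R, (i.+1%:R * u)%R])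
      (e / (t + 1))%:E)%E).
    apply: ge0_le_integral => //.
    - by move=> s _; exact: mean_ge0.
    - by apply: measurable_funTS; exact: measurable_mean.
    - move=> s /=; rewrite in_itv/= => /andP[us su]; apply: hh => //.
      by rewrite us/= (le_trans su)// -natr1 mulrDl mul1r lerD2l.
  rewrite integral_cst_itv; last by rewrite ler_wpM2r// ler_nat.
  by rewrite lee_fin -natr1 mulrDl mul1r [i%:R * u + u]addrC addrK mulrC.
have fD i : (\int[lebesgue_measure]_(s in `[(0 + i%:R * u)%R, (0 + i.+1%:R * u)%R]) mean P (D i s) < +oo)%E.
  by apply: (le_lt_trans (mDi i)); rewrite ltry.
have mtD i : measurable_fun setT (tint (D i) `[0 + i%:R * u, 0 + i.+1%:R * u]).
  exact: measurable_tint.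
apply: (@le_trans _ _ (mean P (fun w => \sum_(i < N.+1) tint (D i) `[0 + i%:R * u, 0 + i.+1%:R * u] w))).
  apply: le_mean_ae.
  - by apply: measurableT_comp => //; apply: measurable_funB => //; exact: measurable_rsum.
  - exact: measurable_sum.
  - by move=> w; exact: normr_ge0.
  - by move=> w; apply: sumr_ge0 => i _; exact: tint_ge0.
  have := ae_integrable_wprod p n t.
  apply: filterS => w Iw.
  have := Rintegral_blocks Iw (lexx 0) u0 (leq0n N.+1).
  have tE : 0 + N.+1%:R * u = t by rewrite add0r.
  have zE : 0 + 0%:R * u = 0 by rewrite mul0r addr0.
  rewrite tE zE lexx => /(_ isT) blk; rewrite /tint -blk.
  rewrite big_mkord /rsum -sumrB; apply: (le_trans (ler_norm_sum _ _ _)).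
  apply: ler_sum => i _; rewrite -/u.
  have sub : lebesgue_measure.-integrable `[0 + i%:R * u, 0 + i.+1%:R * u] (EFin \o a p n ^~ w).
    apply: integrableS Iw => //; apply: subset_itv; rewrite bnd_simp add0r//.
    by rewrite -ut ler_wpM2r// ler_nat.
  have cstI : lebesgue_measure.-integrable `[0 + i%:R * u, 0 + i.+1%:R * u]
      (EFin \o cst (a p n (i%:R * u) w)).
    apply: measurable_bounded_integrable => //.
    - exact: lebesgue_itv_lty.
    - exact: bounded_cst.
  rewrite (_ : u * a p n (i%:R * u) w = \int[lebesgue_measure]_(s in `[0 + i%:R * u, 0 + i.+1%:R * u])
      cst (a p n (i%:R * u) w) s)%R; last first.
    rewrite Rintegral_cst_itv; last by rewrite lerD2l ler_wpM2r// ler_nat.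
    by rewrite !add0r -natr1 mulrDl mul1r [i%:R * u + u]addrC addrK mulrC.
  rewrite -RintegralB//; apply: le_trans (le_normr_Rintegral _ _) _ => //.
  rewrite (_ : EFin \o _ = ((EFin \o a p n ^~ w) \- (EFin \o cst (a p n (i%:R * u) w)))%E).
    exact: integrableB.
  by apply/funext => s; rewrite /= EFinB.
rewrite mean_sum//; last by move=> i w; exact: tint_ge0.
apply: (@le_trans _ _ (\sum_(i < N.+1) (u * (e / (t + 1)))%:E)%E).
  apply: lee_sum => i _; rewrite (eq_mean P (g := fun w => 1 * tint (D i) `[0 + i%:R * u, 0 + i.+1%:R * u] w)).
    rewrite mean_tintM//; apply: le_trans (mDi i).
    by under eq_integral do under eq_mean do rewrite mul1r.
  by move=> w; rewrite mul1r.
rewrite sumEFin lee_fin sumr_const card_ord.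
rewrite (_ : _ *+ _ = t * (e / (t + 1))); last by rewrite -mulr_natl mulrA ut.
by rewrite mulrCA ler_piMr ?(ltW e0)// ler_pdivrMr ?ltr_wpDl// mul1r lerDl.
Qed.

End riemann_sums.
Local Notation rs := rsum.

(** * Stripping levels from Riemann sums *)

Section scaling.
Local Notation Gc l := (\bigcup_(t in `[0, +oo[) sigma_rv (L l t)).
Local Notation Go l := (gen_from L [set j | j != l]).

Let splitL l := mean_split L_process L_indep (j0 := l).

Let cG l : <<s Gc l >> `<=` measurable.
Proof. exact: (@sigma_process_measurable _ _ _ _ L_process l). Qed.

Let cO l : <<s Go l >> `<=` measurable.
Proof. exact: (@gen_from_measurable _ _ _ _ L_process). Qed.

Variables (t : R) (N : nat).
Hypothesis t0 : 0 < t.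

Let x (i : nat) := i%:R * (t / N.+1%:R).
Let x0 i : 0 <= x i. Proof. by rewrite mulr_ge0// divr_ge0// ltW. Qed.
Let f l (i : 'I_N.+1) w := L l (x i * b ^+ l) w.
Let A l n (i : 'I_N.+1) w := t / N.+1%:R * a l.+1 n (x i) w.
Let xb i l : 0 <= x i * b ^+ l. Proof. by rewrite mulr_ge0// ltW. Qed.

Let f0 l i w : 0 < f l i w. Proof. exact: L_gt0. Qed.
Let A0 l n i w : 0 < A l n i w.
Proof. by rewrite mulr_gt0 ?divr_gt0//; exact: wprod_gt0. Qed.
Let mf l i : measurable_fun (setT : set (g_sigma_algebraType (Gc l))) (f l i).
Proof. exact: measurable_coord. Qed.
Let mA l n i : measurable_fun (setT : set (g_sigma_algebraType (Go l))) (A l n i).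
Proof.
by apply: measurable_funM => //; apply: measurable_wprod_other => //; rewrite leqnn.
Qed.

Let rsE l n w : (l < n)%N -> rs l n t N w = \sum_i f l i w * A l n i w.
Proof.
move=> ln; apply: eq_bigr => i _.
have -> : a l n (i%:R * (t / N.+1%:R)) w = f l i w * a l.+1 n (x i) w by rewrite /wprod big_ltn.
exact: mulrCA.
Qed.

Let fq l i q : 0 <= q <= k%:R -> mean P (fun w => f l i w `^ q) = (m q)%:E.
Proof. by move=> qk; exact: L_pow. Qed.

Let rs0 l n w : 0 < rs l n t N w.
Proof.
rewrite /rsum big_ord_recl ltr_pwDl ?mulr_gt0 ?divr_gt0 ?wprod_gt0//.
by rewrite sumr_ge0// => i _; rewrite mulr_ge0 ?divr_ge0 ?(ltW t0)// wprod_ge0.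
Qed.

Let rs_nn n w : rs n n t N w = t.
Proof.
rewrite /rsum; under eq_bigr do rewrite /wprod big_geq// mulr1.
exact: sumr_cst_div.
Qed.

Let mrs l n : measurable_fun setT (rs l n t N).
Proof. exact: measurable_rsum. Qed.

Let mrsq l n q : measurable_fun setT (fun w => rs l n t N w `^ q).
Proof. exact: (measurableT_comp (measurable_powR q) (mrs l n)). Qed.

Lemma mean_rsum l n : mean P (rs l n t N) = t%:E.
Proof.
rewrite /rsum mean_sum; last 2 first.
- by move=> i; apply: measurable_funM => //; apply: jmeas_section; exact: jmeas_wprod.
- by move=> i w; rewrite mulr_ge0 ?divr_ge0 ?(ltW t0)// wprod_ge0.
rewrite (eq_bigr (fun=> (t / N.+1%:R)%:E)).
  by rewrite sumEFin sumr_cst_div.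
move=> i _; rewrite meanZ ?divr_ge0 ?(ltW t0)//; last 2 first.
- by apply: jmeas_section; exact: jmeas_wprod.
- by move=> w; exact: wprod_ge0.
by rewrite (mean_wprod) ?mule1// x0.
Qed.

Lemma rsum_iter_le p p' n q : 1 <= q <= k%:R -> (p <= p')%N -> (p' <= n)%N ->
  (mean P (fun w => rs p n t N w `^ q)%R <=
   (m q ^+ (p' - p))%:E * mean P (fun w => rs p' n t N w `^ q)%R)%E.
Proof.
move=> /andP[q1 qk]; have q0 : 0 <= q by apply: le_trans q1.
elim: p' => [|p' ih]; first by rewrite leqn0 => /eqP-> _; rewrite subnn mul1e.
rewrite leq_eqVlt => /predU1P[->|]; first by rewrite subnn mul1e.
rewrite ltnS => pp' p'n; apply: (le_trans (ih pp' (ltnW p'n))).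
have -> : (m q ^+ (p'.+1 - p))%:E = ((m q ^+ (p' - p))%:E * (m q)%:E)%E.
  by rewrite subSn// exprSr EFinM.
rewrite -muleA; apply: lee_wpmul2l; first by rewrite lee_fin exprn_ge0// ltW.
under eq_mean do rewrite rsE//.
by apply: (step_le_ge1 (@cG p') (@cO p') (@splitL p') (@mf p') (@mA p' n)) => // i; apply: fq; rewrite q0.
Qed.

Lemma rsum_iter_ge p n q : 0 < q <= 1 -> (p <= n)%N ->
  ((m q ^+ p)%:E * mean P (fun w => rs p n t N w `^ q)%R <=
   mean P (fun w => rs 0 n t N w `^ q)%R)%E.
Proof.
move=> /andP[q0 q1]; elim: p => [|p ih] pn; first by rewrite mul1e.
apply: le_trans (ih (ltnW pn)).
have -> : (m q ^+ p.+1)%:E = ((m q ^+ p)%:E * (m q)%:E)%E by rewrite exprSr EFinM.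
rewrite -muleA; apply: lee_wpmul2l; first by rewrite lee_fin exprn_ge0// ltW.
under [in X in (_ <= X)%E]eq_mean do rewrite rsE//.
apply: (step_ge_le1 (@cG p) (@cO p) (@splitL p) (@mf p) (@mA p n)) => //.
  by move=> i; apply: fq; rewrite ltW// (le_trans q1)// ler1n (ltn_trans _ k2).
by rewrite q0.
Qed.

Lemma rsum_pow_fin p n q : 1 <= q <= k%:R -> (p <= n)%N ->
  (mean P (fun w => rs p n t N w `^ q)%R <= (m q ^+ (n - p) * t `^ q)%:E)%E.
Proof.
move=> qk pn; apply: (le_trans (rsum_iter_le qk pn (leqnn n))).
by under eq_mean do rewrite rs_nn; rewrite mean_cst -EFinM.
Qed.

(** Jensen's inequality for a variable of mean [t], by the tangent at [t]. No moment bound is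
    involved, so any number of levels may remain. *)
Lemma rsum_pow_ge p n q : 1 <= q -> ((t `^ q)%:E <= mean P (fun w => rs p n t N w `^ q)%R)%E.
Proof.
move=> q1; have q0 : 0 <= q by apply: le_trans q1.
have c0 : 0 <= q * t `^ (q - 1) by rewrite mulr_ge0 ?powR_ge0.
have tq : t `^ q = t `^ (q - 1) * t.
  by rewrite -{3}(powRr1 (ltW t0)) -powRD ?subrK// (gt_eqF t0) implybT.
have : (mean P (fun w => t `^ q + q * t `^ (q - 1) * rs p n t N w)%R <=
        mean P (fun w => rs p n t N w `^ q + q * t `^ q)%R)%E.
  apply: le_mean.
  - by apply: measurable_funD => //; exact: measurable_funM.
  - exact: measurable_funD.
  - by move=> w; rewrite addr_ge0 ?powR_ge0// mulr_ge0// ltW.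
  - by move=> w; have := powR_tangent_ge q1 (ltW (rs0 p n w)) t0; rewrite tq; lra.
rewrite (meanD P (measurable_cst _) (measurable_funM (measurable_cst _) (mrs p n))
  (fun=> powR_ge0 _ _) (fun w => mulr_ge0 c0 (ltW (rs0 p n w)))).
rewrite (meanD P (mrsq p n q) (measurable_cst _) (fun=> powR_ge0 _ _)
  (fun=> mulr_ge0 q0 (powR_ge0 _ _))).
rewrite !mean_cst (meanZ P c0 (mrs p n) (fun w => ltW (rs0 p n w))) mean_rsum.
rewrite -EFinM -mulrA -tq; case: (mean P _) => [r| |].
- by rewrite -!EFinD !lee_fin lerD2r.
- by move=> _; rewrite leey.
- by [].
Qed.

Lemma rsum_pow_le p n q : 0 < q <= 1 -> (mean P (fun w => rs p n t N w `^ q)%R <= (t `^ q)%:E)%E.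
Proof.
move=> /andP[q0 q1].
have c0 : 0 <= q * t `^ (q - 1) by rewrite mulr_ge0 ?powR_ge0// ltW.
have d0 : 0 <= (1 - q) * t `^ q by rewrite mulr_ge0 ?powR_ge0// subr_ge0.
have tq : t `^ q = t `^ (q - 1) * t.
  by rewrite -{3}(powRr1 (ltW t0)) -powRD ?subrK// (gt_eqF t0) implybT.
apply: (@le_trans _ _ (mean P (fun w => (1 - q) * t `^ q + q * t `^ (q - 1) * rs p n t N w)%R)).
  apply: le_mean => //.
  - by apply: measurable_funD => //; exact: measurable_funM.
  - by move=> w; exact: powR_ge0.
  - move=> w; have := powR_tangent_le (q := q) (x := rs p n t N w) _ (ltW (rs0 p n w)) t0.
    by rewrite q0 q1 tq => /(_ isT); lra.
rewrite (meanD P (measurable_cst _) (measurable_funM (measurable_cst _) (mrs p n))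
  (fun=> d0) (fun w => mulr_ge0 c0 (ltW (rs0 p n w)))).
rewrite mean_cst (meanZ P c0 (mrs p n) (fun w => ltW (rs0 p n w))) mean_rsum.
by rewrite -EFinM -EFinD lee_fin -mulrA -tq; lra.
Qed.

Variables (q c : R).
Hypothesis c0 : 0 <= c.

Section lower.
Hypothesis q1k : 1 <= q <= k%:R.
Hypothesis low_q : forall j s s', 0 <= s <= s' ->
  ((expR (- (c * (s' - s))) * m q)%:E <= mean P (fun w => L j s w `^ (q - 1) * L j s' w)%R)%E.

(** At level [l] all sampled times lie within [t * b ^+ l] of [0], so a correlation with the value
    at time [0] loses at most the factor [expR (- (c * (t * b ^+ l)))], bounded below by its
    tangent. *)
Lemma rsum_step_ge l n : (l < n)%N ->
  (((1 - q * (c * (t * b ^+ l))) * m q)%:E * mean P (fun w => rs l.+1 n t N w `^ q)%R <=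
   mean P (fun w => rs l n t N w `^ q)%R)%E.
Proof.
move=> ln; case/andP: (q1k) => q1 qk; have q0 : 0 <= q by apply: le_trans q1.
under [in X in (_ <= X)%E]eq_mean do rewrite rsE//.
pose E := expR (- (c * (t * b ^+ l))).
have hC : (((1 - q * (1 - E)) * m q)%:E * mean P (fun w => rs l.+1 n t N w `^ q)%R <=
    mean P (fun w => (\sum_i f l i w * A l n i w) `^ q)%R)%E.
  apply: (step_ge_ge1 (@cG l) (@cO l) (@splitL l) (@mf l) (@mA l n)) => //.
  - by move=> i; apply: fq; rewrite q0.
  - exact: expR_ge0.
  - move=> i; rewrite /f; have -> : x (@ord0 N) * b ^+ l = 0 by rewrite /x !mul0r.
    apply: le_trans (low_q l _); last by rewrite lexx xb.
    rewrite lee_fin ler_wpM2r ?(ltW (m_gt0 _))// ler_expR lerN2 subr0 ler_wpM2l//.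
    rewrite ler_pM2r// /x mulrCA ler_piMr ?(ltW t0)// ler_pdivrMr// mul1r ler_nat.
    exact: ltnW.
  - by apply: le_lt_trans (rsum_pow_fin q1k ln) _; rewrite ltry.
apply: le_trans hC; apply: lee_wpmul2r; first by apply: mean_ge0 => w; exact: powR_ge0.
rewrite lee_fin ler_wpM2r ?(ltW (m_gt0 _))// lerD2l lerN2 ler_wpM2l//.
have := expR_ge1Dx (- (c * (t * b ^+ l))); rewrite -/E; lra.
Qed.

Lemma rsum_iter_low p n : (p <= n)%N ->
  (((1 - \sum_(l < p) q * (c * (t * b ^+ l))) * m q ^+ p)%:E *
     mean P (fun w => rs p n t N w `^ q)%R <=
   mean P (fun w => rs 0 n t N w `^ q)%R)%E.
Proof.
case/andP: (q1k) => q1 qk; have q0 : 0 <= q by apply: le_trans q1.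
elim: p => [|p ih] pn; first by rewrite big_ord0 subr0 expr0 mulr1 mul1e.
have m0 r (z : T -> R) : (0 <= mean P (fun w => z w `^ r)%R)%E by apply: mean_ge0 => w; exact: powR_ge0.
rewrite big_ord_recr/=; set S := \sum_(l < p) _; set y := q * (c * (t * b ^+ p)).
have y0 : 0 <= y by rewrite !mulr_ge0// ltW.
have S0 : 0 <= S by apply: sumr_ge0 => l _; rewrite !mulr_ge0// ltW.
(* When the errors exceed [1] the claimed lower bound is nonpositive; otherwise
   [(1 - S) * (1 - y) >= 1 - S - y] adds one more level. *)
have [Sy1|Sy1] := ltP 1 (S + y).
  apply: (@le_trans _ _ 0%E).
    apply: mule_le0_ge0 => //; rewrite lee_fin mulr_le0_ge0 ?exprn_ge0 ?(ltW (m_gt0 _))//.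
    by rewrite subr_le0 ltW.
  exact: m0.
have S1 : S <= 1 by lra.
apply: le_trans (ih (ltnW pn)).
apply: le_trans (lee_wpmul2l _ (rsum_step_ge pn)).
  rewrite -/y muleA -EFinM; apply: lee_wpmul2r => //; rewrite lee_fin.
  rewrite -/S [X in _ <= X](_ : _ = (1 - S) * (1 - y) * m q ^+ p.+1); last by rewrite exprSr; ring.
  rewrite ler_wpM2r ?exprn_ge0 ?(ltW (m_gt0 _))//.
  by have : 0 <= S * y by [exact: mulr_ge0]; lra.
by rewrite lee_fin mulr_ge0 ?subr_ge0// exprn_ge0// ltW.
Qed.

End lower.

Section upper.
Hypothesis q1 : 0 < q <= 1.
Hypothesis up_q : forall j s s', 0 <= s <= s' ->
  (mean P (fun w => L j s w `^ (q - 1) * L j s' w)%R <= (expR (c * (s' - s)) * m q)%:E)%E.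

Lemma rsum_iter_up p n : (p <= n)%N ->
  (mean P (fun w => rs 0 n t N w `^ q)%R <=
   (expR (\sum_(l < p) c * (t * b ^+ l)) * m q ^+ p)%:E * mean P (fun w => rs p n t N w `^ q)%R)%E.
Proof.
case/andP: (q1) => q0 q1'.
elim: p => [|p ih] pn; first by rewrite big_ord0 expR0 expr0 mulr1 mul1e.
apply: (le_trans (ih (ltnW pn))).
rewrite big_ord_recr/= expRD exprSr mulrACA (EFinM (_ * m q ^+ p) (_ * m q)) -muleA.
apply: lee_wpmul2l; first by rewrite lee_fin mulr_ge0 ?expR_ge0// exprn_ge0// ltW.
under eq_mean do rewrite rsE//.
apply: (step_le_le1 (@cG p) (@cO p) (@splitL p) (@mf p) (@mA p n)) => //.
- by move=> i; apply: fq; rewrite ltW// (le_trans q1')// ler1n (ltn_trans _ k2).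
- by apply: le_trans (expR_ge1Dx _); rewrite lerDl !mulr_ge0// ltW.
- move=> i; rewrite /f; have -> : x (@ord0 N) * b ^+ p = 0 by rewrite /x !mul0r.
  apply: (le_trans (up_q p _)); first by rewrite lexx xb.
  rewrite lee_fin ler_wpM2r ?(ltW (m_gt0 _))// ler_expR subr0 ler_wpM2l//.
  rewrite ler_pM2r// /x mulrCA ler_piMr ?(ltW t0)// ler_pdivrMr// mul1r ler_nat.
  exact: ltnW.
Qed.

End upper.

End scaling.

(** * Two-sided moment bounds on short intervals *)

Section cascade_scaling.

Let mT p n t : measurable_fun setT (tint (a p n) `[0, t]).
Proof. by apply: measurable_tint => //; [exact: jmeas_wprod|exact: wprod_ge0]. Qed.
Let T0 p n t w : 0 <= tint (a p n) `[0, t] w.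
Proof. by apply: tint_ge0; exact: wprod_ge0. Qed.
Let mrs p n t N : measurable_fun setT (rs p n t N).
Proof. exact: measurable_rsum. Qed.

Let tint_kfin p n t : (p <= n)%N -> 0 <= t ->
  (mean P (fun w => tint (a p n) `[0, t] w ^+ k)%R <= (M k ^+ (n - p) * t ^+ k)%:E)%E.
Proof.
move=> pn t0.
have := mean_tint_near t pn (leqnn n) (leqnn k) (lexx 0).
move/le_trans; apply; under eq_mean do rewrite tint_wprodnn// subr0.
by rewrite mean_cst EFinM.
Qed.

(** Convergence in [L_1] plus [k]-th moments bounded uniformly in the mesh. That bound grows with
    [n - p], which is harmless since the levels are fixed here. *)
Lemma rsum_pow_small p n t q : (p <= n)%N -> 0 < t -> 0 < q < k%:R ->
  mean_small P (fun N w => `|tint (a p n) `[0, t] w - rs p n t N w| `^ q).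
Proof.
move=> pn t0 qk.
have K0 : 0 <= M k ^+ (n - p) * t ^+ k.
  by rewrite mulr_ge0 ?exprn_ge0 ?(ltW t0)// (le_trans ler01).
apply: (@mean_small_powR _ _ _ P _ q k (2 ^+ k * (M k ^+ (n - p) * t ^+ k + M k ^+ (n - p) * t ^+ k))) => //.
- by move=> N; apply: measurableT_comp => //; exact: measurable_funB.
- by rewrite mulr_ge0 ?exprn_ge0// addr_ge0.
- exact/rsum_small/ltW.
move=> N.
have mk (f : T -> R) : measurable_fun setT f -> measurable_fun setT (fun w => f w ^+ k).
  by move=> mf; exact: measurable_funX.
have r0 w : 0 <= rs p n t N w by exact/rsum_ge0/ltW.
apply: (@le_trans _ _ (mean P (fun w => 2 ^+ k * (tint (a p n) `[0, t] w ^+ k + rs p n t N w ^+ k)))).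
  apply: le_mean.
  - by apply: mk; apply: measurableT_comp => //; exact: measurable_funB.
  - by apply: measurable_funM => //; apply: measurable_funD; exact: mk.
  - by move=> w; exact: exprn_ge0.
  move=> w; apply: le_trans (exprDn_le _ (T0 _ _ _ _) (r0 _)).
  rewrite lerXn2r ?nnegrE ?addr_ge0//.
  by apply: le_trans (ler_normB _ _) _; rewrite !ger0_norm.
rewrite (meanZ P (exprn_ge0 _ (ler0n _ _)) (measurable_funD (mk _ (mT _ _ _)) (mk _ (mrs _ _ _ _)))
  (fun w => addr_ge0 (exprn_ge0 _ (T0 _ _ _ _)) (exprn_ge0 _ (r0 w)))).
rewrite (meanD P (mk _ (mT _ _ _)) (mk _ (mrs _ _ _ _)) (fun w => exprn_ge0 _ (T0 _ _ _ _))
  (fun w => exprn_ge0 _ (r0 w))).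
rewrite EFinM EFinD; apply: lee_wpmul2l; first by rewrite lee_fin exprn_ge0.
apply: leeD; first exact/tint_kfin/ltW.
have := rsum_pow_fin N t0 (q := k%:R) _ pn.
rewrite lexx (ltW k1) => /(_ isT).
rewrite (powR_mulrn _ (ltW t0)) /M leqnn; apply: le_trans.
rewrite le_eqVlt; apply/orP; left; apply/eqP; apply: eq_mean => w; rewrite powR_mulrn//.
Qed.

Let cst_small (t q : R) : 0 < q ->
  mean_small P (fun (N : nat) (w : T) => `|t - t : R| `^ q).
Proof.
move=> q0 e e0; exists 0%N => n _; under eq_mean do rewrite subrr normr0 powR0 ?gt_eqF//.
by rewrite mean_cst lee_fin ltW.
Qed.

Section exponent.
Variable q : R.
Hypothesis qk : 0 < q < k%:R.

Let q0 : 0 < q. Proof. by case/andP: qk. Qed.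
Let q1k : 1 <= q -> 1 <= q <= k%:R. Proof. by case/andP: qk => _ /ltW -> ->. Qed.
Let mq0 n : 0 < m q ^+ n. Proof. by rewrite exprn_gt0. Qed.
Let rsG p n t N w : 0 < t -> 0 <= rs p n t N w. Proof. by move=> t0; exact/rsum_ge0/ltW. Qed.

Lemma tint_pow_strip_le p n t : 1 <= q -> (p <= n)%N -> 0 < t ->
  (mean P (fun w => tint (a 0 n) `[0, t] w `^ q)%R <=
   (4 `^ q * m q ^+ p)%:E * mean P (fun w => tint (a p n) `[0, t] w `^ q)%R)%E.
Proof.
move=> q1 pn t0.
apply: (@mean_powR_transfer _ _ _ P (rs 0 n t) (rs p n t)) => //.
- exact/ltW/mq0.
- by move=> N w; exact: rsG.
- by move=> N w; exact: rsG.
- exact: rsum_pow_small.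
- exact: rsum_pow_small.
move=> N; rewrite -[X in m q ^+ X]subn0.
exact: (rsum_iter_le N t0 (q1k q1) (leq0n p) pn).
Qed.

Lemma tint_pow_strip_ge p n t : q <= 1 -> (p <= n)%N -> 0 < t ->
  (mean P (fun w => tint (a p n) `[0, t] w `^ q)%R <=
   (4 `^ q * (m q ^+ p)^-1)%:E * mean P (fun w => tint (a 0 n) `[0, t] w `^ q)%R)%E.
Proof.
move=> q1 pn t0.
apply: (@mean_powR_transfer _ _ _ P (rs p n t) (rs 0 n t)) => //.
- by rewrite invr_ge0; exact/ltW/mq0.
- by move=> N w; exact: rsG.
- by move=> N w; exact: rsG.
- exact: rsum_pow_small.
- exact: rsum_pow_small.
move=> N; rewrite lee_pdivlMl//.
by apply: (rsum_iter_ge N t0) => //; rewrite q0.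
Qed.

Let bV_sum p p' : (p' <= p)%N -> \sum_(l < p') b ^- p * b ^+ l <= b ^- (p - p') / (b - 1).
Proof.
move=> p'p; have bb : 0 < b - 1 by rewrite subr_gt0.
have E : \sum_(l < p') b ^+ l = (b ^+ p' - 1) / (b - 1).
  by rewrite subrX1 mulrC mulKf// gt_eqF.
rewrite -mulr_sumr E mulrA ler_pM2r ?invr_gt0//.
rewrite mulrBr mulr1 -{1}(subnK p'p) exprD invfM -mulrA mulVf ?gt_eqF// mulr1.
by rewrite lerBlDr lerDl ltW.
Qed.

(** Stripping all [p] levels would accumulate an error of up to [q * c / (b - 1)], possibly more
    than [1]. The last [i] levels are kept, which brings the error below [1 / 2]; Jensen's
    inequality handles them, and the factor [m q ^+ i] goes into the constant. *)
Lemma tint_pow_ge_low c : 1 <= q -> 0 <= c ->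
  (forall j s s', 0 <= s <= s' ->
    ((expR (- (c * (s' - s))) * m q)%:E <= mean P (fun w => L j s w `^ (q - 1) * L j s' w)%R)%E) ->
  exists2 D, 0 < D & forall p n, (p <= n)%N ->
    ((D * (m q ^+ p * (b ^- p) `^ q))%:E <= mean P (fun w => tint (a 0 n) `[0, b ^- p] w `^ q)%R)%E.
Proof.
move=> q1 c0 low; have bb : 0 < b - 1 by rewrite subr_gt0.
have q_ge0 : 0 <= q by exact: ltW.
have bi : 0 <= b^-1 < 1 by rewrite invr_ge0 (ltW b0) invf_lt1.
have ei : 0 < (b - 1) / (2 * (q * c + 1)).
  by rewrite divr_gt0// mulr_gt0// ltr_wpDl ?mulr_ge0.
have [i hi] : exists i, b ^- i <= (b - 1) / (2 * (q * c + 1)).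
  have /cvgrPdist_le/(_ _ ei)[i _ hi] : b^-1 ^+ i @[i --> \oo] --> 0.
    by apply: cvg_expr; rewrite ger0_norm; case/andP: bi.
  by exists i; have /= := hi i (leqnn _); rewrite sub0r normrN -exprVn ger0_norm// exprn_ge0//; case/andP: bi.
exists (4 `^ q * 2 * m q ^+ i)^-1.
  by rewrite invr_gt0 !mulr_gt0 ?powR_gt0.
move=> p n pn; set t := b ^- p; have t0 : 0 < t by exact: bV0.
pose p' := (p - i)%N; have p'p : (p' <= p)%N by exact: leq_subr.
have S2 : \sum_(l < p') q * (c * (t * b ^+ l)) <= 2^-1.
  rewrite (eq_bigr (fun l : 'I_p' => q * c * (t * b ^+ l))); last by move=> l _; rewrite mulrA.
  rewrite -mulr_sumr; have [ip|pi] := leqP i p; last first.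
    have -> : p' = 0%N by apply/eqP; rewrite subn_eq0 ltnW.
    by rewrite big_ord0 mulr0.
  apply: (@le_trans _ _ (q * c * (b ^- i / (b - 1)))).
    apply: ler_wpM2l; first exact: mulr_ge0.
    by have := bV_sum p'p; rewrite subKn.
  apply: (@le_trans _ _ (q * c * (2 * (q * c + 1))^-1)).
    apply: ler_wpM2l; first exact: mulr_ge0.
    by rewrite ler_pdivrMr// mulrC.
  have qc : 0 <= q * c by exact: mulr_ge0.
  rewrite ler_pdivrMr ?mulr_gt0 ?ltr_wpDl//.
  lra.
have := @mean_powR_transfer _ _ _ P (fun _ _ => t) (rs 0 n t) (fun=> t) (tint (a 0 n) `[0, t]) q
  (2 * (m q ^+ p')^-1) q0.
rewrite mean_cst => tr.
have {}tr : ((t `^ q)%:E <= (4 `^ q * (2 * (m q ^+ p')^-1))%:E *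
    mean P (fun w => (tint (a 0 n) `[0, t] w `^ q)%R))%E.
  apply: tr => //.
  - by rewrite mulr_ge0// invr_ge0 ltW.
  - by move=> N w; exact: ltW.
  - by move=> N w; exact: rsG.
  - by move=> w; exact: ltW.
  - exact: cst_small.
  - exact: rsum_pow_small.
  move=> N.
  have h1 := rsum_pow_ge N t0 p' n q1.
  have := rsum_iter_low N t0 c0 (q1k q1) low (leq_trans p'p pn).
  have : (0 <= mean P (fun w => (rs 0 n t N w `^ q)%R))%E by apply: mean_ge0 => w; exact: powR_ge0.
  case: (mean P (fun w => (rs 0 n t N w `^ q)%R)) => [r| |] //; last first.
    by move=> _ _; rewrite gt0_muley ?leey// lte_fin mulr_gt0 ?invr_gt0.
  rewrite lee_fin -EFinM => r0 h2; rewrite lee_fin -ler_pdivrMl ?mulr_gt0 ?invr_gt0//.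
  rewrite -lee_fin; apply: le_trans h2.
  apply: (@le_trans _ _ ((2^-1 * m q ^+ p')%:E * (t `^ q)%:E)%E).
    by rewrite -EFinM lee_fin invfM invrK.
  apply: lee_pmul => //.
  - by rewrite lee_fin mulr_ge0 ?invr_ge0// ltW.
  - by rewrite lee_fin powR_ge0.
  - by rewrite lee_fin ler_wpM2r ?(ltW (mq0 _))//; lra.
have F0 : 0 < 4 `^ q * 2 * m q ^+ i by rewrite !mulr_gt0 ?powR_gt0.
move: tr; have : (0 <= mean P (fun w => (tint (a 0 n) `[0, t] w `^ q)%R))%E.
  by apply: mean_ge0 => w; exact: powR_ge0.
case: (mean P _) => [r|_ _|//]; last by rewrite leey.
rewrite lee_fin -EFinM !lee_fin => r0 h.
have mpi : m q ^+ p <= m q ^+ p' * m q ^+ i.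
  by rewrite -exprD ler_weXn2l ?(m_ge1 (q1k q1))// addnC -leq_subLR.
rewrite ler_pdivrMl// (le_trans (ler_wpM2r _ mpi)) ?powR_ge0//.
apply: (le_trans (ler_wpM2l _ h)); first by rewrite mulr_ge0 ?(ltW (mq0 _)).
rewrite le_eqVlt; apply/orP; left; apply/eqP; field.
by rewrite expf_neq0// gt_eqF.
Qed.

(** The errors are now factors [expR (c * (t * b ^+ l))], whose product stays below
    [expR (c / (b - 1))]; so all [p] levels can be stripped. *)
Lemma tint_pow_le_up c : q <= 1 -> 0 <= c ->
  (forall j s s', 0 <= s <= s' ->
    (mean P (fun w => L j s w `^ (q - 1) * L j s' w)%R <= (expR (c * (s' - s)) * m q)%:E)%E) ->
  exists2 D, 0 < D & forall p n, (p <= n)%N ->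
    (mean P (fun w => tint (a 0 n) `[0, b ^- p] w `^ q)%R <= (D * (m q ^+ p * (b ^- p) `^ q))%:E)%E.
Proof.
move=> q1 c0 up; have bb : 0 < b - 1 by rewrite subr_gt0.
exists (4 `^ q * expR (c / (b - 1))); first by rewrite mulr_gt0 ?powR_gt0 ?expR_gt0.
move=> p n pn; set t := b ^- p; have t0 : 0 < t by exact: bV0.
have S2 : \sum_(l < p) c * (t * b ^+ l) <= c / (b - 1).
  rewrite -mulr_sumr; apply: ler_wpM2l => //.
  by apply: (le_trans (bV_sum (leqnn p))); rewrite subnn expr0 invr1 mul1r.
have q01 : 0 < q <= 1 by rewrite q0.
have := @mean_powR_transfer _ _ _ P (rs 0 n t) (fun _ _ => t) (tint (a 0 n) `[0, t]) (fun=> t) q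
  (expR (c / (b - 1)) * m q ^+ p) q0.
rewrite mean_cst !mulrA -EFinM => tr; apply: tr => //.
- by rewrite mulr_ge0 ?expR_ge0// ltW.
- by move=> N w; exact: rsG.
- by move=> N w; exact: ltW.
- by move=> w; exact: ltW.
- exact: rsum_pow_small.
- exact: cst_small.
move=> N; rewrite EFinM.
apply: (le_trans (rsum_iter_up N t0 c0 q01 up pn)).
apply: lee_pmul.
- by rewrite lee_fin mulr_ge0 ?expR_ge0// ltW.
- by apply: mean_ge0 => w; exact: powR_ge0.
- by rewrite lee_fin ler_wpM2r ?(ltW (mq0 _))// ler_expR.
- exact: (rsum_pow_le N t0 p n q01).
Qed.

(** After stripping [p] levels, [x ^ q <= t ^ q + t ^ (q - k) * x ^ k] with [t = b ^- p] reduces the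
    rest to the moment of order [k], of size [t ^ k]. *)
Lemma tint_pow_le_ge1 : 1 <= q -> exists2 D, 0 < D & forall p n, (p <= n)%N ->
  (mean P (fun w => tint (a 0 n) `[0, b ^- p] w `^ q)%R <= (D * (m q ^+ p * (b ^- p) `^ q))%:E)%E.
Proof.
move=> q1; have [|K K0 hK] := moment_bound (r := k); first by rewrite (ltn_trans _ k2)//=.
exists (4 `^ q * (1 + K)); first by rewrite mulr_gt0 ?powR_gt0// ltr_pwDl.
move=> p n pn; set t := b ^- p; have t0 : 0 < t by exact: bV0.
apply: (le_trans (tint_pow_strip_le q1 pn t0)).
have tk : 0 <= t `^ (q - k%:R) by exact: powR_ge0.
have tkE : t `^ (q - k%:R) * t ^+ k = t `^ q.
  by rewrite -powR_mulrn ?(ltW t0)// -powRD ?subrK// (gt_eqF t0) implybT.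
have mX : measurable_fun setT (fun w => tint (a p n) `[0, t] w ^+ k) by exact: measurable_funX.
have X0 w : 0 <= tint (a p n) `[0, t] w ^+ k by exact: exprn_ge0.
have h : (mean P (fun w => tint (a p n) `[0, t] w `^ q)%R <= ((1 + K) * t `^ q)%:E)%E.
  apply: (@le_trans _ _ (mean P (fun w => t `^ q + t `^ (q - k%:R) * tint (a p n) `[0, t] w ^+ k))).
    apply: le_mean.
    - exact: (measurableT_comp (measurable_powR q)).
    - by apply: measurable_funD => //; exact: measurable_funM.
    - by move=> w; exact: powR_ge0.
    move=> w; set x := tint _ _ _; have x0 : 0 <= x by exact: T0.
    have [xt|tx] := leP x t.
      apply: (@le_trans _ _ (t `^ q)); last by rewrite lerDl mulr_ge0// exprn_ge0.
      by apply: ge0_ler_powR; rewrite ?nnegrE ?(ltW q0) ?(ltW t0).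
    have xp : 0 < x by exact: lt_trans tx.
    apply: (@le_trans _ _ (t `^ (q - k%:R) * x ^+ k)); last by rewrite lerDr powR_ge0.
    rewrite (_ : x `^ q = x `^ (q - k%:R) * x ^+ k); last first.
      by rewrite -powR_mulrn// -powRD ?subrK// (gt_eqF xp) implybT.
    rewrite ler_wpM2r ?exprn_ge0// -[q - _]opprB !powRN lef_pV2 ?posrE ?powR_gt0//.
    by apply: ge0_ler_powR; rewrite ?nnegrE ?(ltW t0) ?(ltW tx)// subr_ge0 ltW//; case/andP: qk.
  rewrite (meanD P (measurable_cst _) (measurable_funM (measurable_cst _) mX)
    (fun=> powR_ge0 _ _) (fun w => mulr_ge0 tk (X0 w))).
  rewrite mean_cst (meanZ P tk mX X0) mulrDl mul1r EFinD leeD2l//.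
  have := hK p n 0 pn (lexx 0); rewrite add0r -/t => hk.
  apply: (le_trans (lee_wpmul2l _ hk)); first by rewrite lee_fin.
  by rewrite -EFinM lee_fin mulrCA tkE.
apply: (le_trans (lee_wpmul2l _ h)); first by rewrite lee_fin mulr_ge0 ?powR_ge0// ltW.
by rewrite -EFinM lee_fin le_eqVlt; apply/orP; left; apply/eqP; ring.
Qed.

(** A variable of mean [t] and second moment at most [K * t ^ 2] keeps half of its mean below
    [H * t], by the choice of [H]; there [x <= (H * t) ^ (1 - q) * x ^ q]. *)
Lemma tint_pow_ge_le1 : q <= 1 -> exists2 D, 0 < D & forall p n, (p <= n)%N ->
  ((D * (m q ^+ p * (b ^- p) `^ q))%:E <= mean P (fun w => tint (a 0 n) `[0, b ^- p] w `^ q)%R)%E.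
Proof.
move=> q1; have [|K K0 hK] := moment_bound (r := 2); first by rewrite k2.
pose H := 2 * (K + 1); have H0 : 0 < H by rewrite mulr_gt0// ltr_wpDl.
exists (4 `^ q * (2 * H `^ (1 - q)))^-1; first by rewrite invr_gt0 !mulr_gt0 ?powR_gt0.
move=> p n pn; set t := b ^- p; have t0 : 0 < t by exact: bV0.
have Ht : 0 < H * t by exact: mulr_gt0.
have tk : 0 <= (H * t) `^ (1 - q) by exact: powR_ge0.
have Hi : 0 <= (H * t)^-1 by rewrite invr_ge0 ltW.
have mX : measurable_fun setT (fun w => tint (a p n) `[0, t] w ^+ 2) by exact: measurable_funX.
have mXq : measurable_fun setT (fun w => tint (a p n) `[0, t] w `^ q).
  exact: (measurableT_comp (measurable_powR q)).
have X0 w : 0 <= tint (a p n) `[0, t] w ^+ 2 by exact: exprn_ge0.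
have Xq0 w : 0 <= tint (a p n) `[0, t] w `^ q by exact: powR_ge0.
have h : (t%:E <= ((H * t) `^ (1 - q))%:E * mean P (fun w => tint (a p n) `[0, t] w `^ q)%R +
    (t / 2)%:E)%E.
  have {1}<- : mean P (tint (a p n) `[0, t]) = t%:E.
    rewrite -[X in X%:E]subr0.
    by apply: (mean_tint_wprod); rewrite lexx ltW.
  apply: (@le_trans _ _ (mean P (fun w => (H * t) `^ (1 - q) * tint (a p n) `[0, t] w `^ q +
     (H * t)^-1 * tint (a p n) `[0, t] w ^+ 2))).
    apply: le_mean => //.
    - by apply: measurable_funD; exact: measurable_funM.
    move=> w; set x := tint _ _ _; have x0 : 0 <= x by exact: T0.
    have [xt|tx] := leP x (H * t); last first.
      apply: (@le_trans _ _ ((H * t)^-1 * x ^+ 2)); last by rewrite lerDr mulr_ge0// powR_ge0.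
      by rewrite ler_pdivlMl// expr2 ler_wpM2r// ltW.
    apply: (@le_trans _ _ ((H * t) `^ (1 - q) * x `^ q)); last by rewrite lerDl mulr_ge0 ?sqr_ge0.
    have [->|xn0] := eqVneq x 0; first by rewrite mulr_ge0 ?powR_ge0.
    have {1}-> : x = x `^ (1 - q) * x `^ q.
      by rewrite -powRD ?subrK ?powRr1// xn0 implybT.
    rewrite ler_wpM2r ?powR_ge0//.
    by apply: ge0_ler_powR; rewrite ?nnegrE ?subr_ge0 ?(ltW Ht).
  rewrite (meanD P (measurable_funM (measurable_cst _) mXq) (measurable_funM (measurable_cst _) mX)
    (fun w => mulr_ge0 tk (Xq0 w)) (fun w => mulr_ge0 Hi (X0 w))).
  rewrite (meanZ P tk mXq Xq0) (meanZ P Hi mX X0) leeD2l//.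
  have := hK p n 0 pn (lexx 0); rewrite add0r -/t => hk.
  apply: (le_trans (lee_wpmul2l _ hk)); first by rewrite lee_fin.
  rewrite -EFinM lee_fin (_ : (H * t)^-1 * (K * t ^+ 2) = (K / (K + 1)) * (t / 2)); last first.
    by rewrite /H; field; rewrite !gt_eqF// ltr_wpDl.
  by rewrite ler_piMl ?divr_ge0 ?(ltW t0)// ler_pdivrMr ?ltr_wpDl// mul1r; lra.
suff aux (x y : \bar R) : (0 <= x)%E -> (0 <= y)%E ->
    (t%:E <= ((H * t) `^ (1 - q))%:E * y + (t / 2)%:E)%E ->
    (y <= (4 `^ q * (m q ^+ p)^-1)%:E * x)%E ->
    (((4 `^ q * (2 * H `^ (1 - q)))^-1 * (m q ^+ p * t `^ q))%:E <= x)%E.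
  by apply: aux h (tint_pow_strip_ge q1 pn t0); apply: mean_ge0 => w; exact: powR_ge0.
clear h; case: x => [r|_ _ _ _|//]; last by rewrite leey.
case: y => [r'| |] //.
rewrite !lee_fin => r0 r'0 h hs.
have HE : (H * t) `^ (1 - q) * t `^ q = H `^ (1 - q) * t.
  rewrite powRM ?(ltW H0) ?(ltW t0)// -mulrA -powRD ?subrK ?powRr1 ?(ltW t0)//.
  by rewrite (gt_eqF t0) implybT.
rewrite ler_pdivrMl ?mulr_gt0 ?powR_gt0//.
have {}h : t `^ q <= 2 * H `^ (1 - q) * r'.
  have h2 : t <= 2 * ((H * t) `^ (1 - q) * r') by lra.
  rewrite -(ler_pM2l (powR_gt0 (1 - q) Ht)) HE mulrCA.
  rewrite (_ : 2 * _ * _ = H `^ (1 - q) * (2 * ((H * t) `^ (1 - q) * r'))); last by ring.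
  by rewrite ler_pM2l// powR_gt0.
have hs' : m q ^+ p * r' <= 4 `^ q * r.
  by rewrite -ler_pdivlMl// mulrCA mulrA.
apply: (le_trans (ler_wpM2l (ltW (mq0 p)) h)).
rewrite (_ : m q ^+ p * _ = 2 * H `^ (1 - q) * (m q ^+ p * r')); last by ring.
rewrite (_ : 4 `^ q * _ * r = 2 * H `^ (1 - q) * (4 `^ q * r)); last by ring.
by rewrite ler_wpM2l// mulr_ge0// powR_ge0.
Qed.

End exponent.

Lemma tint_pow_bounds q : 0 < q < k%:R -> exists D1 D2, [/\ 0 < D1, 0 < D2 &
  forall p n, (p <= n)%N ->
    ((D1 * (m q ^+ p * (b ^- p) `^ q))%:E <= mean P (fun w => tint (a 0 n) `[0, b ^- p] w `^ q)%R
     <= (D2 * (m q ^+ p * (b ^- p) `^ q))%:E)%E].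
Proof.
move=> /andP[q0 qk]; have [q1|/ltW q1] := leP q 1.
  have [|c c0 up] := L_up (q := q); first by rewrite q0.
  have [|D1 D10 h1] := @tint_pow_ge_le1 q _ q1; first by rewrite q0.
  have [|D2 D20 h2] := @tint_pow_le_up q _ c q1 c0 up; first by rewrite q0.
  by exists D1, D2; split => // p n pn; rewrite h1// h2.
have [|c c0 low] := L_low (q := q); first by rewrite q1.
have [|D1 D10 h1] := @tint_pow_ge_low q _ c q1 c0 low; first by rewrite q0.
have [|D2 D20 h2] := @tint_pow_le_ge1 q _ q1; first by rewrite q0.
by exists D1, D2; split => // p n pn; rewrite h1// h2.
Qed.

Let bpow_scaling q p : m q ^+ p * (b ^- p) `^ q = (b ^- p) `^ (q - ln (m q) / ln b).
Proof.
have lnb : ln b != 0 by rewrite gt_eqF// ln_gt0.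
have -> : b ^- p = expR (- (p%:R * ln b)) by rewrite expRN expRM_natl lnK.
have -> : m q ^+ p = expR (p%:R * ln (m q)) by rewrite expRM_natl lnK// posrE.
rewrite -!expRM -expRD; congr expR.
move: (ln b) (ln (m q)) (p%:R) lnb => x y z x0; by field.
Qed.

Let powR_compare (u v s : R) : 0 < u -> u <= v <= b * u ->
  v `^ s <= b `^ `|s| * u `^ s /\ u `^ s <= b `^ `|s| * v `^ s.
Proof.
move=> u0 /andP[uv vbu]; have v0 : 0 < v by exact: lt_le_trans uv.
have lnb : 0 < ln b by rewrite ln_gt0.
have l1 : ln u <= ln v by rewrite ler_ln.
have l2 : ln v <= ln b + ln u by rewrite -lnM ?posrE// ler_ln ?posrE// mulr_gt0.
rewrite /powR !gt_eqF// -!expRD !ler_expR.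
have h : `|s * (ln v - ln u)| <= `|s| * ln b.
  by rewrite normrM ler_wpM2l// ger0_norm ?subr_ge0//; lra.
have := ler_norm (s * (ln v - ln u)); have := lerNnormlW h; lra.
Qed.

Let scale_index t : 0 < t <= 1 -> exists p, b ^- p.+1 < t <= b ^- p.
Proof.
move=> /andP[t0 t1].
have ex : exists n, b ^- n < t.
  have /cvgrPdist_lt/(_ _ t0)[i _ hi] : b^-1 ^+ i @[i --> \oo] --> 0.
    by apply: cvg_expr; rewrite ger0_norm ?invr_ge0 ?(ltW b0)// invf_lt1.
  exists i; have /= := hi i (leqnn _); rewrite sub0r normrN exprVn ger0_norm//; exact: ltW.
case: (ex_minnP ex) => [[|p]]; first by rewrite expr0 invr1 ltNge t1.
by move=> hp hmin; exists p; rewrite hp leNgt; apply/negP => /hmin; rewrite ltnn.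
Qed.

Let le_tint_pow n u v q : 0 < q -> u <= v ->
  (mean P (fun w => tint (a 0 n) `[0, u] w `^ q)%R <= mean P (fun w => tint (a 0 n) `[0, v] w `^ q)%R)%E.
Proof.
move=> q0 uv; have mp t : measurable_fun setT (fun w => tint (a 0 n) `[0, t] w `^ q).
  exact: (measurableT_comp (measurable_powR q)).
apply: le_mean_ae => //; try by move=> w; exact: powR_ge0.
have := ae_integrable_wprod 0 n v.
apply: filterS => w Iw; apply: ge0_ler_powR; rewrite ?nnegrE ?(ltW q0)//.
by apply: (Rintegral_subitv _ Iw) => //; move=> s; exact: wprod_ge0.
Qed.

(** Interpolates between [b ^- p.+1 < t <= b ^- p]. Both neighbouring bounds require at least
    [p + 1] levels, so [N] depends on [t] while the constants do not. *)
Lemma tint_scaling q : 0 < q < k%:R -> exists D1 D2, [/\ 0 < D1, 0 < D2 &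
  forall t, 0 < t <= 1 -> exists N, forall n, (N <= n)%N ->
    ((D1 * t `^ (q - ln (m q) / ln b))%:E <= mean P (fun w => tint (a 0 n) `[0, t] w `^ q)%R
     <= (D2 * t `^ (q - ln (m q) / ln b))%:E)%E].
Proof.
move=> qk; have [q0 _] := andP qk; have [D1 [D2 [D10 D20 hD]]] := tint_pow_bounds qk.
set s := q - _; pose F := b `^ `|s|; have F0 : 0 < F by rewrite powR_gt0.
exists (D1 / F), (D2 * F); split; [by rewrite divr_gt0|by rewrite mulr_gt0|].
move=> t t01; have [p /andP[pt tp]] := scale_index t01.
have t0 : 0 < t by case/andP: t01.
have bE : b ^- p = b * b ^- p.+1 by rewrite exprS invfM mulrA divff ?mul1r// gt_eqF.
exists p.+1 => n pn; apply/andP; split.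
- apply: le_trans (le_tint_pow n q0 (ltW pt)).
  have /andP[+ _] := hD _ _ pn; apply: le_trans; rewrite bpow_scaling -/s lee_fin.
  rewrite -mulrA ler_pM2l// ler_pdivrMl//.
  by have [|] := powR_compare (u := b ^- p.+1) (v := t) s (bV0 _); rewrite ?(ltW pt)// -bE.
- apply: (le_trans (le_tint_pow n q0 tp)).
  have /andP[_ +] := hD _ _ (ltnW pn); move/le_trans; apply; rewrite bpow_scaling -/s lee_fin.
  rewrite -mulrA ler_pM2l//.
  have [|//] := powR_compare (u := t) (v := b ^- p) s t0; rewrite tp/= bE.
  by rewrite ler_pM2l// ltW.
Qed.

End cascade_scaling.

(** * The limit and its properties *)

Section cascade_limit.

Let mT p n t : measurable_fun setT (tint (a p n) `[0, t]).
Proof. by apply: measurable_tint => //; [exact: jmeas_wprod|exact: wprod_ge0]. Qed.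
Let T0 p n t w : 0 <= tint (a p n) `[0, t] w.
Proof. by apply: tint_ge0; exact: wprod_ge0. Qed.

Let sb j s : 0 <= s -> 0 <= s * b ^+ j. Proof. by move=> s0; rewrite mulr_ge0// ltW. Qed.

Let ma p n s : measurable_fun setT (a p n s).
Proof. by apply: jmeas_section; exact: jmeas_wprod. Qed.

(* The factors of index between [n] and [n'] have mean one and are independent of the others. *)
Let mean_wprodM n n' u v : (n <= n')%N -> 0 <= u -> 0 <= v ->
  mean P (fun w => a 0 n u w * a 0 n' v w) = mean P (fun w => a 0 n u w * a 0 n v w).
Proof.
move=> nn' u0 v0.
pose U j w := (if (j < n)%N then L j (u * b ^+ j) w else 1) * L j (v * b ^+ j) w.
have mU j : measurable_fun (setT : set (g_sigma_algebraType
    (\bigcup_(t in `[0, +oo[) sigma_rv (L j t)))) (U j).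
  have mL s : 0 <= s -> measurable_fun (setT : set (g_sigma_algebraType
      (\bigcup_(t in `[0, +oo[) sigma_rv (L j t)))) (L j (s * b ^+ j)).
    by move=> s0; apply: measurable_coord; exact: sb.
  rewrite /U; case: (j < n)%N; apply: measurable_funM; try exact: mL.
  exact: measurable_cst.
have U0 j w : 0 <= U j w by rewrite mulr_ge0 ?(ltW (L_gt0 _ _ _))//; case: ifP => // _; exact: ltW.
have UE w l : (n <= l)%N -> a 0 n u w * a 0 l v w = \prod_(0 <= j < l) U j w.
  move=> nl; rewrite big_split/= /wprod; congr (_ * _).
  rewrite (@big_cat_nat _ _ _ n 0 l)//= [X in _ * X]big_nat_cond [X in _ * X]big1 ?mulr1; last first.
    by move=> j; rewrite andbT => /andP[nj _]; rewrite ltnNge nj.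
  by rewrite big_nat [RHS]big_nat; apply: eq_bigr => j /andP[_ ->].
transitivity (mean P (fun w => \prod_(0 <= j < n') U j w)).
  by apply: eq_mean => w; rewrite UE.
transitivity (mean P (fun w => \prod_(0 <= j < n) U j w)); last first.
  by apply: eq_mean => w; rewrite UE.
rewrite !(mean_prod_nat L_process L_indep)//.
rewrite (@big_cat_nat _ _ _ n 0 n')//= [X in (_ * X)%E]big_nat_cond [X in (_ * X)%E]big1 ?mule1// => j.
rewrite andbT => /andP[nj _]; rewrite /U ltnNge nj /=.
by under eq_mean do rewrite mul1r; rewrite L_mean1// sb.
Qed.

Let fin_wprod n (t : R) : (\int[lebesgue_measure]_(s in `[0%R, t]) mean P (a 0 n s) < +oo)%E.
Proof. exact: (wprod_fin). Qed.

Let mean_tint_prod n n' t :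
  mean P (fun w => tint (a 0 n) `[0, t] w * tint (a 0 n') `[0, t] w) =
  (\int[lebesgue_measure]_(v in `[0%R, t]) \int[lebesgue_measure]_(u in `[0%R, t])
     mean P (fun w => a 0 n u w * a 0 n' v w)%R)%E.
Proof.
rewrite (mean_tintM (measurable_itv _) (jmeas_wprod 0 n') (wprod_ge0 0 n')
  (fin_wprod n' t) (mT 0 n t) (T0 0 n t)).
apply: eq_integral => v _; under eq_mean do rewrite mulrC.
rewrite (mean_tintM (measurable_itv _) (jmeas_wprod 0 n) (wprod_ge0 0 n)
  (fin_wprod n t) (ma 0 n' v) (wprod_ge0 0 n' v)).
by apply: eq_integral => u _; apply: eq_mean => w; rewrite mulrC.
Qed.

(** Orthogonality of martingale increments, obtained from Tonelli's theorem and independence without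
    conditional expectations. *)
Let mean_tint_cross n n' t : (n <= n')%N ->
  mean P (fun w => tint (a 0 n) `[0, t] w * tint (a 0 n') `[0, t] w) =
  mean P (fun w => tint (a 0 n) `[0, t] w ^+ 2).
Proof.
move=> nn'; transitivity (mean P (fun w => tint (a 0 n) `[0, t] w * tint (a 0 n) `[0, t] w)); last first.
  by apply: eq_mean => w; rewrite expr2.
rewrite !mean_tint_prod; apply: eq_integral => v; rewrite inE/= in_itv/= => /andP[v0 _].
by apply: eq_integral => u; rewrite inE/= in_itv/= => /andP[u0 _]; exact: mean_wprodM.
Qed.

Section fixed_time.
Variable t : R.
Hypothesis t01 : 0 <= t <= 1.
Let t0 : 0 <= t. Proof. by case/andP: t01. Qed.

Local Notation f n := (tint (a 0 n.+1) `[0, t]).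

Let mX r n : measurable_fun setT (fun w => f n w ^+ r).
Proof. exact: measurable_funX. Qed.

Let X0 r n w : 0 <= f n w ^+ r. Proof. exact: exprn_ge0. Qed.

Let moment_le r : (0 < r <= k)%N -> exists2 K, 0 <= K & forall n,
  (mean P (fun w => f n w ^+ r)%R <= K%:E)%E.
Proof.
move=> rk; have [K K0 hK] := moment_bound rk; exists K => // n.
have := hK 0%N n.+1 0 (leq0n _) (lexx 0); rewrite add0r expr0 invr1 expr1n mulr1.
apply: le_trans; apply: le_mean_ae => //.
- exact: measurable_funX.
- by move=> w; exact: exprn_ge0.
have := ae_integrable_wprod 0 n.+1 1.
apply: filterS => w Iw; rewrite lerXn2r ?nnegrE//.
by apply: (Rintegral_subitv _ Iw) => //; [move=> s; exact: wprod_ge0|case/andP: t01].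
Qed.

Let e n := fine (mean P (fun w => f n w ^+ 2)).

Let eE n : mean P (fun w => f n w ^+ 2) = (e n)%:E.
Proof.
have [|K K0 hK] := moment_le (r := 2); first by rewrite k2.
rewrite fineK// ge0_fin_numE; last exact: mean_ge0.
by apply: le_lt_trans (hK n) _; rewrite ltry.
Qed.

Let increment_eq (z : \bar R) x y : (y%:E + x%:E = z + (2%:E * x%:E))%E -> z = (y - x)%:E.
Proof. by case: z => [r| |] // [h]; congr EFin; lra. Qed.

Let increment n n' : (n <= n')%N ->
  mean P (fun w => (f n' w - f n w) ^+ 2) = (e n' - e n)%:E.
Proof.
move=> nn'.
have mD : measurable_fun setT (fun w => (f n' w - f n w) ^+ 2).
  by apply: measurable_funX; exact: measurable_funB.
have mP : measurable_fun setT (fun w => f n w * f n' w) by exact: measurable_funM.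
have P0 w : 0 <= f n w * f n' w by exact: mulr_ge0.
have mP2 : measurable_fun setT (fun w => 2 * (f n w * f n' w)) by exact: measurable_funM.
have := meanD P mD mP2 (fun w => sqr_ge0 _) (fun w => mulr_ge0 (ler0n _ 2) (P0 w)).
rewrite (meanZ P (ler0n _ 2) mP P0) (mean_tint_cross t (nn' : (n.+1 <= n'.+1)%N)) eE.
rewrite (eq_mean P (g := fun w => f n' w ^+ 2 + f n w ^+ 2)); last by move=> w; ring.
rewrite (meanD P (mX 2 n') (mX 2 n) (X0 2 n') (X0 2 n)) !eE.
exact: increment_eq.
Qed.

(** Moments up to order [k] pass to the limit by Fatou's lemma along the almost surely convergent
    subsequence. *)
Let limit : exists g : T -> R, [/\ measurable_fun setT g, (forall w, 0 <= g w),
  mean_small P (fun n w => (f n w - g w) ^+ 2) &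
  forall r, (0 < r <= k)%N -> exists2 K, 0 <= K & (mean P (fun w => g w ^+ r)%R <= K%:E)%E].
Proof.
have [|K K0 hK] := moment_le (r := 2); first by rewrite k2.
have [|g [phi [mg g0 phi_ge fg small]]] := L2_limit (fun n => mT 0 n.+1 t)
  (fun n w => T0 0 n.+1 t w) (e := e) (B := K) _ increment.
  by move=> n; rewrite -lee_fin -eE.
exists g; split => // r rk; have [K' K'0 hK'] := moment_le rk; exists K' => //.
apply: (@fatou_mean _ _ _ P (fun i w => f (phi i) w ^+ r)) => //.
- exact: measurable_funX.
- by move=> w; exact: exprn_ge0.
- by apply: filterS fg => w hw; exact: (cvg_comp _ _ hw (@exprn_continuous R r (g w))).
- by exists 0%N => i _; exact: hK'.
Qed.

Lemma cascade_limit_fixed : exists g : T -> R, [/\ measurable_fun setT g, (forall w, 0 <= g w),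
  (forall q, 0 < q < k%:R -> mean_small P (fun n w => `|f n w - g w| `^ q)),
  mean P g = t%:E &
  (\int[lebesgue_measure]_(u in `[0%R, t]) \int[lebesgue_measure]_(v in `[0%R, t])
     mean P (fun w => L 0 u w * L 0 v w)%R <= mean P (fun w => g w ^+ 2)%R < +oo)%E].
Proof.
have [g [mg g0 small gmom]] := limit.
have mfg n : measurable_fun setT (fun w => f n w - g w) by exact: measurable_funB.
have mafg n : measurable_fun setT (fun w => `|f n w - g w|) by exact: measurableT_comp.
have small1 : mean_small P (fun n w => `|f n w - g w|) by exact: mean_small_sqr.
exists g; split => //.
- move=> q qk; have [|K K0 hK] := moment_le (r := k); first by rewrite leqnn (ltn_trans _ k2).
  have [|K' K'0 hK'] := gmom k; first by rewrite leqnn (ltn_trans _ k2).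
  apply: (@mean_small_powR _ _ _ P _ q k (2 ^+ k * (K + K'))) => //.
    by rewrite mulr_ge0 ?exprn_ge0// addr_ge0.
  move=> n; have mgk : measurable_fun setT (fun w => g w ^+ k) by exact: measurable_funX.
  have gk0 w : 0 <= g w ^+ k by exact: exprn_ge0.
  apply: (@le_trans _ _ (mean P (fun w => 2 ^+ k * (f n w ^+ k + g w ^+ k)))).
    apply: le_mean.
    + exact: measurable_funX.
    + by apply: measurable_funM => //; exact: measurable_funD.
    + by move=> w; exact: exprn_ge0.
    + move=> w; apply: le_trans (exprDn_le _ (T0 _ _ _ _) (g0 w)).
      rewrite lerXn2r ?nnegrE ?addr_ge0//.
      by apply: le_trans (ler_normB _ _) _; rewrite !ger0_norm.
  rewrite (meanZ P (exprn_ge0 _ (ler0n _ _)) (measurable_funD (mX k n) mgk)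
    (fun w => addr_ge0 (X0 k n w) (gk0 w))) (meanD P (mX k n) mgk (X0 k n) gk0).
  rewrite EFinM EFinD; apply: lee_wpmul2l; first by rewrite lee_fin exprn_ge0.
  by apply: leeD => //; exact: hK.
- have mf n : mean P (f n) = t%:E.
    rewrite -[t in t%:E]subr0.
    by apply: (mean_tint_wprod); rewrite lexx.
  apply/eqP; rewrite eq_le; apply/andP; split; apply/lee_addgt0Pr => x x0.
    have [N /(_ N (leqnn N)) hN] := small1 _ x0.
    apply: (@le_trans _ _ (mean P (fun w => f N w + `|f N w - g w|))).
      apply: le_mean => //; first exact: measurable_funD.
      by move=> w; have := ler_norm (g w - f N w); rewrite distrC; lra.
    rewrite (meanD P (mT 0 N.+1 t) (mafg N) (fun w => T0 0 N.+1 t w) (fun w => normr_ge0 _)).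
    by rewrite mf leeD2l.
  have [N /(_ N (leqnn N)) hN] := small1 _ x0.
  rewrite -(mf N); apply: (@le_trans _ _ (mean P (fun w => g w + `|f N w - g w|))).
    apply: le_mean => //; first exact: measurable_funD.
    by move=> w; have := ler_norm (f N w - g w); lra.
  by rewrite (meanD P mg (mafg N) g0 (fun w => normr_ge0 _)) leeD2l.
- have [|K K0 hK] := gmom 2; first by rewrite k2.
  have mg2 : measurable_fun setT (fun w => g w ^+ 2) by exact: measurable_funX.
  have g20 w : 0 <= g w ^+ 2 by exact: sqr_ge0.
  rewrite (le_lt_trans hK) ?ltry// andbT.
  (* The double integral is the second moment of the first approximation, whose density is [L 0]. *)
  have -> : (\int[lebesgue_measure]_(u in `[0%R, t]) \int[lebesgue_measure]_(v in `[0%R, t])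
     mean P (fun w => L 0 u w * L 0 v w)%R)%E = (e 0)%:E.
    rewrite -eE -(mean_tint_cross t (leqnn 1%N)) mean_tint_prod.
    apply: eq_integral => u _; apply: eq_integral => v _; apply: eq_mean => w.
    by rewrite /wprod !big_nat1 !expr0 !mulr1 mulrC.
  have eN n : (e 0 <= e n).
    rewrite -subr_ge0 -lee_fin -increment//; apply: mean_ge0 => w; exact: sqr_ge0.
  (* From [f ^ 2 <= (1 + h) * g ^ 2 + (1 + h^-1) * (f - g) ^ 2]: [h] makes [h] times the second
     moment of [g] at most [x / 2], and then [N] does the same for the last term. *)
  apply/lee_addgt0Pr => x x0; pose h := x / (2 * (K + 1)).
  have h0 : 0 < h by rewrite divr_gt0// mulr_gt0// ltr_wpDl.
  have y0 : 0 < x / 2 / (1 + h^-1) by rewrite !divr_gt0// ltr_pwDl// invr_ge0 ltW.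
  have [N /(_ N (leqnn N)) hN] := small _ y0.
  have mfg2 : measurable_fun setT (fun w => (f N w - g w) ^+ 2) by exact: measurable_funX.
  have h1 : 0 <= 1 + h by rewrite addr_ge0// ltW.
  have h1' : 0 <= 1 + h^-1 by rewrite addr_ge0// invr_ge0 ltW.
  apply: (@le_trans _ _ (e N)%:E); first by rewrite lee_fin.
  rewrite -eE.
  apply: (@le_trans _ _ (mean P (fun w => (1 + h) * g w ^+ 2 + (1 + h^-1) * (f N w - g w) ^+ 2))).
    apply: le_mean => //.
    + by apply: measurable_funD; exact: measurable_funM.
    + move=> w; rewrite -subr_ge0.
      rewrite (_ : _ - _ = h^-1 * (h * g w - (f N w - g w)) ^+ 2); last by field; rewrite gt_eqF.
      by rewrite mulr_ge0 ?sqr_ge0// invr_ge0 ltW.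
  rewrite (meanD P (measurable_funM (measurable_cst _) mg2) (measurable_funM (measurable_cst _) mfg2)
    (fun w => mulr_ge0 h1 (g20 w)) (fun w => mulr_ge0 h1' (sqr_ge0 _))).
  rewrite (meanZ P h1 mg2 g20) (meanZ P h1' mfg2 (fun w => sqr_ge0 _)).
  apply: (@le_trans _ _ ((1 + h)%:E * mean P (fun w => g w ^+ 2)%R + (x / 2)%:E)%E).
    rewrite leeD2l//; apply: le_trans (lee_wpmul2l _ hN) _; first by rewrite lee_fin.
    by rewrite -EFinM lee_fin mulrC divfK// gt_eqF// ltr_pwDl// invr_ge0 ltW.
  move: hK; have := mean_ge0 P g20; case: (mean P _) => [r| |] //.
  rewrite !lee_fin => r0 rK.
  have : h * r <= x / 2.
    apply: (@le_trans _ _ (h * (K + 1))); first by rewrite ler_wpM2l ?(ltW h0)//; lra.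
    by rewrite le_eqVlt; apply/orP; left; apply/eqP; rewrite /h; field; rewrite gt_eqF// ltr_wpDl.
  lra.
Qed.

End fixed_time.

Let expectation_square_center (g : T -> R) (t : R) : 0 <= t -> measurable_fun setT g ->
  (forall w, 0 <= g w) -> mean P g = t%:E ->
  (mean P (fun w => (g w - t) ^+ 2)%R + (t ^+ 2)%:E = mean P (fun w => g w ^+ 2)%R)%E.
Proof.
move=> t0 mg g0 gt.
have m2 : measurable_fun setT (fun w => (g w - t) ^+ 2).
  by apply: measurable_funX; exact: measurable_funB.
have mt : measurable_fun setT (fun w => 2 * t * g w) by exact: measurable_funM.
have mg2 : measurable_fun setT (fun w => g w ^+ 2) by exact: measurable_funX.
have t2 : 0 <= 2 * t by exact: mulr_ge0.
have h1 := meanD P m2 mt (fun w => sqr_ge0 _) (fun w => mulr_ge0 t2 (g0 w)).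
have h2 := meanD P mg2 (measurable_cst (t ^+ 2)) (fun w => sqr_ge0 _) (fun=> sqr_ge0 t).
rewrite mean_cst in h2; rewrite (meanZ P t2 mg g0) gt in h1.
move: h1; rewrite (eq_mean P (g := fun w => g w ^+ 2 + t ^+ 2)); last by move=> w; ring.
rewrite h2; move: (mean P _) (mean P _) => x y.
case: x => [x| |]; case: y => [y| |] //= [h]; congr EFin.
by move: h; rewrite !expr2; lra.
Qed.

Lemma cascade_limit_process : exists A : R -> T -> R,
  [/\ forall t, 0 <= t <= 1 -> measurable_fun setT (A t) /\ forall w, 0 <= A t w,
      forall q t, 0 < q < k%:R -> 0 <= t <= 1 ->
        mean_small P (fun n w => `|tint (a 0 n.+1) `[0, t] w - A t w| `^ q),
      forall q, 0 < q < k%:R -> exists C1 C2 : R, 0 < C1 <= C2 /\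
        forall t, 0 <= t <= 1 ->
          ((C1 * t `^ (q - ln (m q) / ln b))%:E <= mean P (fun w => A t w `^ q)%R <=
           (C2 * t `^ (q - ln (m q) / ln b))%:E)%E &
      forall t, 0 <= t <= 1 ->
        (\int[lebesgue_measure]_(u in `[0%R, t]) \int[lebesgue_measure]_(v in `[0%R, t])
           (mean P (fun w => L 0 u w * L 0 v w)%R - 1) <= 'V_P[A t])%E].
Proof.
have fixed t : exists g : T -> R, 0 <= t <= 1 -> [/\ measurable_fun setT g, (forall w, 0 <= g w),
    (forall q, 0 < q < k%:R -> mean_small P (fun n w => `|tint (a 0 n.+1) `[0, t] w - g w| `^ q)),
    mean P g = t%:E &
    (\int[lebesgue_measure]_(u in `[0%R, t]) \int[lebesgue_measure]_(v in `[0%R, t])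
       mean P (fun w => L 0 u w * L 0 v w)%R <= mean P (fun w => g w ^+ 2)%R < +oo)%E].
  have [t01|nt] := boolP (0 <= t <= 1); last by exists (fun=> 0).
  by have [g hg] := cascade_limit_fixed t01; exists g.
have {fixed}[A hA] := choice fixed; exists A; split.
- by move=> t /hA[].
- by move=> q t qk /hA[_ _ small _ _]; exact: small.
- move=> q qk; have [q0 _] := andP qk.
  have [D1 [D2 [D10 D20 hD]]] := tint_scaling qk.
  (* At [t = 0] the moment is [0], whereas [0] to the power [0] is [1]; the exponent must be shown
     to be nonzero. *)
  have s0 : q - ln (m q) / ln b != 0.
    rewrite gt_eqF// subr_gt0 ltr_pdivrMr ?ln_gt0//.
    have [q1|q1] := leP q 1.
      apply: (@le_lt_trans _ _ 0); last by rewrite mulr_gt0 ?ln_gt0.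
      by rewrite ln_le0// m_le1// q0.
    rewrite -ln_powR ltr_ln ?posrE ?powR_gt0//.
    apply: (lt_trans (m_lt _)); first by case/andP: qk => _ /ltW ->; rewrite q1.
    by rewrite /powR gt_eqF// ltr_expR ltr_pM2r ?ln_gt0//; lra.
  set s := q - _ in s0 hD *.
  (* The factor [2 ^ q] comes from the quasi-triangle inequality and the factor [2] absorbs the
     distance between [A t] and its approximation. The maximum below only secures [C1 <= C2]. *)
  pose F : R := 2 * 2 `^ q; have F0 : 0 < F by rewrite mulr_gt0// powR_gt0.
  have F1 : 1 <= F.
    rewrite /F; have : 2 `^ 0 <= 2 `^ q :> R by rewrite ler_powR ?ler1n// ltW.
    by rewrite powRr0; lra.
  exists (D1 / F), (Num.max D1 (D2 * F)); split.
    rewrite divr_gt0//= le_max; apply/orP; left.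
    by rewrite ler_pdivrMr// ler_peMr// ltW.
  move=> t t01; have [mA A0 small _ _] := hA t t01; have {}small := small q qk.
  have m0 (f : T -> R) : (0 <= mean P (fun w => f w `^ q)%R)%E.
    by apply: mean_ge0 => w; exact: powR_ge0.
  have nE (f : T -> R) : (forall w, 0 <= f w) ->
      mean P (fun w => `|f w| `^ q) = mean P (fun w => f w `^ q).
    by move=> f0; apply: eq_mean => w; rewrite ger0_norm.
  have h1 n := mean_leD2 P q0 mA (mT 0 n.+1 t) A0.
  have h2 n := mean_leD2 P q0 (mT 0 n.+1 t) mA (T0 0 n.+1 t).
  have {}h1 n : (mean P (fun w => A t w `^ q)%R <= (2 `^ q)%:E *
      (mean P (fun w => tint (a 0 n.+1) `[0%R, t] w `^ q)%R +
       mean P (fun w => `|tint (a 0 n.+1) `[0%R, t] w - A t w| `^ q)%R))%E.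
    have := h1 n; rewrite (nE _ (T0 0 n.+1 t)).
    by under [X in (_ <= _ * (_ + X))%E -> _]eq_mean do rewrite distrC.
  move: (t01) => /andP[]; rewrite le_eqVlt => /predU1P[tE _|t0 t1].
    have -> : mean P (fun w => A t w `^ q) = 0%E.
      apply/eqP; rewrite eq_le m0 andbT; apply/lee_addgt0Pr => x x0; rewrite add0e.
      have y0 : 0 < x / 2 `^ q by rewrite divr_gt0// powR_gt0.
      have [N /(_ N (leqnn N)) hN] := small _ y0.
      apply: (le_trans (h1 N)).
      rewrite (eq_mean P (g := fun=> 0)); last first.
        by move=> w; rewrite -tE /tint set_itv1 Rintegral_set1 powR0 ?gt_eqF.
      rewrite mean_cst add0e; apply: (le_trans (lee_wpmul2l _ hN)).
        by rewrite lee_fin powR_ge0.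
      by rewrite -EFinM lee_fin mulrC divfK// gt_eqF// powR_gt0.
    by rewrite -tE powR0// !mulr0 lexx.
  have ts : 0 < t `^ s by rewrite powR_gt0.
  have [|N1 hN1] := hD t; first by rewrite t0.
  apply/andP; split.
    have y0 : 0 < D1 * t `^ s / F by rewrite divr_gt0// mulr_gt0.
    have [N2 hN2] := small _ y0; pose N := maxn N1 N2.
    have /andP[+ _] := hN1 N.+1 (leqW (leq_maxl _ _)).
    move/le_trans => /(_ _ (h2 N)); rewrite (nE _ A0).
    move/le_trans/(_ (lee_wpmul2l _ (leeD2l _ (hN2 N (leq_maxr _ _))))).
    rewrite lee_fin powR_ge0 => /(_ isT).
    have := m0 (A t); case: (mean P _) => [r|_ _|//]; last by rewrite leey.
    rewrite !lee_fin => r0.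
    rewrite (_ : 2 `^ q * _ = 2 `^ q * r + D1 * t `^ s / 2); last first.
      by rewrite /F; field; rewrite gt_eqF// powR_gt0.
    move=> h; rewrite mulrAC ler_pdivrMr// /F; lra.
  have y0 : 0 < D2 * t `^ s by rewrite mulr_gt0.
  have [N2 hN2] := small _ y0; pose N := maxn N1 N2.
  have /andP[_ hN] := hN1 N.+1 (leqW (leq_maxl _ _)).
  apply: (le_trans (h1 N)).
  apply: (le_trans (lee_wpmul2l _ (leeD hN (hN2 N (leq_maxr _ _))))).
    by rewrite lee_fin powR_ge0.
  rewrite -EFinD -?EFinM lee_fin.
  apply: (@le_trans _ _ (D2 * F * t `^ s)).
    by rewrite /F le_eqVlt; apply/orP; left; apply/eqP; ring.
  by rewrite ler_pM2r// le_max lexx orbT.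
- move=> t t01; have [mA A0 small At /andP[corr fin2]] := hA t t01.
  have t0 : 0 <= t by case/andP: t01.
  have -> : 'V_P[A t]%E = mean P (fun w => (A t w - t) ^+ 2).
    rewrite /variance unlock expectationE; apply: eq_mean => w /=.
    by rewrite expectationE At.
  have V0 : (0 <= mean P (fun w => (A t w - t) ^+ 2)%R)%E by apply: mean_ge0 => w; exact: sqr_ge0.
  have VE := expectation_square_center t0 mA A0 At.
  rewrite -VE in corr.
  (* Since the integrand is at least [c], subtracting the constant is additivity of integrals of
     nonnegative functions, valid even for infinite values. *)
  have itv_sub (c : R) (h : R -> \bar R) : 0 <= c -> measurable_fun `[0, t] h ->
      (forall v, 0 <= v <= t -> (c%:E <= h v)%E) ->
      (\int[lebesgue_measure]_(v in `[0%R, t]) (h v - c%:E) + (c * t)%:E =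
       \int[lebesgue_measure]_(v in `[0%R, t]) h v)%E.
    move=> c0 mh ch.
    rewrite -[in (c * t)%:E](subr0 t) -integral_cst_itv//.
    rewrite -ge0_integralD//.
    + by apply: eq_integral => v _; rewrite subeK.
    + by move=> v; rewrite /= in_itv/= => /ch cv; have : (0 <= h v - c%:E)%E by rewrite suber_ge0.
    + exact: emeasurable_funB.
  pose c u v := mean P (fun w => L 0 u w * L 0 v w).
  have Lge0 s w : 0 <= L 0 s w by exact: ltW.
  have LL0 u v w : 0 <= L 0 u w * L 0 v w by exact: mulr_ge0.
  have mc u : measurable_fun `[0, t] (c u).
    apply: measurable_funTS; apply: (@measurable_mean _ _ _ P (fun v w => L 0 u w * L 0 v w)) => //.
    by apply: jmeas_mul => //; exact: jmeas_section.
  have cE u : 0 <= u <= t -> (\int[lebesgue_measure]_(v in `[0%R, t]) (c u v - 1) + t%:E =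
      \int[lebesgue_measure]_(v in `[0%R, t]) c u v)%E.
    move=> /andP[u0 _]; have := itv_sub 1 (c u) ler01 (mc u); rewrite mul1r; apply => v /andP[v0 _].
    exact: L_corr.
  have tint_c u : (\int[lebesgue_measure]_(v in `[0%R, t]) c u v)%E =
      mean P (fun w => tint (L 0) `[0, t] w * L 0 u w).
    have Lfin : (\int[lebesgue_measure]_(v in `[0%R, t]) mean P (L 0 v) < +oo)%E.
      rewrite (eq_integral (cst 1%:E)); first by rewrite integral_cst_itv// ltry.
      by move=> v; rewrite inE/= in_itv/= => /andP[v0 _]; exact: L_mean1.
    have := mean_tintM (measurable_itv `[0, t]) (L_jmeas 0) Lge0 Lfin
      (jmeas_section u (L_jmeas 0)) (Lge0 u).
    by move=> <-; apply: eq_mean => w; rewrite mulrC.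
  have mC : measurable_fun `[0, t] (fun u => \int[lebesgue_measure]_(v in `[0%R, t]) c u v)%E.
    apply: measurable_funTS; under eq_fun do rewrite tint_c.
    apply: (@measurable_mean _ _ _ P (fun u w => tint (L 0) `[0, t] w * L 0 u w)).
      apply: jmeas_mul => //; exact: measurable_tint.
    by move=> u w; rewrite mulr_ge0 ?tint_ge0.
  have CE u : 0 <= u <= t -> (\int[lebesgue_measure]_(v in `[0%R, t]) (c u v - 1) =
      \int[lebesgue_measure]_(v in `[0%R, t]) c u v - t%:E)%E.
    by move=> ut; rewrite -cE// addeK.
  move: corr; rewrite -(itv_sub t)//; last first.
    move=> u ut; rewrite -cE// leeDr//; apply: integral_ge0 => v; rewrite /= in_itv/= => /andP[v0 _].
    by have : (0 <= c u v - 1%:E)%E by [rewrite suber_ge0// L_corr//; case/andP: ut].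
  rewrite expr2 leeD2rE//; apply: le_trans.
  rewrite le_eqVlt; apply/orP; left; apply/eqP; apply: eq_integral => u.
  by rewrite inE/= in_itv/= => ut; rewrite -CE.
Qed.

End cascade_limit.

End cascade.

(** * Normal tempered stable Ornstein-Uhlenbeck processes *)

Section log_moment.
Context {R : realType} (kappa delta gamma beta : R) (k : nat).
Hypothesis kappa01 : 0 < kappa < 1.
Hypothesis delta0 : 0 < delta.
Hypothesis gamma0 : 0 < gamma.
Hypothesis beta0 : 0 < beta.
Hypothesis k2 : (2 <= k)%N.
Hypothesis k_le : k%:R <= Num.sqrt (beta ^+ 2 + gamma `^ kappa^-1) - beta.

Local Notation pw := (nts_power kappa gamma beta).

(** The cumulant transform of [X 0] at [q] minus [q * c_X], where [mu] cancels. *)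
Definition log_moment q : R :=
  delta * gamma - delta * pw q - q * (delta * gamma - delta * pw 1).

Local Notation lm := log_moment.

Definition nts_radicand q : R := beta ^+ 2 + gamma `^ kappa^-1 - (beta + q) ^+ 2.

Let k1 : 1 < k%:R :> R. Proof. by rewrite ltr1n. Qed.

(** The range reaches down to [-1] to leave room for chords that control [lm] to the left of [0];
    the right end is the condition on [k]. *)
Lemma nts_radicand_ge0 q : -1 <= q <= k%:R -> 0 <= nts_radicand q.
Proof.
move=> /andP[q1 qk]; rewrite subr_ge0.
have s0 : 0 <= beta ^+ 2 + gamma `^ kappa^-1 by rewrite addr_ge0 ?sqr_ge0 ?powR_ge0.
rewrite -[leRHS](sqr_sqrtr s0); rewrite -subr_ge0 subr_sqr.
suff aux (A K : R) : K <= A - beta -> 1 < K -> q <= K -> 0 <= (A - (beta + q)) * (A + (beta + q)).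
  exact: (aux _ _ k_le k1 qk).
move=> h1 h2 h3; have h4 : 0 <= A - (beta + q) by lra.
have h5 : 0 <= A + (beta + q) by move: q1 beta0; rewrite lerNl; lra.
exact: mulr_ge0.
Qed.

(** The radicand is a concave parabola, and the power [kappa] is increasing and concave. *)
Let concave x y t : -1 <= x <= k%:R -> -1 <= y <= k%:R -> 0 <= t <= 1 ->
  t * pw x + (1 - t) * pw y <= pw (t * x + (1 - t) * y).
Proof.
move=> xD yD /andP[t0 t1]; have t1' : 0 <= 1 - t by rewrite subr_ge0.
have Bx := nts_radicand_ge0 xD; have By := nts_radicand_ge0 yD.
rewrite /nts_power -!/(nts_radicand _).
set X := nts_radicand x in Bx *; set Y := nts_radicand y in By *.
pose Z := t * X + (1 - t) * Y.
have Z0 : 0 <= Z by rewrite addr_ge0 ?mulr_ge0.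
have ZB : Z <= nts_radicand (t * x + (1 - t) * y).
  rewrite /Z /X /Y /nts_radicand -subr_ge0.
  rewrite (_ : _ - _ = t * (1 - t) * (x - y) ^+ 2); last by ring.
  by rewrite mulr_ge0 ?sqr_ge0// mulr_ge0.
have [kp0 kp1] := andP kappa01.
apply: (@le_trans _ _ (Z `^ kappa)); last first.
  by apply: ge0_ler_powR; rewrite ?nnegrE ?(ltW kp0)//; exact: le_trans ZB.
(* There is no tangent to the power [kappa] at [0]; but [Z = 0] forces both of its nonnegative
   summands to vanish. *)
move: Z0; rewrite le_eqVlt => /predU1P[Z0|Z0].
  have tX0 : 0 <= t * X by rewrite mulr_ge0.
  have tY0 : 0 <= (1 - t) * Y by rewrite mulr_ge0.
  have : t * X = 0 by move: Z0; rewrite /Z; lra.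
  have : (1 - t) * Y = 0 by move: Z0; rewrite /Z; lra.
  have hp (u v : R) : u * v = 0 -> u * v `^ kappa = 0.
    by move=> /eqP; rewrite mulf_eq0 => /orP[/eqP->|/eqP->]; rewrite ?mul0r// powR0 ?mulr0// gt_eqF.
  by move=> /hp -> /hp ->; rewrite addr0 powR_ge0.
have kp01 : 0 < kappa <= 1 by rewrite kp0 ltW.
have h1 := powR_tangent_le kp01 Bx Z0; have h2 := powR_tangent_le kp01 By Z0.
have := ler_wpM2l t0 h1; have := ler_wpM2l t1' h2.
set p := kappa * Z `^ (kappa - 1); set z := Z `^ kappa => h3 h4.
have : t * (z + p * (X - Z)) + (1 - t) * (z + p * (Y - Z)) = z by rewrite /Z; ring.
lra.
Qed.

Lemma log_moment_convex x y t : -1 <= x <= k%:R -> -1 <= y <= k%:R -> 0 <= t <= 1 ->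
  lm (t * x + (1 - t) * y) <= t * lm x + (1 - t) * lm y.
Proof.
move=> xD yD t01; have := concave xD yD t01.
rewrite -(ler_pM2l delta0) /log_moment; set z := pw (_ + _); lra.
Qed.

Lemma nts_power0 : pw 0 = gamma.
Proof.
have [kp0 _] := andP kappa01.
by rewrite /nts_power addr0 addrAC subrr add0r -powRrM mulVf ?gt_eqF// powRr1 ?ltW.
Qed.

Lemma log_moment0 : lm 0 = 0. Proof. by rewrite /log_moment nts_power0; ring. Qed.

Lemma log_moment1 : lm 1 = 0. Proof. by rewrite /log_moment; ring. Qed.

(** Convexity cleared of denominators, so that degenerate chords are allowed. *)
Lemma log_moment_chord x y z : -1 <= x -> x <= y -> y <= z -> z <= k%:R ->
  (z - x) * lm y <= (z - y) * lm x + (y - x) * lm z.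
Proof.
move=> x1 xy yz zk; have [xz|/eqP xz] := eqVneq x z.
  by have -> : y = x by [lra]; rewrite -xz; lra.
have zx : 0 < z - x by rewrite subr_gt0 lt_neqAle (le_trans xy)// andbT; apply/eqP.
have t01 : 0 <= (z - y) / (z - x) <= 1.
  apply/andP; split; first by rewrite divr_ge0 ?subr_ge0 ?(ltW zx)//; lra.
  by rewrite ler_pdivrMr// mul1r; lra.
have xD : -1 <= x <= k%:R by lra.
have zD : -1 <= z <= k%:R by lra.
have := log_moment_convex xD zD t01.
rewrite (_ : _ * x + _ = y); last by field; rewrite gt_eqF.
move/(ler_wpM2l (ltW zx)) => h; apply: (le_trans h).
by rewrite le_eqVlt; apply/orP; left; apply/eqP; field; rewrite gt_eqF.
Qed.

Lemma log_moment_le0 q : 0 <= q <= 1 -> lm q <= 0.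
Proof.
move=> /andP[q0 q1]; have := @log_moment_chord 0 q 1; rewrite log_moment0 log_moment1.
move=> /(_ _ q0 q1 (ltW k1)); rewrite lerN10 => /(_ isT); lra.
Qed.

Lemma log_moment_ge0_right q : 1 <= q <= k%:R -> 0 <= lm q.
Proof.
move=> /andP[q1 qk]; have := @log_moment_chord 0 1 q; rewrite log_moment0 log_moment1.
by move=> /(_ _ ler01 q1 qk); rewrite lerN10 => /(_ isT); lra.
Qed.

Lemma log_moment_ge0_left : 0 <= lm (-1).
Proof.
have := @log_moment_chord (-1) 0 1; rewrite log_moment0 log_moment1.
by move=> /(_ _ _ ler01 (ltW k1)); rewrite lexx lerN10 => /(_ isT isT); lra.
Qed.

Lemma log_moment_le_chord q : 1 <= q <= k%:R -> lm q <= (q - 1) * (lm k%:R / (k%:R - 1)).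
Proof.
move=> /andP[q1 qk]; have k10 : 0 < k%:R - 1 :> R by rewrite subr_gt0.
have := @log_moment_chord 1 q k%:R; rewrite log_moment1 => /(_ _ q1 qk (lexx _)) h.
rewrite mulrA ler_pdivlMr// mulrC; apply: le_trans (h _) _; last by lra.
by lra.
Qed.

(** The chord over [[1, k]] bounds [lm (1 + x)] from above; convexity on [[-1, x]] at the point [0],
    where [lm] vanishes, bounds [lm x] from below. *)
Lemma log_moment_far x : 0 <= x <= k%:R - 1 ->
  lm (1 + x) - lm x <= x * (lm k%:R / (k%:R - 1) + lm (-1)).
Proof.
move=> /andP[x0 xk].
have := @log_moment_le_chord (1 + x); rewrite addrC addrK => h1.
have := @log_moment_chord (-1) 0 x; rewrite log_moment0 => h2.
have {}h1 : lm (x + 1) <= x * (lm k%:R / (k%:R - 1)) by apply: h1; lra.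
have {}h2 : 0 <= (x - 0) * lm (-1) + (0 - -1) * lm x by have := h2 _ _ x0 _; lra.
by lra.
Qed.

(** Here [y] stands for the memory lost, [1 - exp (- lambda (s' - s))]. The slope to the left of [q]
    is at most that of the chord from [q] to [k], which needs [q < k]. *)
Lemma log_moment_low q : 1 <= q < k%:R -> exists2 c, 0 <= c & forall y, 0 <= y <= 1 ->
  lm q - c * y <= lm (q - y) - lm (1 - y).
Proof.
move=> /andP[q1 qk]; have kq : 0 < k%:R - q by rewrite subr_gt0.
exists (`|lm k%:R - lm q| / (k%:R - q)); first by rewrite divr_ge0// ltW.
move=> y /andP[y0 y1].
have h1 : lm (1 - y) <= 0 by apply: log_moment_le0; lra.
have h2 : (k%:R - q) * (lm q - lm (q - y)) <= y * (lm k%:R - lm q).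
  by have := @log_moment_chord (q - y) q k%:R; lra.
have h3 : lm q - lm (q - y) <= `|lm k%:R - lm q| / (k%:R - q) * y.
  rewrite mulrAC ler_pdivlMr// mulrC; apply: (le_trans h2).
  by rewrite mulrC ler_wpM2r// ler_norm.
lra.
Qed.

(** Now the chord from [-1] bounds how much [lm] can rise to the left of [q]; since [q > 0] and
    [y <= 1], the point [q - y] stays to the right of [-1]. *)
Lemma log_moment_up q : 0 < q <= 1 -> exists2 c, 0 <= c & forall y, 0 <= y <= 1 ->
  lm (q - y) - lm (1 - y) <= lm q + c * y.
Proof.
move=> /andP[q0 q1]; have q10 : 0 < q + 1 by rewrite addr_gt0.
have k2R : 2 <= k%:R :> R by rewrite ler_nat.
have l2 : 0 <= lm 2 by apply: log_moment_ge0_right; rewrite ler1n.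
exists (`|lm (-1) - lm q| / (q + 1) + lm 2); first by rewrite addr_ge0// divr_ge0// ltW.
move=> y /andP[y0 y1].
have h1 : - lm (1 - y) <= y * lm 2.
  by have := @log_moment_chord (1 - y) 1 2; rewrite log_moment1; lra.
have h2 : (q + 1) * (lm (q - y) - lm q) <= y * (lm (-1) - lm q).
  by have := @log_moment_chord (-1) (q - y) q; lra.
have h3 : lm (q - y) - lm q <= `|lm (-1) - lm q| / (q + 1) * y.
  rewrite mulrAC ler_pdivlMr// mulrC; apply: (le_trans h2).
  by rewrite mulrC ler_wpM2r// ler_norm.
lra.
Qed.

(** The expression is the logarithm of the mean of [sqrt (L(s) L(s'))]; its closeness to [0] gives
    continuity in [L_1]. *)
Lemma log_moment_sqrt : exists2 c, 0 <= c & forall y, 0 <= y <= 1 ->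
  - (c * y) <= lm (1 - y / 2) + lm 2^-1 - lm (2^-1 - y / 2).
Proof.
have k2R : 2 <= k%:R :> R by rewrite ler_nat.
have l2 : 0 <= lm 2 by apply: log_moment_ge0_right; rewrite ler1n.
have lN := log_moment_ge0_left.
have lh : lm 2^-1 <= 0 by apply: log_moment_le0; lra.
exists (lm 2 / 2 + (lm (-1) - lm 2^-1) / 3); first by lra.
move=> y /andP[y0 y1].
have h1 : - lm (1 - y / 2) <= y / 2 * lm 2.
  by have := @log_moment_chord (1 - y / 2) 1 2; rewrite log_moment1; lra.
have h2 : 3 / 2 * (lm (2^-1 - y / 2) - lm 2^-1) <= y / 2 * (lm (-1) - lm 2^-1).
  by have := @log_moment_chord (-1) (2^-1 - y / 2) 2^-1; lra.
lra.
Qed.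

Lemma log_moment_corr x : 0 <= x <= 1 -> lm x <= lm (1 + x).
Proof.
have k2R : 2 <= k%:R :> R by rewrite ler_nat.
move=> x01; apply: (@le_trans _ _ 0); first exact: log_moment_le0.
by apply: log_moment_ge0_right; lra.
Qed.

Section base.
Variable b : R.
Hypothesis hb : expR (- (delta * gamma) + (delta * pw k%:R - k%:R * delta * pw 1) / (1 - k%:R)) < b.

Let k10 : 0 < k%:R - 1 :> R. Proof. by rewrite subr_gt0. Qed.

(** The condition on [b] says that [ln b] exceeds the slope of [lm] along the chord over
    [[1, k]]. *)
Let slopeE : - (delta * gamma) + (delta * pw k%:R - k%:R * delta * pw 1) / (1 - k%:R) =
  lm k%:R / (k%:R - 1).
Proof.
rewrite /log_moment -[1 - _]opprB; move: k10; move: (k%:R) => x x0; field.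
by rewrite !gt_eqF// oppr_lt0 andbT; exact: ltr0_neq0.
Qed.

Lemma base_gt1 : 1 < b.
Proof.
apply: le_lt_trans hb; rewrite slopeE; apply: (@le_trans _ _ (expR 0)); first by rewrite expR0.
rewrite ler_expR divr_ge0 ?(ltW k10)//.
by apply: log_moment_ge0_right; rewrite lexx (ltW k1).
Qed.

Lemma log_moment_lt_base q : 1 < q <= k%:R -> expR (lm q) < b `^ (q - 1).
Proof.
move=> /andP[q1 qk]; have b0 : 0 < b by exact: lt_trans base_gt1.
rewrite /powR gt_eqF// ltr_expR; apply: (@le_lt_trans _ _ ((q - 1) * (lm k%:R / (k%:R - 1)))).
  by apply: log_moment_le_chord; rewrite (ltW q1).
rewrite ltr_pM2l ?subr_gt0// -slopeE -[X in X < _]expRK ltr_ln ?posrE//; exact: expR_gt0.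
Qed.

Lemma scaling_functionE q : scaling_function kappa gamma beta delta b q =
  q - ln (expR (lm q)) / ln b.
Proof.
have lb : ln b != 0 by rewrite gt_eqF// ln_gt0// base_gt1.
by rewrite expRK /scaling_function /log_moment; field.
Qed.

End base.

End log_moment.

(** * Versions of the stochastic integral measurable for the driving process *)

Section stochastic_integral.
Context {d : measure_display} {T : measurableType d} {R : realType}
  (P : probability T R) (G : set (set T)).
Hypothesis sG : <<s G >> `<=` measurable.

Local Notation mG := (measurable_fun (setT : set (g_sigma_algebraType G))).

Let mean_min_deviation (f : T -> R) (e : R) : measurable_fun setT f -> 0 <= e ->
  (P [set w | e < `|f w|]%R <= e%:E)%E ->
  (mean P (fun w => Num.min 1 `|f w|)%R <= (e + e)%:E)%E.
Proof.
move=> mf e0 he.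
have mA : measurable [set w | e < `|f w|]%R.
  have mn : measurable_fun setT (fun w => `|f w|) by exact: measurableT_comp.
  have -> : [set w | e < `|f w|]%R = setT `&` (fun w => `|f w|) @^-1` `]e, +oo[.
    by rewrite setTI; apply/seteqP; split => w /=; rewrite in_itv/= andbT.
  exact: mn.
have mI : measurable_fun setT (\1_([set w | e < `|f w|]%R) : T -> R) by exact: measurable_indic.
apply: (@le_trans _ _ (mean P (fun w => e + \1_([set w | e < `|f w|]%R) w))).
  apply: le_mean.
  - by apply: measurable_minr; [exact: measurable_cst|exact: measurableT_comp].
  - by apply: measurable_funD => //; exact: measurable_cst.
  - by move=> w; rewrite le_min ler01 normr_ge0.
  move=> w; rewrite indicE; case: (boolP (w \in _)) => [_|]; first by rewrite ge_min lerDr e0.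
  by rewrite notin_setE/= => /negP; rewrite -leNgt => h; rewrite addr0 ge_min h orbT.
rewrite (meanD P (measurable_cst _) mI (fun=> e0) (fun w => ler0n _ _)) mean_cst EFinD leeD2l//.
by rewrite /mean integral_indic// setIT.
Qed.

Lemma ae_limit_measurable (S : nat -> T -> R) (I : T -> R) : (forall n, mG (S n)) ->
  measurable_fun setT I ->
  (forall n, (P [set w | 2^-1 ^+ n < `|S n w - I w|]%R <= (2^-1 ^+ n)%R%:E)%E) ->
  exists2 J : T -> R, mG J & {ae P, forall w, I w = J w}.
Proof.
move=> mS mI hS.
have mS' n : measurable_fun setT (S n) by exact: measurable_gen_meas (mS n).
(* The truncated deviation has mean at most twice the tolerance; the shift by one index makes this
   [2^-1 ^+ n]. *)
pose y n w := Num.min 1 `|S n.+1 w - I w|.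
have my n : measurable_fun setT (y n).
  apply: measurable_minr; first exact: measurable_cst.
  by apply: measurableT_comp => //; exact: measurable_funB.
have y0 n w : 0 <= y n w by rewrite le_min ler01 normr_ge0.
have hy n : (mean P (y n) <= (2^-1 ^+ n)%R%:E)%E.
  apply: (le_trans (mean_min_deviation _ _ (hS n.+1))).
  - exact: measurable_funB.
  - exact: exprn_ge0.
  - by rewrite lee_fin exprS le_eqVlt; apply/orP; left; apply/eqP; field.
exists (fun w => fine (limn_esup (fun n => (S n.+1 w)%:E))).
  apply: measurableT_comp => //.
  by apply: measurable_fun_limn_esup => n; apply/measurable_EFinP; exact: mS.
have := ae_cvg0 my y0 hy; apply: filterS => w hw.
have SI : S n.+1 w @[n --> \oo] --> I w.
  apply/cvgrPdist_lt => e e0.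
  have me : 0 < Num.min 1 e by rewrite lt_min ltr01.
  have /cvgrPdist_lt/(_ _ me)[N _ hN] := hw; exists N => // n /= Nn.
  have := hN n Nn; rewrite sub0r normrN ger0_norm// /y lt_min !gt_min ltxx /=.
  by rewrite distrC => /andP[h1 /orP[/(lt_trans h1)|]].
have /cvg_limn_einf_sup[_ ->]// : (S n.+1 w)%:E @[n --> \oo] --> (I w)%:E.
by apply: cvg_EFin => //; exact: nearW.
Qed.

(** A limit in probability is determined only up to a null set. Summable tolerances give almost sure
    convergence, and the upper limit of the Riemann sums is a version to which independence from
    [X 0] applies. *)
Lemma stochastic_integral_measurable (f : R -> R) (W : R -> T -> R) (t : R) (I : T -> R) :
  0 <= t -> (forall s, 0 <= s -> mG (W s)) -> is_stochastic_integral P f W t I ->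
  exists2 J : T -> R, mG J & {ae P, forall w, I w = J w}.
Proof.
move=> t0 mW [mI hI].
have ex n : exists N : nat, (P [set w | 2^-1 ^+ n < `|\sum_(i < N.+1) f (i%:R * (t / N.+1%:R)) *
    (W (i.+1%:R * (t / N.+1%:R)) w - W (i%:R * (t / N.+1%:R)) w) - I w|]%R <= (2^-1 ^+ n)%R%:E)%E.
  have [|h h0 hh] := hI (2^-1 ^+ n); first by rewrite exprn_gt0.
  pose N := Num.truncn (t / h); exists N.
  have tN : t / N.+1%:R < h by rewrite ltr_pdivrMr// mulrC -ltr_pdivrMr// truncnS_gt.
  have tN0 : 0 <= t / N.+1%:R by rewrite divr_ge0.
  apply: (hh N.+1 (fun i => i%:R * (t / N.+1%:R)) (fun i => i%:R * (t / N.+1%:R))).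
  - by rewrite mul0r.
  - by rewrite mulrCA divff ?mulr1// pnatr_eq0.
  - by move=> i _; rewrite lexx ler_wpM2r ?ler_nat//; split => //; rewrite -mulrBl -natrB// subSnn mul1r.
have [N hN] := choice ex.
apply: ae_limit_measurable mI hN => n; apply: measurable_sum => i; apply: measurable_funM.
  exact: measurable_cst.
have x0 j : 0 <= j%:R * (t / (N n).+1%:R) by rewrite mulr_ge0// divr_ge0.
by apply: measurable_funB; exact: mW.
Qed.

End stochastic_integral.

(** * Memory of the Ornstein-Uhlenbeck process *)

Section memory.
Context {d : measure_display} {T : measurableType d} {R : realType}
  (P : probability T R) (D : probability (measurableTypeR R) R) (lambda : R) (X : R -> T -> R).
Hypothesis lambda0 : 0 < lambda.
Hypothesis X_OU : stationary_OU_process P D lambda X.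

Local Notation expsum l := (fun w => expR (\sum_(p <- l) p.1 * X p.2 w)%R).

Let X_process : is_process X. Proof. by case: X_OU. Qed.

Lemma measurable_expsum (l : seq (R * R)) : (forall p, p \in l -> 0 <= p.2) ->
  measurable_fun setT (expsum l).
Proof.
move=> l0; apply: measurableT_comp => //; elim: l l0 => [|p l ih] l0.
  by under eq_fun do rewrite big_nil; exact: measurable_cst.
under eq_fun do rewrite big_cons; apply: measurable_funD.
  by apply: measurable_funM; [exact: measurable_cst|apply: X_process; exact/l0/mem_head].
by apply: ih => q ql; apply: l0; rewrite inE ql orbT.
Qed.

(* Given the past at time [0], the only memory of the process is through [X 0]: for
   nonnegative times, [\sum z_i X t_i] is [x X 0] plus a variable independent of [X 0]. *)
Lemma OU_memory0 (l : seq (R * R)) (z : R) : (forall p, p \in l -> 0 <= p.2) ->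
  let x := \sum_(p <- l) p.1 * expR (- lambda * p.2) in
  (mean P (fun w => expR (z * X 0 w + \sum_(p <- l) p.1 * X p.2 w))%R *
     mean P (fun w => expR (x * X 0 w))%R =
   mean P (fun w => expR ((z + x) * X 0 w))%R * mean P (expsum l))%E.
Proof.
move=> l0 x; have [_ _ _ [Z [[Z_process _ _ _] indep XI]]] := X_OU.
pose G := \bigcup_(t in `[0, +oo[) sigma_rv (Z t).
have sG : <<s G >> `<=` measurable.
  exact: (@sigma_process_measurable _ _ _ (fun=> Z) (fun=> Z_process) 0).
have [J mJ lJ] : exists2 J : T -> R, measurable_fun (setT : set (g_sigma_algebraType G)) J &
    {ae P, forall w, \sum_(p <- l) p.1 * X p.2 w = x * X 0 w + J w}.
  rewrite {}/x; elim: l l0 => [|p l ih] l0.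
    exists (fun=> 0); first exact: measurable_cst.
    by apply: aeW => w; rewrite !big_nil mul0r addr0.
  have [|J1 mJ1 lJ1] := ih; first by move=> q ql; apply: l0; rewrite inE ql orbT.
  have p0 : 0 <= p.2 by exact/l0/mem_head.
  have [I hI XE] := XI _ p0.
  have [|J2 mJ2 IJ2] := stochastic_integral_measurable sG p0 _ hI.
    move=> s s0; apply: (@measurable_coord _ _ _ (fun=> Z) 0 (lambda * s)).
    by rewrite mulr_ge0// ltW.
  exists (fun w => p.1 * J2 w + J1 w).
    by apply: measurable_funD => //; apply: measurable_funM => //; exact: measurable_cst.
  apply: filterS3 lJ1 XE IJ2 => w h1 h2 h3.
  by rewrite !big_cons h1 h2 h3; ring.
have mJT : measurable_fun setT J by exact: measurable_gen_meas mJ.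
have mX0 : measurable_fun setT (X 0) by exact: X_process.
have ind (u : R) : mean P (fun w => expR (u * X 0 w) * expR (J w)) =
    (mean P (fun w => expR (u * X 0 w))%R * mean P (fun w => expR (J w))%R)%E.
  apply: mean_indep; try by move=> w; exact: expR_ge0.
  - by apply: measurableT_comp => //; exact: measurable_funM.
  - exact: measurableT_comp.
  move=> A B [A' mA' <-] [B' mB' <-]; rewrite !setTI; apply: indep.
    exists ((fun y => expR (u * y)) @^-1` A') => //; rewrite ?setTI//.
    rewrite -[X in measurable X]setTI.
    have : measurable_fun setT (fun y : R => expR (u * y)).
      by apply: measurableT_comp => //; exact: measurable_funM.
    by apply.
  have : measurable_fun (setT : set (g_sigma_algebraType G)) (fun w => expR (J w)).
    by apply: measurableT_comp.
  by move/(_ measurableT _ mB'); rewrite setTI.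
have mE (u : R) : measurable_fun setT (fun w => expR (u * X 0 w) * expR (J w)).
  by apply: measurable_funM; apply: measurableT_comp => //; exact: measurable_funM.
have pos (u : R) w : 0 <= expR (u * X 0 w) * expR (J w) by rewrite mulr_ge0 ?expR_ge0.
have -> : mean P (fun w => expR (z * X 0 w + \sum_(p <- l) p.1 * X p.2 w)) =
    mean P (fun w => expR ((z + x) * X 0 w) * expR (J w)).
  apply: eq_mean_ae => //.
  - have := @measurable_expsum ((z, 0) :: l).
    under eq_fun do rewrite big_cons/=; apply => p; rewrite inE => /predU1P[->//|]; exact: l0.
  - by apply: filterS lJ => w ->; rewrite -expRD; congr expR; ring.
have -> : mean P (expsum l) = mean P (fun w => expR (x * X 0 w) * expR (J w)).
  apply: eq_mean_ae => //.
  - exact: measurable_expsum.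
  - by apply: filterS lJ => w ->; rewrite -expRD.
(* The mean of [expR J] is never computed: it occurs once on each side of the cross-multiplied
   identity. *)
by rewrite !ind muleAC -muleA.
Qed.

End memory.

Lemma same_fdd_mean {R : realType} d (T : measurableType d) (P : probability T R) (X : R -> T -> R)
    d' (T' : measurableType d') (P' : probability T' R) (X' : R -> T' -> R)
    (h : R -> R -> R) (l : seq (R * R)) :
  is_process X -> is_process X' -> same_fdd P X P' X' ->
  (forall z, measurable_fun setT (h z)) -> (forall z x, 0 <= h z x) ->
  (forall p, p \in l -> 0 <= p.2) ->
  mean P (fun w => \prod_(p <- l) h p.1 (X p.2 w)) = mean P' (fun w => \prod_(p <- l) h p.1 (X' p.2 w)).
Proof.
move=> hX hX' fdd mh h0 l0.
pose t := map_tuple snd (in_tuple l).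
have t0 i : 0 <= tnth t i by rewrite tnth_map; apply: l0; exact: mem_tnth.
pose g (x : (size l).-tuple R) := \prod_(i < size l) h (tnth (in_tuple l) i).1 (tnth x i).
have mg : measurable_fun setT g.
  apply: measurable_prod => i _.
  exact: (measurableT_comp (mh _) (measurable_tnth i)).
have g0 x : 0 <= g x by exact: prodr_ge0.
have gE d1 (T1 : measurableType d1) (Y : R -> T1 -> R) w :
    \prod_(p <- l) h p.1 (Y p.2 w) = g (sample Y t w).
  by rewrite big_tnth; apply: eq_bigr => i _; rewrite /sample !tnth_map.
have mS d1 (T1 : measurableType d1) (Y : R -> T1 -> R) : is_process Y ->
    measurable_fun setT (sample Y t).
  move=> mY; apply/measurable_fun_tnthP => i.
  rewrite (_ : _ \o _ = Y (tnth t i)); first exact: mY.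
  by apply/funext => w; rewrite /= /sample tnth_map.
have push d1 (T1 : measurableType d1) (P1 : probability T1 R) (Y : R -> T1 -> R) : is_process Y ->
    mean P1 (fun w => \prod_(p <- l) h p.1 (Y p.2 w)) =
    (\int[pushforward P1 (sample Y t)]_x (g x)%:E)%E.
  move=> mY; rewrite ge0_integral_pushforward//.
  - by rewrite preimage_setT; apply: eq_integral => w _; rewrite gE.
  - exact: mS.
  - exact/measurable_EFinP.
  - by move=> x _; rewrite lee_fin.
rewrite !push//.
pose S : {mfun T >-> (size l).-tuple R} := HB.pack (sample X t) (isMeasurableFun.Build _ _ _ _ _ (mS _ _ _ hX)).
pose S' : {mfun T' >-> (size l).-tuple R} := HB.pack (sample X' t) (isMeasurableFun.Build _ _ _ _ _ (mS _ _ _ hX')).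
have := @eq_measure_integral _ _ R setT (pushforward P' S') (pushforward P S) (fun x => (g x)%:E).
by apply => B mB _; exact: fdd.
Qed.

(** * Memory of the mother process *)

Section mother_memory.
Context {d : measure_display} {T : measurableType d} {R : realType}
  (P : probability T R) (D : probability (measurableTypeR R) R) (lambda c : R) (X : R -> T -> R).
Hypothesis lambda0 : 0 < lambda.
Hypothesis X_OU : stationary_OU_process P D lambda X.

Local Notation Lam := (mother X c).
Local Notation powprod l := (fun w => \prod_(p <- l) (Lam p.2 w `^ p.1))%R.

Let X_process : is_process X. Proof. by case: X_OU. Qed.

Let powprodE (l : seq (R * R)) w : \prod_(p <- l) (Lam p.2 w `^ p.1) =
  expR (- c * \sum_(p <- l) p.1) * \prod_(p <- l) expR (p.1 * X p.2 w).
Proof.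
elim: l => [|p l ih]; first by rewrite !big_nil mulr0 expR0 mulr1.
rewrite !big_cons ih /mother -expRM mulrDr expRD mulrACA -expRD; congr (expR _ * _); ring.
Qed.

Let prod_expE (l : seq (R * R)) w : \prod_(p <- l) expR (p.1 * X p.2 w) =
  expR (\sum_(p <- l) p.1 * X p.2 w).
Proof. by rewrite expR_sum. Qed.

Let mean_powprod (l : seq (R * R)) : (forall p, p \in l -> 0 <= p.2) ->
  mean P (powprod l) = ((expR (- c * \sum_(p <- l) p.1))%:E *
    mean P (fun w => expR (\sum_(p <- l) p.1 * X p.2 w))%R)%E.
Proof.
move=> l0; under eq_mean do rewrite powprodE prod_expE.
rewrite meanZ ?expR_ge0//.
exact: (measurable_expsum X_OU l0).
Qed.

Let mean_shift (l : seq (R * R)) (t : R) : 0 <= t -> (forall p, p \in l -> t <= p.2) ->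
  mean P (fun w => expR (\sum_(p <- l) p.1 * X p.2 w)) =
  mean P (fun w => expR (\sum_(p <- [seq (q.1, q.2 - t) | q <- l]) p.1 * X p.2 w)).
Proof.
move=> t0 lt; have [_ stat _ _] := X_OU.
pose h z x : R := expR (z * x).
have l'0 p : p \in [seq (q.1, q.2 - t) | q <- l] -> 0 <= p.2.
  by move=> /mapP[q ql ->]; rewrite subr_ge0 lt.
have mh z : measurable_fun setT (h z).
  by apply: measurableT_comp => //; exact: measurable_funM.
have h0 z x : 0 <= h z x by exact: expR_ge0.
have Xt : is_process (fun s => X (s + t)) by move=> s s0; apply: X_process; rewrite addr_ge0.
have := same_fdd_mean Xt X_process (stat t t0) mh h0 l'0.
rewrite /h; under [X in _ = X -> _]eq_mean do rewrite -expR_sum.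
move=> <-; apply: eq_mean => w; rewrite -expR_sum big_map; congr expR.
by apply: eq_bigr => p _; rewrite /= subrK.
Qed.

(** Stationarity moves the earliest time [t] to [0]. The centring constants match because both sides
    have the same total exponent. *)
Lemma mother_memory (l : seq (R * R)) (z t : R) : 0 <= t -> (forall p, p \in l -> t <= p.2) ->
  let x := \sum_(p <- l) p.1 * expR (- lambda * (p.2 - t)) in
  (mean P (powprod ((z, t) :: l)) * mean P (fun w => Lam 0 w `^ x)%R =
   mean P (fun w => Lam 0 w `^ (z + x))%R * mean P (powprod l))%E.
Proof.
move=> t0 lt x.
have l0 p : p \in l -> 0 <= p.2 by move=> /lt; exact: le_trans.
have zl0 p : p \in (z, t) :: l -> 0 <= p.2 by rewrite inE => /predU1P[->//|/l0].
have zlt p : p \in (z, t) :: l -> t <= p.2 by rewrite inE => /predU1P[->//|/lt].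
pose l' := [seq (q.1, q.2 - t) | q <- l].
have l'0 p : p \in l' -> 0 <= p.2 by move=> /mapP[q ql ->]; rewrite subr_ge0 lt.
have M0 (q : R) : mean P (fun w => Lam 0 w `^ q) =
    ((expR (- c * q))%:E * mean P (fun w => expR (q * X 0 w))%R)%E.
  have := @mean_powprod [:: (q, 0)]; rewrite big_seq1/=.
  under [mean P (powprod _)]eq_mean do rewrite big_seq1/=.
  under [X in _ -> _ = (_ * X)%E]eq_mean do [].
  move=> ->; last by move=> p; rewrite inE => /eqP->.
  by congr (_ * _)%E; apply: eq_mean => w; rewrite big_seq1.
rewrite !M0 (mean_powprod zl0) (mean_powprod l0) (mean_shift t0 zlt) (mean_shift t0 lt) -/l'.
have := OU_memory0 lambda0 X_OU z l'0.
have -> : \sum_(p <- l') p.1 * expR (- lambda * p.2) = x by rewrite big_map.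
under [X in (X * _)%E = _ -> _]eq_mean => w.
  rewrite (_ : z * X 0 w + _ = \sum_(p <- (z, 0) :: l') p.1 * X p.2 w); last by rewrite big_cons.
  over.
have -> : [seq (q.1, q.2 - t) | q <- (z, t) :: l] = (z, 0) :: l' by rewrite /= subrr.
rewrite big_cons/=; set A := mean P _; set B := mean P _; set C := mean P _; set E := mean P _.
move=> ABCE.
rewrite !muleA [(_ * A * _)%E]muleAC -EFinM -muleA ABCE.
rewrite [((expR (- c * (z + x)))%:E * C * _)%E]muleAC -EFinM -!muleA -!expRD.
by congr ((expR _)%:E * _)%E; ring.
Qed.

End mother_memory.

(** * Everywhere positive versions of the copies *)

Section positive_version.
Context {d : measure_display} {T : measurableType d} {R : realType}
  (P : probability T R) (Lam : nat -> R -> T -> R).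
Hypothesis Lam_process : forall j, is_process (Lam j).
Hypothesis Lam_jmeas : forall j, jointly_measurable (Lam j).
Hypothesis Lam_indep : mutually_independent P (fun j => sigma_process (Lam j)).
Hypothesis Lam_ae_gt0 : forall j s, 0 <= s -> P [set w | Lam j s w <= 0] = 0%E.

(** The value [1] at negative times yields joint measurability on the whole line. *)
Let time_ext j s w := if 0 <= s then Lam j s w else 1.

Let jmeas_time_ext j : jmeas (time_ext j).
Proof.
apply: measurable_fun_if => //.
- by apply: measurable_fun_ler => //; exact: measurable_fst.
- by rewrite setTI; exact: Lam_jmeas.
Qed.

(** A copy has only the finite-dimensional laws of the mother process, so it may fail to be positive
    on a null set that varies with the time. *)
Definition positive_version j s w := if 0 < time_ext j s w then time_ext j s w else 1.

Local Notation L := positive_version.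

Lemma positive_version_gt0 j s w : 0 < L j s w.
Proof. by rewrite /positive_version; case: ifP. Qed.

Let cut (x : R) := if 0 < x then x else 1.

Let measurable_cut : measurable_fun setT cut.
Proof.
apply: measurable_fun_ifT => //.
by apply: measurable_fun_ltr => //; exact: measurable_id.
Qed.

Lemma jmeas_positive_version j : jmeas (L j).
Proof. exact: (measurableT_comp measurable_cut (@jmeas_time_ext j)). Qed.

Lemma positive_version_indep : mutually_independent P (fun j => sigma_process (L j)).
Proof.
move=> J A hA; apply: Lam_indep => i iJ; have := hA i iJ.
apply: smallest_sub; first exact: smallest_sigma_algebra.
move=> _ [t t0 [B mB <-]]; apply: sub_sigma_algebra; exists t => //.
exists (cut @^-1` B); first by rewrite -[X in measurable X]setTI; exact: measurable_cut.
rewrite !setTI; apply/seteqP; split => w /=; rewrite /positive_version /time_ext;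
  by move: t0; rewrite /= in_itv/= andbT => ->.
Qed.

Lemma positive_version_ae j s : 0 <= s -> {ae P, forall w, Lam j s w = L j s w}.
Proof.
move=> s0; exists [set w | Lam j s w <= 0]; split.
- rewrite (_ : [set w | _] = setT `&` Lam j s @^-1` `]-oo, 0]).
    exact: Lam_process.
  by rewrite setTI; apply/seteqP; split => w /=; rewrite in_itv.
- exact: Lam_ae_gt0.
- move=> w /=; rewrite /positive_version /time_ext s0 => h.
  by rewrite leNgt; apply/negP => w0; apply: h; rewrite w0.
Qed.

Lemma mean_positive_version j (l : seq (R * R)) : (forall p, p \in l -> 0 <= p.2) ->
  mean P (fun w => \prod_(p <- l) Lam j p.2 w `^ p.1) =
  mean P (fun w => \prod_(p <- l) L j p.2 w `^ p.1).
Proof.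
move=> l0; apply: eq_mean_ae.
- by apply: measurable_prod_seq => p pl; apply: (measurableT_comp (measurable_powR _)); exact/Lam_process/l0.
- apply: measurable_prod_seq => p pl; apply: (measurableT_comp (measurable_powR _)).
  by apply: jmeas_section; exact: jmeas_positive_version.
- by move=> w; apply: prodr_ge0 => p _; exact: powR_ge0.
- by move=> w; apply: prodr_ge0 => p _; exact: powR_ge0.
elim: l l0 => [|p l ih] l0; first by apply: aeW => w; rewrite !big_nil.
have h1 := positive_version_ae j (l0 p (mem_head _ _)).
have h2 : forall q, q \in l -> 0 <= q.2 by move=> q ql; apply: l0; rewrite inE ql orbT.
by apply: filterS2 h1 (ih h2) => w; rewrite !big_cons => -> ->.
Qed.

Variable b : R.
Hypothesis b0 : 0 < b.

Let cascade_ext n t w : cascade Lam b n t w = tint (wprod time_ext b 0 n.+1) `[0, t] w.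
Proof.
apply: eq_Rintegral => s; rewrite inE/= in_itv/= => /andP[s0 _].
rewrite /wprod big_mkord; apply: eq_bigr => j _.
by rewrite /time_ext mulr_ge0// exprn_ge0// ltW.
Qed.

Lemma measurable_cascade n t : measurable_fun setT (cascade Lam b n t).
Proof.
rewrite (funext (cascade_ext n t)); apply: measurable_tint_signed => //.
exact: (@jmeas_wprod _ _ _ time_ext b jmeas_time_ext).
Qed.

(** Uncountably many null sets cannot simply be united. Tonelli's theorem for the indicator [bad]
    shows instead that almost every path is altered on a Lebesgue-null set of times only. *)
Lemma cascade_positive_version n t :
  {ae P, forall w, cascade Lam b n t w = tint (wprod L b 0 n.+1) `[0, t] w}.
Proof.
pose bad j s w : R := (time_ext j (s * b ^+ j) w <= 0)%R%:R.
have bad0 j s w : 0 <= bad j s w by exact: ler0n.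
have mbad j : jmeas (bad j).
  have mf : measurable_fun setT
      (fun q : measurableTypeR R * T => ((q.1 : R) * b ^+ j, q.2) : measurableTypeR R * T).
    by apply: measurable_fun_pair => //; exact: measurable_funM.
  apply: (measurableT_comp (_ : measurable_fun setT (fun x : R => (x <= 0)%R%:R : R))).
    rewrite (_ : (fun _ => _) = \1_(`]-oo, 0])); first exact: measurable_indic.
    by apply/funext => x; rewrite indicE mem_setE in_itv.
  exact: (measurableT_comp (@jmeas_time_ext j) mf).
have mean_bad j s : 0 <= s -> mean P (bad j s) = 0%E.
  move=> s0; have sb : 0 <= s * b ^+ j by rewrite mulr_ge0// exprn_ge0// ltW.
  transitivity (mean P (fun=> 0)); last exact: mean_cst.
  apply: eq_mean_ae => //.
  - exact: jmeas_section.
  - have := positive_version_ae j sb; apply: filterS => w.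
    rewrite /bad /positive_version /time_ext sb => h.
    by rewrite h; case: ifP => // h1; rewrite leNgt ?h1// ltr01.
have ae_bad j : {ae P, forall w,
    {ae lebesgue_measure, forall s : R, `[0, t]%classic s -> time_ext j (s * b ^+ j) w = L j (s * b ^+ j) w}}.
  have : (\int[P]_w \int[lebesgue_measure]_(s in `[0%R, t]) (bad j s w)%:E = 0)%E.
    rewrite mean_etint// (eq_integral (cst 0%E)) ?integral0//.
    by move=> s; rewrite inE/= in_itv/= => /andP[s0 _]; exact: mean_bad.
  have mI : measurable_fun setT (fun w => \int[lebesgue_measure]_(s in `[0%R, t]) (bad j s w)%:E)%E.
    exact: measurable_etint.
  move=> I0; have := @ae_eq_integral_abs _ T R P setT measurableT _ mI.
  rewrite (eq_integral (fun w => \int[lebesgue_measure]_(s in `[0%R, t]) (bad j s w)%:E)%E); last first.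
    by move=> w _; rewrite gee0_abs// integral_ge0// => s _; rewrite lee_fin.
  move=> /iffLR /(_ I0); apply: filterS => w /(_ Logic.I) Iw.
  have mbw : measurable_fun `[0, t] (fun s : R => (bad j s w)%:E).
    by apply/measurable_EFinP; apply: measurable_funTS; exact: jmeas_path.
  have {}Iw : (\int[lebesgue_measure]_(s in `[0%R, t]) `|(bad j s w)%:E| = 0)%E.
    by rewrite -[RHS]Iw; apply: eq_integral => s _; rewrite gee0_abs// lee_fin.
  have /iffLR/(_ Iw) := @ae_eq_integral_abs _ _ R lebesgue_measure `[0, t] (measurable_itv _) _ mbw.
  apply: (filterS (F := almost_everywhere lebesgue_measure)) => s hs /hs [].
  rewrite /bad /positive_version; case: leP => // _ /eqP; by rewrite oner_eq0.
have : {ae P, forall w, forall j, (j < n.+1)%N -> {ae lebesgue_measure, forall s : R,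
    `[0, t]%classic s -> time_ext j (s * b ^+ j) w = L j (s * b ^+ j) w}}.
  by apply: ae_foralln => j; apply: filterS (ae_bad j) => w.
apply: filterS => w hw; rewrite cascade_ext.
have {}hw : {ae lebesgue_measure, forall s : R, `[0, t]%classic s ->
    wprod time_ext b 0 n.+1 s w = wprod L b 0 n.+1 s w}.
  have : {ae lebesgue_measure, forall s : R, forall j, (j < n.+1)%N ->
      `[0, t]%classic s -> time_ext j (s * b ^+ j) w = L j (s * b ^+ j) w}.
    apply: ae_foralln => j; have [jn|jn] := ltnP j n.+1; last exact: aeW.
    by apply: (filterS (F := almost_everywhere lebesgue_measure)) (hw j jn) => s hs _.
  apply: (filterS (F := almost_everywhere lebesgue_measure)) => s hs ts; rewrite /wprod big_nat [RHS]big_nat.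
  by apply: eq_bigr => j /andP[_ jn]; exact: hs.
have mw (F : nat -> R -> T -> R) : (forall j, jmeas (F j)) ->
    measurable_fun `[0, t] (fun s : R => (wprod F b 0 n.+1 s w)%:E).
  move=> mF; apply/measurable_EFinP; apply: measurable_funTS.
  by apply: jmeas_path; exact: jmeas_wprod.
rewrite /tint /Rintegral; congr fine; apply: ae_eq_integral => //.
- exact: mw.
- by apply: mw; exact: jmeas_positive_version.
- by apply: (filterS (F := almost_everywhere lebesgue_measure)) hw => s hs ts; rewrite hs.
Qed.

End positive_version.

(** * Exponential moments of the normal tempered stable law *)

Lemma integral_normal_prob {R : realType} (f : R -> \bar R) : (forall x, (0 <= f x)%E) ->
  measurable_fun setT f ->
  (\int[normal_prob 0 1]_x f x = \int[lebesgue_measure]_x (f x * (normal_pdf 0 1 x)%:E))%E.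
Proof.
move=> f0 mf; have dom := @normal_prob_dominates R 0 1.
rewrite -(Radon_Nikodym_SigmaFinite.change_of_variables dom f0 measurableT mf).
have dI := Radon_Nikodym_SigmaFinite.f_integrable dom.
have mpdf : measurable_fun setT (fun x : R => (normal_pdf 0 1 x)%:E).
  by apply/measurable_EFinP; exact: measurable_normal_pdf.
have := integral_ae_eq measurableT dI mpdf.
move=> /(_ _) ae; apply: ae_eq_integral => //.
- by apply: emeasurable_funM => //; exact: measurable_int dI.
- exact: emeasurable_funM.
apply: filterS (ae _) => [x h _|E _ mE]; first by rewrite h.
by rewrite -Radon_Nikodym_SigmaFinite.f_integral.
Qed.

Lemma normal_mgf {R : realType} (t : R) :
  (\int[normal_prob 0 1]_x (expR (t * x))%:E = (expR (t ^+ 2 / 2))%:E)%E.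
Proof.
have mt : measurable_fun setT (fun x : R => expR (t * x)).
  by apply: measurableT_comp => //; exact: measurable_funM.
rewrite integral_normal_prob; first last.
- exact/measurable_EFinP.
- by move=> x; rewrite lee_fin expR_ge0.
transitivity (\int[lebesgue_measure]_x ((expR (t ^+ 2 / 2))%:E * (normal_pdf t 1 x)%:E))%E.
  apply: eq_integral => x _; rewrite -!EFinM; congr EFin.
  rewrite !normal_pdfE ?oner_eq0// /normal_fun !mulrA ![expR _ * normal_peak _]mulrC -!mulrA.
  by rewrite -!expRD; congr (_ * expR _); rewrite expr1n; field.
rewrite ge0_integralZl_EFin ?expR_ge0//.
- by rewrite integral_normal_pdf mule1.
- by move=> x _; rewrite lee_fin normal_pdf_ge0.
- by apply/measurable_EFinP; exact: measurable_normal_pdf.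
Qed.

Section tempered_stable_mgf.
Context {R : realType} (kappa delta gamma : R) (nu : probability (measurableTypeR R) R).
Hypothesis kappa0 : 0 < kappa.
Hypothesis nu_TS : is_TS kappa delta gamma nu.

Local Notation g := (gamma `^ kappa^-1).

Let mexp (z : R) : measurable_fun setT (fun y : measurableTypeR R => (expR (z * y))%:E).
Proof.
by apply/measurable_EFinP; apply: measurableT_comp => //; exact: measurable_funM.
Qed.

Lemma TS_ae_gt0 : {ae nu, forall y, 0 < y}.
Proof.
exists (~` `]0, +oo[); split => //.
- exact: measurableC.
- by rewrite probability_setC// nu_TS.1 subee.
- by apply: subsetC => y /=; rewrite in_itv/= andbT.
Qed.

Let mgf_lt z : z < g / 2 ->
  (\int[nu]_y (expR (z * y))%:E = (expR (delta * gamma - delta * (g - 2 * z) `^ kappa))%:E)%E.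
Proof.
move=> zg; have := nu_TS.2 z zg; move/(congr1 expeR); rewrite lneK//=.
by rewrite itv_boundlr/= !bnd_simp leey andbT; apply: integral_ge0 => y _; rewrite lee_fin expR_ge0.
Qed.

(** The definition of the law stops short of [z = g / 2]. This end point occurs at [q = k] when [k]
    equals its upper bound, and is reached by monotone convergence. *)
Lemma TS_mgf z : z <= g / 2 ->
  (\int[nu]_y (expR (z * y))%:E = (expR (delta * gamma - delta * (g - 2 * z) `^ kappa))%:E)%E.
Proof.
rewrite le_eqVlt => /predU1P[zE|]; last exact: mgf_lt.
pose u n : R := z - n.+1%:R^-1.
(* On the positive half-line, which carries the law, the integrand increases with the parameter. *)
have D0 (v : R) : (\int[nu]_y (expR (v * y))%:E = \int[nu]_(y in `]0%R, +oo[) (expR (v * y))%:E)%E.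
  rewrite [RHS]integral_mkcond; apply: ae_eq_integral => //.
    by apply/(measurable_restrictT _ _).1 => //; exact: measurable_funTS.
  apply: (filterS (F := almost_everywhere nu)) TS_ae_gt0 => y y0 _; rewrite patchE mem_setE in_itv/= y0//.
rewrite D0.
have uz : u n @[n --> \oo] --> z.
  by rewrite -[X in _ --> X]subr0; apply: cvgB; [exact: cvg_cst|exact: cvg_harmonic].
have limz y : (expR (u n * y))%:E @[n --> \oo] --> (expR (z * y))%:E.
  apply: cvg_EFin; first exact: nearW.
  have uy : u n * y @[n --> \oo] --> z * y by apply: cvgM => //; exact: cvg_cst.
  exact: (cvg_comp _ _ uy (@continuous_expR R (z * y))).
have E n : (\int[nu]_(y in `]0%R, +oo[) (expR (u n * y))%:E =
    (expR (delta * gamma - delta * (2 * n.+1%:R^-1) `^ kappa))%:E)%E.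
  rewrite -D0 mgf_lt; last by rewrite /u -zE ltrBlDr ltrDl invr_gt0.
  have aux (G x : R) : G - 2 * (G / 2 - x) = 2 * x by field.
  by rewrite /u zE aux.
have mono : (\int[nu]_(y in `]0%R, +oo[) (expR (u n * y))%:E)%E @[n --> \oo] -->
    (\int[nu]_(y in `]0%R, +oo[) (expR (z * y))%:E)%E.
  have -> : (\int[nu]_(y in `]0%R, +oo[) (expR (z * y))%:E)%E =
      (\int[nu]_(y in `]0%R, +oo[) limn (fun n => (expR (u n * y))%:E))%E.
    by apply: eq_integral => y _; apply/esym/cvg_lim => //; exact: limz.
  apply: (@cvg_monotone_convergence _ _ R nu `]0, +oo[ (measurable_itv _)
    (fun n y => (expR (u n * y))%:E)).
  - by move=> n; exact: measurable_funTS.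
  - by move=> n y _; rewrite lee_fin expR_ge0.
  - move=> y; rewrite /= in_itv/= andbT => y0 n n' nn'.
    by rewrite lee_fin ler_expR ler_pM2r// lerD2l lerN2 lef_pV2 ?posrE// ler_nat.
have pow0 : (2 * n.+1%:R^-1) `^ kappa @[n --> \oo] --> (0 : R).
  apply/cvgrPdist_lt => e e0.
  have e'0 : 0 < e `^ kappa^-1 / 2 by rewrite divr_gt0// powR_gt0.
  have /cvgrPdist_lt/(_ _ e'0)[N _ hN] := @cvg_harmonic R.
  exists N => // n /hN; rewrite /= !sub0r !normrN !ger0_norm ?powR_ge0 ?invr_ge0// => h.
  have -> : e = (e `^ kappa^-1) `^ kappa.
    by rewrite -powRrM mulVf ?gt_eqF// powRr1// ltW.
  apply: gt0_ltr_powR; rewrite ?nnegrE ?powR_ge0 ?mulr_ge0 ?invr_ge0//.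
  by rewrite mulrC -ltr_pdivlMr.
have lim2 : (expR (delta * gamma - delta * (2 * n.+1%:R^-1) `^ kappa))%:E @[n --> \oo] -->
    (expR (delta * gamma - delta * (g - 2 * z) `^ kappa))%:E.
  apply: cvg_EFin; first exact: nearW.
  have -> : g - 2 * z = 0 by rewrite zE; lra.
  rewrite powR0 ?gt_eqF//.
  have h : delta * gamma - delta * (2 * n.+1%:R^-1) `^ kappa @[n --> \oo] -->
      delta * gamma - delta * 0.
    by apply: cvgB; [exact: cvg_cst|apply: cvgM; [exact: cvg_cst|exact: pow0]].
  exact: (cvg_comp _ _ h (@continuous_expR R _)).
by move: mono; rewrite (funext E) => mono; exact: (cvg_unique _ mono lim2).
Qed.

End tempered_stable_mgf.

Section NTS_mgf.
Context {R : realType} (kappa gamma beta mu delta : R) (D : probability (measurableTypeR R) R).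
Hypothesis kappa0 : 0 < kappa.
Hypothesis D_NTS : is_NTS kappa gamma beta mu delta D.

(** Given [Y = y] the normal part contributes [q ^ 2 * y / 2], so [Y] enters with the parameter
    [z = q * beta + q ^ 2 / 2], for which [gamma ^ (1 / kappa) - 2 * z] is the radicand. *)
Lemma NTS_mgf (q c : R) : 0 <= nts_radicand kappa gamma beta q ->
  (\int[D]_x (expR (q * (x - c)))%:E = (expR (q * (mu - c) + delta * gamma -
     delta * nts_power kappa gamma beta q))%:E)%E.
Proof.
move=> r0; have [nu nu_TS DE] := D_NTS.
pose Phi (p : measurableTypeR R * measurableTypeR R) : measurableTypeR R :=
  mu + beta * p.1 + Num.sqrt p.1 * p.2.
have mPhi : measurable_fun setT Phi.
  apply: measurable_funD; first by apply: measurable_funD => //; exact: measurable_funM.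
  by apply: measurable_funM => //; exact: (measurableT_comp (continuous_measurable_fun (@sqrt_continuous R)) measurable_fst).
have mh : measurable_fun setT (fun x : measurableTypeR R => (expR (q * (x - c)))%:E).
  apply/measurable_EFinP; apply: measurableT_comp => //; apply: measurable_funM => //.
  exact: measurable_funB.
pose z := q * beta + q ^+ 2 / 2.
pose Phi' : {mfun (measurableTypeR R * measurableTypeR R)%type >-> measurableTypeR R} :=
  HB.pack Phi (isMeasurableFun.Build _ _ _ _ _ mPhi).
have -> : (\int[D]_x (expR (q * (x - c)))%:E =
    \int[pushforward (nu \x normal_prob 0 1) Phi']_x (expR (q * (x - c)))%:E)%E.
  apply: eq_measure_integral => B mB _; exact: DE.
rewrite ge0_integral_pushforward//.
rewrite preimage_setT fubini_tonelli1//; first last.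
- by move=> p; rewrite lee_fin expR_ge0.
- exact: measurableT_comp.
have inner y : 0 < y -> (\int[normal_prob 0 1]_e (expR (q * (Phi (y, e) - c)))%:E =
    (expR (q * (mu - c)))%:E * (expR (z * y))%:E)%E.
  move=> y0.
  transitivity (\int[normal_prob 0 1]_e ((expR (q * (mu + beta * y - c)))%:E *
      (expR (q * Num.sqrt y * e))%:E))%E.
    by apply: eq_integral => e _; rewrite -EFinM -expRD; congr (expR _)%:E; rewrite /Phi/=; ring.
  rewrite ge0_integralZl_EFin ?expR_ge0//.
    rewrite normal_mgf -!EFinM -!expRD; congr (expR _)%:E.
    by rewrite exprMn sqr_sqrtr ?ltW// /z; field.
  by apply/measurable_EFinP; apply: measurableT_comp => //; exact: measurable_funM.
transitivity (\int[nu]_y ((expR (q * (mu - c)))%:E * (expR (z * y))%:E))%E.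
  apply: ae_eq_integral => //.
  - apply: (@measurable_fun_fubini_tonelli_F _ _ _ _ R (normal_prob 0 1)).
      exact: (measurableT_comp mh mPhi).
    by move=> p; rewrite lee_fin expR_ge0.
  - apply: emeasurable_funM => //.
    by apply/measurable_EFinP; apply: measurableT_comp => //; exact: measurable_funM.
  - apply: (filterS (F := almost_everywhere nu)) (TS_ae_gt0 nu_TS) => y y0 _.
    exact: inner.
rewrite ge0_integralZl_EFin ?expR_ge0//.
- have zE : gamma `^ kappa^-1 - 2 * z = nts_radicand kappa gamma beta q.
    by rewrite /z /nts_radicand; field.
  rewrite (TS_mgf kappa0 nu_TS); last by rewrite ler_pdivlMr//; move: r0; rewrite -zE; lra.
  by rewrite zE -EFinM -expRD; congr (expR _)%:E; rewrite /nts_power /nts_radicand; ring.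
- by apply/measurable_EFinP; apply: measurableT_comp => //; exact: measurable_funM.
Qed.

End NTS_mgf.

Lemma Lfun_mean {d : measure_display} {T : measurableType d} {R : realType} (P : probability T R)
    (f : T -> R) (q : R) : measurable_fun setT f -> (forall w, 0 <= f w) ->
  (mean P (fun w => f w `^ q)%R < +oo)%E -> f \in Lfun P q%:E.
Proof.
move=> mf f0 fq; apply/andP; split; first by rewrite inE.
rewrite inE /= /finite_norm unlock; apply: poweR_lty; apply: le_lt_trans fq.
rewrite le_eqVlt; apply/orP; left; apply/eqP; apply: eq_integral => w _.
by rewrite /= ger0_norm.
Qed.

Lemma ereal_exp_div {R : realType} (A B : \bar R) (x y : R) :
  (A * (expR x)%:E = (expR y)%:E * B)%E -> A = ((expR (y - x))%:E * B)%E.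
Proof.
move=> AB; have e1 : ((expR x)%:E * (expR (- x))%:E = 1)%E.
  by rewrite -EFinM -expRD subrr expR0.
by rewrite -[A]mule1 -e1 muleA AB muleAC -EFinM -expRD.
Qed.

(** * The copies satisfy the hypotheses on the layers of a cascade *)

Section copies.
Context {R : realType} (d0 : measure_display) (T0 : measurableType d0) (P0 : probability T0 R)
  (d : measure_display) (T : measurableType d) (P : probability T R)
  (kappa mu delta gamma beta lambda : R) (k : nat)
  (D : probability (measurableTypeR R) R) (X : R -> T0 -> R) (Lam : nat -> R -> T -> R).
Hypothesis kappa01 : 0 < kappa < 1.
Hypothesis delta0 : 0 < delta.
Hypothesis gamma0 : 0 < gamma.
Hypothesis beta0 : 0 < beta.
Hypothesis lambda0 : 0 < lambda.
Hypothesis k2 : (2 <= k)%N.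
Hypothesis k_le : k%:R <= Num.sqrt (beta ^+ 2 + gamma `^ kappa^-1) - beta.
Hypothesis D_NTS : is_NTS kappa gamma beta mu delta D.
Hypothesis X_OU : stationary_OU_process P0 D lambda X.

Local Notation c := (nts_center kappa gamma beta mu delta).
Local Notation Mo := (mother X c).
Local Notation lm := (log_moment kappa delta gamma beta).

Hypothesis copies : independent_copies P0 Mo P Lam.
Hypothesis Lam_jmeas : forall j, jointly_measurable (Lam j).

Local Notation L := (positive_version Lam).

Let X_process : is_process X. Proof. by case: X_OU. Qed.

Let k1 : 1 < k%:R :> R. Proof. by rewrite ltr1n. Qed.
Let kR2 : 2 <= k%:R :> R. Proof. by rewrite ler_nat. Qed.

Let measurable_mother : is_process Mo.
Proof.
by move=> t t0; apply: measurableT_comp => //; apply: measurable_funB => //; exact: X_process.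
Qed.

Let Lam_process j : is_process (Lam j). Proof. by case: copies. Qed.

Lemma mother_pow (q : R) : -1 <= q <= k%:R -> mean P0 (fun w => Mo 0 w `^ q) = (expR (lm q))%:E.
Proof.
move=> qk; have [kp0 _] := andP kappa01.
have r0 := nts_radicand_ge0 beta0 k2 k_le qk.
have mX0 : measurable_fun setT (X 0 : T0 -> measurableTypeR R) by exact: X_process.
pose X0 : {mfun T0 >-> measurableTypeR R} := HB.pack (X 0) (isMeasurableFun.Build _ _ _ _ _ mX0).
have mh : measurable_fun setT (fun x : measurableTypeR R => (expR (q * (x - c)))%:E).
  apply/measurable_EFinP; apply: measurableT_comp => //; apply: measurable_funM => //.
  exact: measurable_funB.
have -> : mean P0 (fun w => Mo 0 w `^ q) = (\int[pushforward P0 X0]_x (expR (q * (x - c)))%:E)%E.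
  rewrite ge0_integral_pushforward//.
  rewrite preimage_setT; apply: eq_integral => w _ /=.
  by rewrite /mother -expRM mulrC.
have -> : (\int[pushforward P0 X0]_x (expR (q * (x - c)))%:E = \int[D]_x (expR (q * (x - c)))%:E)%E.
  by apply: eq_measure_integral => B mB _; have [_ _ DX _] := X_OU; exact: DX.
rewrite (NTS_mgf kp0 D_NTS c r0); congr (expR _)%:E.
by rewrite /nts_center /log_moment; ring.
Qed.

(** Positivity at one time is a property of the one-dimensional law, tested with the indicator of
    the nonpositive reals. *)
Lemma copy_ae_gt0 j s : 0 <= s -> P [set w | Lam j s w <= 0] = 0%E.
Proof.
move=> s0; have [_ fdd _] := copies.
pose h (z x : R) : R := if x <= 0 then 1 else 0.
have mh z : measurable_fun setT (h z).
  by apply: measurable_fun_ifT => //; exact: measurable_fun_ler.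
have h0 z x : 0 <= h z x by rewrite /h; case: ifP.
have l0 p : p \in [:: (0 : R, s)] -> 0 <= p.2 by rewrite inE => /eqP->.
have := same_fdd_mean (Lam_process j) measurable_mother (fdd j) mh h0 l0.
rewrite (eq_mean P (g := fun w => \1_[set w | Lam j s w <= 0] w)); last first.
  move=> w; rewrite big_seq1 /h indicE; case: ifPn => hw; first by rewrite mem_set.
  by rewrite memNset//=; exact/negP.
rewrite (eq_mean P0 (g := fun=> 0)); last first.
  by move=> w; rewrite big_seq1 /h leNgt expR_gt0.
rewrite mean_cst /mean integral_indic ?setIT//.
rewrite (_ : [set w | _] = setT `&` Lam j s @^-1` `]-oo, 0]).
  exact: Lam_process.
by rewrite setTI; apply/seteqP; split => w /=; rewrite in_itv.
Qed.

Lemma copy_mean j (l : seq (R * R)) : (forall p, p \in l -> 0 <= p.2) ->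
  mean P (fun w => \prod_(p <- l) L j p.2 w `^ p.1) =
  mean P0 (fun w => \prod_(p <- l) Mo p.2 w `^ p.1).
Proof.
move=> l0; have [_ fdd _] := copies.
rewrite -(mean_positive_version Lam_process Lam_jmeas copy_ae_gt0 j l0).
exact: (same_fdd_mean (Lam_process j) measurable_mother (fdd j)
  (fun z => measurable_powR z) (fun z x => powR_ge0 x z) l0).
Qed.

Let jL j : jmeas (L j). Proof. exact: jmeas_positive_version. Qed.
Let L0 j s w : 0 < L j s w. Proof. exact: positive_version_gt0. Qed.
Let mL j s : measurable_fun setT (L j s). Proof. exact: jmeas_section. Qed.
Let mLq j s q : measurable_fun setT (fun w => L j s w `^ q).
Proof. exact: (measurableT_comp (measurable_powR q)). Qed.

Lemma copy_memory j (l : seq (R * R)) (z t : R) : 0 <= t -> (forall p, p \in l -> t <= p.2) ->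
  let x := \sum_(p <- l) p.1 * expR (- lambda * (p.2 - t)) in
  -1 <= x <= k%:R -> -1 <= z + x <= k%:R ->
  (mean P (fun w => L j t w `^ z * \prod_(p <- l) L j p.2 w `^ p.1)%R * (expR (lm x))%:E =
   (expR (lm (z + x)))%:E * mean P (fun w => \prod_(p <- l) L j p.2 w `^ p.1)%R)%E.
Proof.
move=> t0 lt x xk zxk; have := mother_memory c lambda0 X_OU z t0 lt.
cbv zeta; rewrite -/x !mother_pow//.
have l0 p : p \in l -> 0 <= p.2 by move=> /lt; exact: le_trans.
have zl0 p : p \in (z, t) :: l -> 0 <= p.2 by rewrite inE => /predU1P[->//|/l0].
rewrite -(copy_mean j zl0) -(copy_mean j l0).
by under [X in (X * _)%E = _ -> _]eq_mean do rewrite big_cons/=.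
Qed.

Let lm0 : lm 0 = 0. Proof. exact: log_moment0. Qed.
Let lm1 : lm 1 = 0. Proof. exact: log_moment1. Qed.

Lemma copy_pow (q : R) j s : -1 <= q <= k%:R -> 0 <= s ->
  mean P (fun w => L j s w `^ q) = (expR (lm q))%:E.
Proof.
move=> qk s0; have lt p : p \in ([::] : seq (R * R)) -> s <= p.2 by rewrite in_nil.
have := @copy_memory j _ q s s0 lt; rewrite /= big_nil addr0 lm0 expR0 mule1 => h.
have z0 : -1 <= (0 : R) <= k%:R by have := kR2; lra.
have {}h : mean P (fun w => L j s w `^ q) = ((expR (lm q))%:E * 1)%E.
  rewrite -[X in (_ * X)%E](mean_cst P 1) (eq_mean P (f := fun=> 1)
    (g := fun w => \prod_(p <- [::] : seq (R * R)) L j p.2 w `^ p.1)); last by move=> w; rewrite big_nil.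
  rewrite -(h z0 qk).
  by apply: eq_mean => w; rewrite big_nil mulr1.
by rewrite h mule1.
Qed.

(** The source of all two-time estimates; [x] is the share of the value at time [s] still present in
    the exponent at time [s']. *)
Lemma copy_two j s s' (z z' x : R) : 0 <= s <= s' -> x = expR (- (lambda * (s' - s))) ->
  -1 <= z' <= k%:R -> -1 <= z' * x <= k%:R -> -1 <= z + z' * x <= k%:R ->
  mean P (fun w => L j s w `^ z * L j s' w `^ z') =
    (expR (lm (z + z' * x) + lm z' - lm (z' * x)))%:E.
Proof.
move=> /andP[s0 ss'] xE z'k xk zxk.
have lt p : p \in [:: (z', s')] -> s <= p.2 by rewrite inE => /eqP->.
have := @copy_memory j _ z s s0 lt; rewrite /= big_seq1/= mulNr -xE => /(_ xk zxk).
under [X in (X * _)%E = _ -> _]eq_mean do rewrite big_seq1/=.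
under [X in _ = (_ * X)%E -> _]eq_mean do rewrite big_seq1/=.
rewrite (copy_pow j z'k (le_trans s0 ss')) -EFinM -expRD.
by move=> h; rewrite -[RHS]mule1; apply: ereal_exp_div; rewrite mule1.
Qed.

Let memory_bounds s s' : 0 <= s <= s' -> let x := expR (- (lambda * (s' - s))) in
  [/\ 0 < x, x <= 1 & 1 - x <= lambda * (s' - s)].
Proof.
move=> /andP[_ ss'] x; split; first exact: expR_gt0.
- by rewrite -[1]expR0 ler_expR oppr_le0 mulr_ge0 ?subr_ge0// ltW.
- by have := expR_ge1Dx (- (lambda * (s' - s))); rewrite -/x; lra.
Qed.

Lemma copy_corr j u v : 0 <= u -> 0 <= v -> (1 <= mean P (fun w => L j u w * L j v w)%R)%E.
Proof.
wlog uv : u v / u <= v => [h u0 v0|u0 v0].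
  have [|/ltW vu] := leP u v => [uv|]; first exact: h.
  by rewrite (eq_mean P (g := fun w => L j v w * L j u w)) ?h// => w; rewrite mulrC.
have suv : 0 <= u <= v by rewrite u0.
have [x0 x1 _] := memory_bounds suv; move: x0 x1; set x := expR _ => x0 x1.
rewrite (eq_mean P (g := fun w => L j u w `^ 1 * L j v w `^ 1)); last first.
  by move=> w; rewrite !powRr1// ltW.
have h1 : -1 <= (1 : R) <= k%:R by have := kR2; lra.
have h2 : -1 <= 1 * x <= k%:R by have := kR2; lra.
have h3 : -1 <= 1 + 1 * x <= k%:R by have := kR2; lra.
rewrite (copy_two j suv (erefl x) h1 h2 h3) !mul1r.
rewrite lm1 addr0 lee_fin -[leLHS]expR0 ler_expR subr_ge0.
by apply: (log_moment_corr kappa01 delta0 gamma0 beta0 k2 k_le); lra.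
Qed.

Let slope := lm k%:R / (k%:R - 1) + lm (-1).

Let lmk : 0 <= lm k%:R.
Proof.
apply: (log_moment_ge0_right kappa01 delta0 gamma0 beta0 k2 k_le).
by rewrite lexx (ltW k1).
Qed.

Let slope0 : 0 <= slope.
Proof.
apply: addr_ge0; last exact: (log_moment_ge0_left kappa01 delta0 gamma0 beta0 k2 k_le).
by apply: divr_ge0 => //; rewrite subr_ge0 ltW.
Qed.

(** At most [k - 1] later times, at distance at least [e], carry a total memory of at most
    [(k - 1) * exp (- lambda e)]; [slope] is the cost per unit in [log_moment_far]. *)
Definition far_rate := (k%:R - 1) * slope.

Lemma far_rate_ge0 : 0 <= far_rate.
Proof. by apply: mulr_ge0 => //; rewrite subr_ge0 ltW. Qed.

Lemma copy_far j s t e : (size t < k)%N -> 0 <= s -> 0 <= e -> (forall x, x \in t -> s + e <= x) ->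
  (mean P (fun w => L j s w * \prod_(x <- t) L j x w)%R <=
   (expR (far_rate * expR (- (lambda * e))))%:E * mean P (fun w => \prod_(x <- t) L j x w)%R)%E.
Proof.
move=> tk s0 e0 st; pose l := [seq (1 : R, x) | x <- t].
have lt p : p \in l -> s <= p.2.
  by move=> /mapP[x /st sx ->]; apply: le_trans sx; rewrite lerDl.
have lE w : \prod_(p <- l) L j p.2 w `^ p.1 = \prod_(x <- t) L j x w.
  by rewrite big_map; apply: eq_bigr => x _; rewrite powRr1// ltW.
pose x := \sum_(p <- l) p.1 * expR (- lambda * (p.2 - s)).
have x0 : 0 <= x.
  by rewrite /x big_map; apply: sumr_ge0 => y _; rewrite mul1r expR_ge0.
have xe : x <= (k%:R - 1) * expR (- (lambda * e)).
  apply: (@le_trans _ _ (\sum_(y <- t) expR (- (lambda * e)))).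
    rewrite /x big_map big_seq [leRHS]big_seq; apply: ler_sum => y /st sy.
    by rewrite mul1r ler_expR mulNr lerN2 ler_pM2l// lerBrDr addrC.
  rewrite big_const_seq count_predT iter_addr_0 -[leLHS]mulr_natl ler_wpM2r ?expR_ge0//.
  by rewrite lerBrDr natr1 ler_nat.
have xk : x <= k%:R - 1.
  apply: (le_trans xe); rewrite ler_piMr ?subr_ge0 ?(ltW k1)//.
  by rewrite -[leRHS]expR0 ler_expR oppr_le0 mulr_ge0// ltW.
have x1 : -1 <= x <= k%:R by have := kR2; lra.
have x2 : -1 <= 1 + x <= k%:R by have := kR2; lra.
have := @copy_memory j _ 1 s s0 lt x1 x2; rewrite -/x.
under [X in (X * _)%E = _ -> _]eq_mean do rewrite lE powRr1 ?(ltW (L0 _ _ _))//.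
under [X in _ = (_ * X)%E -> _]eq_mean do rewrite lE.
have : (0 <= mean P (fun w => \prod_(x <- t) L j x w)%R)%E.
  by apply: mean_ge0 => w; apply: prodr_ge0 => y _; exact: ltW.
move=> B0 /ereal_exp_div ->; apply: lee_wpmul2r => //; rewrite lee_fin ler_expR.
have x3 : 0 <= x <= k%:R - 1 by rewrite x0.
apply: (le_trans (log_moment_far kappa01 delta0 gamma0 beta0 k2 k_le x3)); rewrite -/slope.
by rewrite /far_rate mulrAC ler_wpM2r.
Qed.

Lemma copy_low q : 1 <= q < k%:R -> exists2 C, 0 <= C & forall j s s', 0 <= s <= s' ->
  ((expR (- (C * (s' - s))) * expR (lm q))%:E <= mean P (fun w => L j s w `^ (q - 1) * L j s' w)%R)%E.
Proof.
move=> qk; have [C C0 hC] := log_moment_low kappa01 delta0 gamma0 beta0 k2 k_le qk.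
exists (C * lambda); first by rewrite mulr_ge0// ltW.
move=> j s s' ss'; have [x0 x1 xl] := memory_bounds ss'; move: x0 x1 xl; set x := expR _ => x0 x1 xl.
rewrite (eq_mean P (g := fun w => L j s w `^ (q - 1) * L j s' w `^ 1)); last first.
  by move=> w; rewrite powRr1// ltW.
have h1 : -1 <= (1 : R) <= k%:R by have := kR2; lra.
have h2 : -1 <= 1 * x <= k%:R by have := kR2; lra.
have h3 : -1 <= q - 1 + 1 * x <= k%:R by have := kR2; lra.
rewrite (copy_two j ss' (erefl x) h1 h2 h3) !mul1r.
rewrite lm1 addr0 lee_fin -expRD ler_expR.
have := hC (1 - x); rewrite (_ : q - (1 - x) = q - 1 + x); last by ring.
rewrite (_ : 1 - (1 - x) = x); last by ring.
have : C * (1 - x) <= C * lambda * (s' - s) by rewrite -mulrA ler_wpM2l.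
move=> h4 h5; have y01 : 0 <= 1 - x <= 1 by lra.
by have := h5 y01; lra.
Qed.

Lemma copy_up q : 0 < q <= 1 -> exists2 C, 0 <= C & forall j s s', 0 <= s <= s' ->
  (mean P (fun w => L j s w `^ (q - 1) * L j s' w)%R <= (expR (C * (s' - s)) * expR (lm q))%:E)%E.
Proof.
move=> q01; have [C C0 hC] := log_moment_up kappa01 delta0 gamma0 beta0 k2 k_le q01.
exists (C * lambda); first by rewrite mulr_ge0// ltW.
move=> j s s' ss'; have [x0 x1 xl] := memory_bounds ss'; move: x0 x1 xl; set x := expR _ => x0 x1 xl.
rewrite (eq_mean P (g := fun w => L j s w `^ (q - 1) * L j s' w `^ 1)); last first.
  by move=> w; rewrite powRr1// ltW.
have h1 : -1 <= (1 : R) <= k%:R by have := kR2; lra.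
have h2 : -1 <= 1 * x <= k%:R by have := kR2; lra.
have h3 : -1 <= q - 1 + 1 * x <= k%:R by have := kR2; lra.
rewrite (copy_two j ss' (erefl x) h1 h2 h3) !mul1r.
rewrite lm1 addr0 lee_fin -expRD ler_expR.
have := hC (1 - x); rewrite (_ : q - (1 - x) = q - 1 + x); last by ring.
rewrite (_ : 1 - (1 - x) = x); last by ring.
have : C * (1 - x) <= C * lambda * (s' - s) by rewrite -mulrA ler_wpM2l.
move=> h4 h5; have y01 : 0 <= 1 - x <= 1 by lra.
by have := h5 y01; lra.
Qed.

(** Factor [L' - L] through square roots: the mean of the squared difference of the roots is [2]
    minus twice the mean of [sqrt (L L')], which [copy_two] evaluates. *)
Lemma copy_cont e : 0 < e -> exists2 h, 0 < h & forall j s s',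
  0 <= s -> s <= s' <= s + h -> (mean P (fun w => `|L j s' w - L j s w|)%R <= e%:E)%E.
Proof.
move=> e0; have [C C0 hC] := log_moment_sqrt kappa01 delta0 gamma0 beta0 k2 k_le.
(* With [ee = e / 4] below, the squared difference contributes at most [2 * (C * lambda + 1) * h /
   (2 * ee) = e / 2], and the sum of two variables of mean [1] contributes [2 * ee = e / 2]. *)
pose h := e ^+ 2 / (8 * (C * lambda + 1)).
have Cl : 0 < C * lambda + 1 by rewrite ltr_wpDl// mulr_ge0// ltW.
have h0 : 0 < h by rewrite divr_gt0 ?exprn_gt0 ?mulr_gt0.
exists h => // j s s' s0 /andP[ss' s'h].
have sss' : 0 <= s <= s' by rewrite s0.
have s'0 : 0 <= s' by apply: le_trans ss'.
have [x0 x1 xl] := memory_bounds sss'; move: x0 x1 xl; set x := expR _ => x0 x1 xl.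
pose r t w := L j t w `^ 2^-1.
have r0 t w : 0 <= r t w by exact: powR_ge0.
have rr t w : r t w ^+ 2 = L j t w.
  by rewrite -powR_mulrn// -powRrM mulVf ?powRr1// ltW.
have mr t : measurable_fun setT (r t) by exact: mLq.
have mrr : measurable_fun setT (fun w => r s w * r s' w) by exact: measurable_funM.
have rho : mean P (fun w => r s w * r s' w) = (expR (lm (1 - (1 - x) / 2) + lm 2^-1 - lm (2^-1 - (1 - x) / 2)))%:E.
  have h1 : -1 <= (2^-1 : R) <= k%:R by have := kR2; lra.
  have h2 : -1 <= 2^-1 * x <= k%:R by have := kR2; lra.
  have h3 : -1 <= 2^-1 + 2^-1 * x <= k%:R by have := kR2; lra.
  rewrite (copy_two j sss' (erefl x) h1 h2 h3).
  have -> : 2^-1 + 2^-1 * x = 1 - (1 - x) / 2 by move: (x) => y; field.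
  by have -> : 2^-1 * x = 2^-1 - (1 - x) / 2 by move: (x) => y; field.
have L1 t : 0 <= t -> mean P (L j t) = 1%E.
  move=> t0; rewrite (eq_mean P (g := fun w => L j t w `^ 1)); last by move=> w; rewrite powRr1// ltW.
  have h1 : -1 <= (1 : R) <= k%:R by have := kR2; lra.
  by rewrite (copy_pow j h1 t0) lm1 expR0.
pose S w := (r s w - r s' w) ^+ 2.
have mS : measurable_fun setT S by apply: measurable_funX; exact: measurable_funB.
have S0 w : 0 <= S w by exact: sqr_ge0.
have rr0 w : 0 <= r s w * r s' w by exact: mulr_ge0.
have mrr2 : measurable_fun setT (fun w => 2 * (r s w * r s' w)) by exact: measurable_funM.
have ES : (mean P S <= (2 * C * lambda * (s' - s))%:E)%E.
  have := meanD P mS mrr2 S0 (fun w => mulr_ge0 (ler0n _ 2) (rr0 w)).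
  rewrite (meanZ P (ler0n _ 2) mrr rr0) rho.
  rewrite (eq_mean P (g := fun w => L j s w + L j s' w)); last by move=> w; rewrite -!rr /S; ring.
  rewrite (meanD P (mL j s) (mL j s') (fun w => ltW (L0 _ _ _)) (fun w => ltW (L0 _ _ _))) !L1//.
  have y01 : 0 <= 1 - x <= 1 by lra.
  have := hC (1 - x) y01; set y := lm _ + _ - _ => hy.
  have := expR_ge1Dx y.
  have : C * (1 - x) <= C * lambda * (s' - s) by rewrite -mulrA ler_wpM2l.
  case: (mean P S) => [u||] // h1 h2 [h3]; rewrite lee_fin; lra.
pose ee := e / 4; have ee0 : 0 < ee by rewrite divr_gt0.
have i0 : 0 <= (2 * ee)^-1 by rewrite invr_ge0 mulr_ge0// ltW.
pose Q w := L j s w + L j s' w.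
have mQ : measurable_fun setT Q by exact: measurable_funD.
have Q0 w : 0 <= Q w by rewrite addr_ge0// ltW.
apply: (@le_trans _ _ (mean P (fun w => (2 * ee)^-1 * S w + ee * Q w))).
  apply: le_mean.
  - by apply: measurableT_comp => //; exact: measurable_funB.
  - by apply: measurable_funD; exact: measurable_funM.
  - by move=> w; exact: normr_ge0.
  move=> w; rewrite /Q -!rr /S; move: (r s w) (r s' w) (r0 s w) (r0 s' w) => u v u0 v0.
  rewrite (_ : v ^+ 2 - u ^+ 2 = (v - u) * (v + u)); last by ring.
  rewrite normrM (ger0_norm (addr_ge0 v0 u0)) (_ : (u - v) ^+ 2 = `|v - u| ^+ 2); last first.
    by rewrite real_normK ?num_real//; ring.
  set a := `|_|; rewrite -subr_ge0.
  rewrite (_ : _ - _ = (2 * ee)^-1 * (a - ee * (v + u)) ^+ 2 + ee / 2 * (u - v) ^+ 2); last first.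
    by field; rewrite gt_eqF.
  apply: addr_ge0; apply: mulr_ge0; [exact: i0|exact: sqr_ge0| |exact: sqr_ge0].
  by apply: mulr_ge0; [exact: ltW|rewrite invr_ge0].
rewrite (meanD P (measurable_funM (measurable_cst _) mS) (measurable_funM (measurable_cst _) mQ)
  (fun w => mulr_ge0 i0 (S0 w)) (fun w => mulr_ge0 (ltW ee0) (Q0 w))).
rewrite (meanZ P i0 mS S0) (meanZ P (ltW ee0) mQ Q0).
rewrite (meanD P (mL j s) (mL j s') (fun w => ltW (L0 _ _ _)) (fun w => ltW (L0 _ _ _))) !L1//.
apply: (@le_trans _ _ (((2 * ee)^-1)%:E * (2 * C * lambda * (s' - s))%:E + ee%:E * (1 + 1)%:E)%E).
  by rewrite leeD2r//; apply: lee_wpmul2l.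
rewrite -EFinM -?EFinM -?EFinD lee_fin.
have : (2 * ee)^-1 * (2 * C * lambda * (s' - s)) <= e / 2.
  apply: (@le_trans _ _ ((2 * ee)^-1 * (2 * (C * lambda + 1) * h))).
    apply: ler_wpM2l => //; apply: ler_pM; try lra.
      by rewrite !mulr_ge0// ltW.
  by rewrite le_eqVlt; apply/orP; left; apply/eqP; rewrite /h /ee; field; rewrite !gt_eqF.
rewrite /ee; lra.
Qed.

End copies.

(** * Transfer of the abstract limit to the cascade of the copies *)

Theorem theorem9 (R : realType)
  (d0 : measure_display) (T0 : measurableType d0) (P0 : probability T0 R)
  (d : measure_display) (T : measurableType d) (P : probability T R)
  (kappa mu delta gamma beta lambda : R) (qstar : nat)
  (hkappa : 0 < kappa < 1) (hdelta : 0 < delta) (hgamma : 0 < gamma)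
  (hbeta : 0 < beta) (hlambda : 0 < lambda)
  (hbeta_lt : beta < (gamma `^ kappa^-1 - 1) / 2)
  (hqstar2 : (2 <= qstar)%N)
  (hqstar : qstar%:R <= Num.sqrt (beta ^+ 2 + gamma `^ kappa^-1) - beta)
  (D : probability (measurableTypeR R) R)
  (hD : is_NTS kappa gamma beta mu delta D)
  (X : R -> T0 -> R)
  (hX : stationary_OU_process P0 D lambda X)
  (hLam_measurable :
    jointly_measurable (mother X (nts_center kappa gamma beta mu delta)))
  (hLam_separable :
    separable_process P0 (mother X (nts_center kappa gamma beta mu delta)))
  (Lam : nat -> R -> T -> R)
  (hcopies : independent_copies P0
    (mother X (nts_center kappa gamma beta mu delta)) P Lam)
  (hcopies_measurable : forall j, jointly_measurable (Lam j))
  (hcopies_separable : forall j, separable_process P (Lam j))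
  (b : R)
  (hb : expR (- (delta * gamma)
      + (delta * nts_power kappa gamma beta qstar%:R
         - qstar%:R * delta * nts_power kappa gamma beta 1)
        / (1 - qstar%:R)) < b) :
  exists A : R -> T -> R,
    [/\ forall t : R, 0 <= t <= 1 -> measurable_fun [set: T] (A t),
        forall q t : R, 0 < q < qstar%:R -> 0 <= t <= 1 ->
          'E_P[fun w => (`|cascade Lam b n t w - A t w| `^ q)%R]%E
            @[n --> \oo] --> 0%E,
        forall q : R, 0 < q < qstar%:R -> A 1 \in Lfun P q%:E,
        forall q : R, 0 < q < qstar%:R ->
          exists C1 C2 : R, 0 < C1 <= C2 /\
            forall t : R, 0 <= t <= 1 ->
              ((C1 * t `^ scaling_function kappa gamma beta delta b q)%:E
                 <= 'E_P[fun w => (A t w `^ q)%R]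
                 <= (C2 * t `^ scaling_function kappa gamma beta delta b q)%:E)%E
      & forall t : R, 0 <= t <= 1 ->
          (\int[lebesgue_measure]_(u in `[0%R, t])
             \int[lebesgue_measure]_(v in `[0%R, t])
               (joint_mgf P0 X (nts_center kappa gamma beta mu delta) 1 1 u v
                  - 1)
           <= 'V_P[A t])%E].
Proof.
set c := nts_center kappa gamma beta mu delta in hLam_measurable hLam_separable hcopies *.
pose lm := log_moment kappa delta gamma beta.
have b1 := base_gt1 hkappa hdelta hgamma hbeta hqstar2 hqstar hb.
have b0 : 0 < b by exact: lt_trans b1.
have [Lam_process fdd indep] := hcopies.
pose L := positive_version Lam.
have L_gt0 j s w : 0 < L j s w by exact: positive_version_gt0.
have L_jmeas j : jmeas (L j) by exact: jmeas_positive_version.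
have copy_ae_gt0 := copy_ae_gt0 hX hcopies.
have L_indep := positive_version_indep indep.
have m1 : expR (lm 1) = 1 by rewrite /lm log_moment1 expR0.
have m_le1 q : 0 < q <= 1 -> expR (lm q) <= 1.
  move=> /andP[q0 q1]; rewrite -[leRHS]expR0 ler_expR.
  by apply: (log_moment_le0 hkappa hdelta hgamma hbeta hqstar2 hqstar); rewrite (ltW q0).
have m_ge1 q : 1 <= q <= qstar%:R -> 1 <= expR (lm q).
  move=> q1k; rewrite -[leLHS]expR0 ler_expR.
  exact: (log_moment_ge0_right hkappa hdelta hgamma hbeta hqstar2 hqstar).
have m_lt q := log_moment_lt_base hkappa hdelta hgamma hbeta hqstar2 hqstar hb (q := q).
have L_pow q j s : 0 <= q <= qstar%:R -> 0 <= s -> mean P (fun w => L j s w `^ q) = (expR (lm q))%:E.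
  move=> /andP[q0 qk]; apply: (copy_pow hkappa hgamma hbeta hlambda hqstar2 hqstar hD hX hcopies hcopies_measurable).
  by rewrite qk andbT (le_trans _ q0).
have [A [mA A_lim A_scaling A_var]] := cascade_limit_process b1 L_jmeas L_gt0 L_indep hqstar2
  (far_rate_ge0 hkappa hdelta hgamma hbeta hqstar2 hqstar) hlambda
  (fun q => expR_gt0 (lm q)) m1 m_le1 m_ge1 m_lt L_pow
  (copy_far hkappa hdelta hgamma hbeta hlambda hqstar2 hqstar hD hX hcopies hcopies_measurable)
  (copy_cont hkappa hdelta hgamma hbeta hlambda hqstar2 hqstar hD hX hcopies hcopies_measurable)
  (copy_low hkappa hdelta hgamma hbeta hlambda hqstar2 hqstar hD hX hcopies hcopies_measurable)
  (copy_up hkappa hdelta hgamma hbeta hlambda hqstar2 hqstar hD hX hcopies hcopies_measurable)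
  (copy_corr hkappa hdelta hgamma hbeta hlambda hqstar2 hqstar hD hX hcopies hcopies_measurable).
have scE q : q - ln (expR (lm q)) / ln b = scaling_function kappa gamma beta delta b q.
  by rewrite (scaling_functionE hkappa hdelta hgamma hbeta hqstar2 hqstar hb).
exists A; split.
- by move=> t /mA[].
- move=> q t qk t01; have [mAt _] := mA t t01.
  have mt n : measurable_fun setT (tint (wprod L b 0 n.+1) `[0, t]).
    by apply: measurable_tint => //; [exact: jmeas_wprod|exact: wprod_ge0].
  (* For each [n] the two cascades agree almost surely, so the distances to [A t] have the same
     means. *)
  rewrite (_ : (fun n => _) = fun n =>
      mean P (fun w => `|tint (wprod L b 0 n.+1) `[0, t] w - A t w| `^ q)).
    by apply: mean_small_cvg => [n w|]; [exact: powR_ge0|exact: A_lim].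
  have mp (f : T -> R) : measurable_fun setT f -> measurable_fun setT (fun w => `|f w - A t w| `^ q).
    move=> mf; apply: (measurableT_comp (measurable_powR q)).
    by apply: measurableT_comp => //; exact: measurable_funB.
  apply/funext => n; rewrite expectationE; apply: eq_mean_ae.
  + by apply: mp; exact: measurable_cascade.
  + exact: mp.
  + by move=> w; exact: powR_ge0.
  + by move=> w; exact: powR_ge0.
  + have := cascade_positive_version Lam_process hcopies_measurable copy_ae_gt0 b0 n t.
    by apply: filterS => w ->.
- move=> q qk; have t1 : 0 <= (1 : R) <= 1 by rewrite ler01 lexx.
  have [mA1 A10] := mA 1 t1; have [C1 [C2 [_ hC]]] := A_scaling q qk.
  apply: Lfun_mean => //; have /andP[_ h] := hC 1 t1.
  by apply: (le_lt_trans h); rewrite ltry.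
- move=> q qk; have [C1 [C2 [C12 hC]]] := A_scaling q qk.
  by exists C1, C2; split => // t t01; rewrite expectationE -scE; exact: hC.
- move=> t t01; apply: le_trans (A_var t t01).
  rewrite le_eqVlt; apply/orP; left; apply/eqP.
  apply: eq_integral => u; rewrite inE/= in_itv/= => /andP[u0 _].
  apply: eq_integral => v; rewrite inE/= in_itv/= => /andP[v0 _].
  (* The constant in [joint_mgf] is the centring of the mother process at two times, so it is the
     two-time mean of any copy, here of copy [0]. *)
  suff -> : joint_mgf P0 X c 1 1 u v = mean P (fun w => L 0 u w * L 0 v w) by [].
  have l0 p : p \in [:: (1 : R, u); (1, v)] -> 0 <= p.2 by rewrite !inE => /orP[] /eqP->.
  have := copy_mean hX hcopies hcopies_measurable 0 l0.
  rewrite (eq_mean P (g := fun w => L 0 u w * L 0 v w)); last first.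
    by move=> w; rewrite big_cons big_seq1/= !powRr1// ltW.
  move=> ->; rewrite /joint_mgf expectationE -meanZ ?expR_ge0//; last first.
    have [X_process _ _ _] := hX.
    by apply: measurableT_comp => //; apply: measurable_funD; apply: measurable_funM => //; exact: X_process.
  apply: eq_mean => w; rewrite big_cons big_seq1/= !powRr1 ?expR_ge0// /mother -!expRD.
  by congr expR; rewrite -/c; ring.
Qed.
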